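(* For every integer $k\ge 3$, there is a homotopy equivalence \[\mathrm{VR}(T_{3k-1,3k-1};k)\simeq \bigvee_{6k-3} S^2\vee \bigvee_{6k-2}S^3.\] Also, $\mathrm{VR}(T_{5,5};2)\simeq \bigvee_{9}S^2$.
   Context: For a metric space $X$ and $r\ge 0$, $\mathrm{VR}(X;r)$ is the simplicial complex on vertex set $X$ whose simplices are the finite nonempty subsets of diameter at most $r$. $T_{n,n}$ is the set $\{0,\dots,n-1\}^2$ with metric $d((i,j),(i',j'))=\min\{|i-i'|,n-|i-i'|\}+\min\{|j-j'|,n-|j-j'|\}$, i.e. the vertex set of the $n\times n$ torus grid graph with its shortest-path metric. *)

(* Defs.v *)
From HB Require Import structures.
From mathcomp Require Import all_boot all_order all_algebra.
From mathcomp Require Import all_classical all_reals all_analysis.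
From mathcomp Require Import wedge_sigT.
Unset Printing Implicit Defensive.
Import Order.TTheory GRing.Theory Num.Theory.
Local Open Scope classical_set_scope.
Local Open Scope ring_scope.

Definition cyc_dist (n a b : nat) : nat :=
  let d := if (a <= b)%N then (b - a)%N else (a - b)%N in minn d (n - d).

Definition torus_dist (n : nat) (p q : 'I_n * 'I_n) : nat :=
  (cyc_dist n p.1 q.1 + cyc_dist n p.2 q.2)%N.

Definition VR_simplex (n r : nat) (s : {set 'I_n * 'I_n}) : bool :=
  (s != finset.set0) && [forall p in s, [forall q in s, (torus_dist n p q <= r)%N]].

(* Points are barycentric coordinate vectors t : 'M[R]_(n,n) (t i j is the
   weight of vertex (i,j)), nonnegative, summing to 1, whose support is a
   simplex; topologized as a subspace of R^(n*n). *)
Definition supp (R : realType) (n : nat) (t : 'M[R^o]_(n, n)) : {set 'I_n * 'I_n} :=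
  [set p | t p.1 p.2 != 0].

Definition VR_real_set (R : realType) (n r : nat) : set 'M[R^o]_(n, n) :=
  [set t : 'M[R^o]_(n, n) | (forall i j, 0 <= t i j) /\ (\sum_i \sum_j t i j = 1)
           /\ VR_simplex n r (supp R n t)].

Definition VR_torus (R : realType) (n r : nat) : topologicalType :=
  set_type (VR_real_set R n r).

Definition sphere_set (R : realType) (d : nat) : set 'rV[R^o]_(d.+1) :=
  [set x | \sum_i x ord0 i ^+ 2 = 1].

Definition sphere (R : realType) (d : nat) : topologicalType :=
  set_type (sphere_set R d).

Definition sphere_pt_vec (R : realType) (d : nat) : 'rV[R^o]_(d.+1) :=
  \row_i ((i == ord0)%:R).

Lemma sphere_pt_in (R : realType) (d : nat) : sphere_pt_vec R d \in sphere_set R d.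
Proof.
apply/mem_set; rewrite /sphere_set /=.
rewrite (bigD1 ord0) //= big1 ?addr0; first by rewrite mxE eqxx expr1n.
by move=> i /negbTE Hi; rewrite mxE Hi expr0n.
Qed.

Definition sphere_pt (R : realType) (d : nat) : sphere R d :=
  exist _ (sphere_pt_vec R d) (sphere_pt_in R d).

Definition wsph_dim (a b : nat) (i : 'I_(a + b)) : nat :=
  if (i < a)%N then 2%N else 3%N.

Definition wedge_spheres (R : realType) (a b : nat) : topologicalType :=
  @wedge 'I_(a + b) (fun i => sphere R (wsph_dim a b i))
    (fun i => sphere_pt R (wsph_dim a b i)).

Definition unit_interval (R : realType) : topologicalType :=
  set_type (`[0, 1]%classic : set R^o).

Definition homotopic (R : realType) (X Y : topologicalType) (f g : X -> Y) : Prop :=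
  exists H : (unit_interval R * X)%type -> Y,
    continuous H /\
    (forall (s : unit_interval R) x, set_val s = 0 -> H (s, x) = f x) /\
    (forall (s : unit_interval R) x, set_val s = 1 -> H (s, x) = g x).

Definition homotopy_equivalent (R : realType) (X Y : topologicalType) : Prop :=
  exists (f : X -> Y) (g : Y -> X),
    [/\ continuous f, continuous g,
        homotopic R X X (g \o f) idfun & homotopic R Y Y (f \o g) idfun].

(* Main.v *)
(** Write n = 3k - 1.  Call a pair (s, w) consisting of a simplex s of K and a
vertex w outside s a collapsing pair if every simplex containing s can be
enlarged by w; sliding weight from s to w then deforms |K| onto the complex of
the simplices that do not contain s.

Such collapses lower the scale on the torus.  For r = k, ..., 3 one removes from
the complex of cliques of diameter at most r, first the pairs at distance r on a
common grid line together with a third point off that line, and then the other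
pairs at distance r.  What remains, after one more step at r = 2, is the union
of the clique complexes of the 2n horizontal and vertical n-cycles and of two
triangles in each unit square.

In the clique complex of an n-cycle, a top simplex {0, 1, k, 2k} can be chosen
such that the rest collapses to a path of n - 1 edges; for k = 2 the complex is a
full simplex and collapses to this path directly.  The lower triangles of the
2n - 1 squares that meet the seam of the torus are the other critical simplices.
Without them and the 2n tetrahedra (none for k = 2), the diagonals of the seam
squares can be removed, the cycles become paths, and a triangulated square is
left, which collapses to a point.

A complex which collapses to a point after removal of some facets is a wedge of
spheres, one for each facet.  To have explicit formulas, one first attaches a
cone over the collapsible part, and then contracts this cone while stretching
the facets.  All stages of this homotopy descend to the quotient by the cone. *)

(* The diameter cannot simply be lowered everywhere. As n < 3k, three points of a grid line may go
   once around their cycle with all gaps at most k, and the simplices spanned by such wrapping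
   triangles produce the 3-spheres. Hence the intermediate complexes keep every clique of diameter
   at most k inside a line, and a pair on a line is removed only in the presence of a point off that
   line. Such a point spends at least one unit of its distance in the other direction, which leaves
   too little to wrap around; this is what makes an apex one unit away from an end work.

   The gaps of a wrapping triangle are at most k and add up to 3k - 1, so two of them are k and one
   is k - 1. There are n such triangles, and because 3k = 1 modulo n the tetrahedra that join them
   in pairs form one ring for k at least 3. Removing a single tetrahedron breaks the ring, hence one
   3-sphere for each of the 2n = 6k - 2 lines. The squares that meet the seam number n^2 - (n - 1)^2
   = 2n - 1 = 6k - 3. *)
Require Import Defs.
From HB Require Import structures.
From mathcomp Require Import all_boot zify.
Set Implicit Arguments.
Unset Strict Implicit.
Unset Printing Implicit Defensive.

(** * Collapses *)

Section Collapse.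
Variable V : finType.
Implicit Types (K L : {set V} -> bool) (s S : {set V}) (w : V).

Definition down_closed K : Prop :=
  forall S S', K S -> S' \subset S -> S' != set0 -> K S'.

(* Removal of the star of [s] when every simplex above [s] can be enlarged by
   [w], i.e. when the link of [s] is a cone with apex [w]. *)
Inductive collapses : ({set V} -> bool) -> ({set V} -> bool) -> Prop :=
| collapses_eq K L of K =1 L : collapses K L
| collapses_step K L s w of s != set0 & w \notin s
    & (forall S, K S -> s \subset S -> K (w |: S))
    & collapses (fun S => K S && ~~ (s \subset S)) L : collapses K L.

Lemma collapses_trans K L M : collapses K L -> collapses L M -> collapses K M.
Proof.
elim=> {K L} [K L eqKL|K L s w s0 ws Kw _ IH] LM; last first.
  exact: collapses_step s0 ws Kw (IH LM).
elim: LM K eqKL => {L M} [L M eqLM|L M s w s0 ws Lw _ IH] K eqKL.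
  by apply: collapses_eq => S; rewrite eqKL.
apply: (collapses_step s0 ws) => [S|]; first by rewrite !eqKL; exact: Lw.
by apply: IH => S; rewrite eqKL.
Qed.

Lemma collapses_sub K L S : collapses K L -> L S -> K S.
Proof.
by elim=> {K L} [K L ->|K L s w _ _ _ _ IH] // /IH /andP[].
Qed.

(** The last condition keeps the enlarged simplex clear of the faces removed earlier: an [s j]
    inside [w i |: S] that does not contain [w i] would already lie in [S], which avoids it. *)
Lemma collapses_seq (I : eqType) (r : seq I) (s : I -> {set V}) (w : I -> V) K :
  (forall i, i \in r -> s i != set0 /\ w i \notin s i) ->
  (forall r1 i r2, r = r1 ++ i :: r2 -> forall S, K S -> s i \subset S ->
     (forall j, j \in r1 -> ~~ (s j \subset S)) ->
     K (w i |: S) /\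
     (forall j, j \in r1 -> s j \subset w i |: S -> w i \notin s j)) ->
  collapses K (fun S => K S && all (fun i => ~~ (s i \subset S)) r).
Proof.
elim: r K => [|i r IH] K sw rK.
  by apply: collapses_eq => S; rewrite andbT.
have [s0 ws] := sw i (mem_head _ _).
apply: (collapses_step s0 ws).
  move=> S KS sS; have := rK [::] i r erefl S KS sS.
  by case=> // ?; rewrite in_nil.
apply: (collapses_trans (IH _ _ _)).
- by move=> j jr; apply: sw; rewrite inE jr orbT.
- move=> r1 j r2 def_r S /andP[KS siS] sjS r1S.
  have ir1S j' : j' \in i :: r1 -> ~~ (s j' \subset S).
    by rewrite inE => /predU1P[->|/r1S].
  have [KwS r1w] := rK (i :: r1) j r2 (congr1 (cons i) def_r) S KS sjS ir1S.
  split; last by move=> j' j'r; apply: r1w; rewrite inE j'r orbT.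
  rewrite KwS; apply/negP => siwS; move/negP: siS; apply.
  have := r1w i (mem_head _ _) siwS => wsi.
  apply/subsetP => v vsi; have := subsetP siwS v vsi.
  by rewrite in_setU1 => /predU1P[vw|//]; rewrite vw (negPf wsi) in vsi.
- by apply: collapses_eq => S /=; rewrite andbA.
Qed.

(** Indices of equal rank are sorted in an unspecified order. So only faces of strictly smaller rank
    may be assumed absent, while the new vertex must complete no face of smaller or equal rank. *)
Lemma collapses_batch (I : finType) (P : pred I) (rk : I -> nat)
    (s : I -> {set V}) (w : I -> V) K :
  (forall i, P i -> s i != set0 /\ w i \notin s i) ->
  (forall i S, P i -> K S -> s i \subset S ->
     (forall j, P j -> rk j < rk i -> ~~ (s j \subset S)) ->
     K (w i |: S) /\
     (forall j, P j -> rk j <= rk i -> s j \subset w i |: S -> w i \notin s j)) ->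
  collapses K (fun S => K S && [forall i, P i ==> ~~ (s i \subset S)]).
Proof.
move=> sw rK; pose le i j := rk i <= rk j.
have le_tr : transitive le by move=> ? ? ?; exact: leq_trans.
have le_tot : total le by move=> i j; exact: leq_total.
pose r := sort le (enum P).
have memr i : (i \in r) = P i by rewrite mem_sort mem_enum.
apply: (collapses_trans (collapses_seq (r := r) (s := s) (w := w) _ _)).
- by move=> i; rewrite memr; exact: sw.
- move=> r1 i r2 def_r S KS siS r1S.
  have Pi : P i by rewrite -memr def_r mem_cat mem_head orbT.
  have : sorted le r by apply: sort_sorted.
  rewrite def_r sorted_pairwise // pairwise_cat /= => /and3P[le1 _ /andP[le2 _]].
  have lt1 j : P j -> rk j < rk i -> j \in r1.
    rewrite -memr def_r mem_cat inE => /orP[//|/predU1P[->|j2]]; first by rewrite ltnn.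
    by move/allP: le2 => /(_ j j2); rewrite /le leqNgt => /negPf ->.
  have [KwS r1w] := rK i S Pi KS siS (fun j Pj ji => r1S j (lt1 j Pj ji)).
  split=> // j jr1; apply: r1w; first by rewrite -memr def_r mem_cat jr1.
  move/allP: le1 => /(_ j jr1); rewrite /allrel.
  by move/allP=> /(_ i (mem_head _ _)).
- apply: collapses_eq => S; congr andb; apply/allP/forallP => [rS i|PS i].
    by apply/implyP; rewrite -memr; exact: rS.
  by rewrite memr; exact/implyP.
Qed.

End Collapse.

(** * Cliques in a cycle *)

Ltac is_arith T := lazymatch T with
  | is_true (leq _ _) => idtac
  | is_true false => idtac
  | False => idtac
  | ~ ?A => is_arith A
  | is_true (@eq_op ?E _ _) => unify (Equality.sort E) nat
  | is_true (~~ ?b) => is_arith (is_true b)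
  | is_true (?a || ?b) => is_arith (is_true a); is_arith (is_true b)
  | is_true (?a && ?b) => is_arith (is_true a); is_arith (is_true b)
  | @eq ?E _ _ => unify E nat
  | ?A -> ?B => is_arith A; is_arith B
  | ?A \/ ?B => is_arith A; is_arith B
  | ?A /\ ?B => is_arith A; is_arith B
  end.

(* [lia] after discarding the hypotheses it cannot use: preprocessing them is
   what takes time. *)
Ltac nlia := intros; repeat match goal with
  | H : ?T |- _ => lazymatch type of T with Prop =>
      tryif is_arith T then fail else clear H end
  end; lia.

Lemma cyc_dist_le n k a b : a < n -> b < n ->
  (cyc_dist n a b <= k) =
  [|| (a <= b + k) && (b <= a + k), n + b <= k + a | n + a <= k + b].
Proof. by rewrite /cyc_dist => an bn; case: (leqP a b) => ab; lia. Qed.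

Lemma cyc_distC n a b : cyc_dist n a b = cyc_dist n b a.
Proof. by rewrite /cyc_dist; case: (ltngtP a b) => [||->]. Qed.

Lemma cyc_dist0 n a : cyc_dist n a a = 0.
Proof. by rewrite /cyc_dist leqnn subnn min0n. Qed.

Lemma shift_proof n (a : 'I_n) m : (a + m) %% n < n.
Proof. by rewrite ltn_mod; case: a => [a]; case: n. Qed.

Definition shift n (a : 'I_n) m : 'I_n := Ordinal (shift_proof a m).

Lemma shiftE n (a : 'I_n) m : m <= n ->
  (a + m < n /\ shift a m = a + m :> nat) \/
  (n <= a + m /\ shift a m + n = a + m).
Proof.
move=> mn; have an := ltn_ord a; rewrite /shift /=.
have [lt|ge] := ltnP (a + m) n; first by left; rewrite modn_small.
by right; split=> //; rewrite -(subnK ge) modnDr modn_small ?subnK //; nlia.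
Qed.

Lemma ord_eqE n (x y : 'I_n) : (x == y) = (x == y :> nat).
Proof. by []. Qed.

Lemma shift_surj n (a c : 'I_n) : exists2 d, d < n & c = shift a d.
Proof.
have an := ltn_ord a; have cn := ltn_ord c; have [ac|ca] := leqP a c.
  exists (c - a); first nlia.
  by apply: val_inj; rewrite /= subnKC // modn_small.
exists (c + n - a); first nlia.
by apply: val_inj; rewrite /= subnKC ?modnDr ?modn_small //; nlia.
Qed.

Lemma shift_eq n (a : 'I_n) d e : d < n -> e < n ->
  (shift a d == shift a e) = (d == e).
Proof.
move=> dn en; apply/eqP/eqP => [/(congr1 val) /= /eqP|-> //].
by rewrite eqn_modDl !modn_small // => /eqP.
Qed.

Lemma shift0 n (a : 'I_n) : shift a 0 = a.
Proof. by apply: val_inj; rewrite /= addn0 modn_small. Qed.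

Lemma shift_eq0 n (a : 'I_n) d : d < n -> (shift a d == a) = (d == 0).
Proof. by move=> dn; rewrite -{2}(shift0 a) shift_eq //; case: n a dn. Qed.

Lemma shift_shift n (a : 'I_n) d e : shift (shift a d) e = shift a (d + e).
Proof. by apply: val_inj; rewrite /= modnDml addnA. Qed.

Lemma shiftDn n (a : 'I_n) d : shift a (d + n) = shift a d.
Proof. by apply: val_inj; rewrite /= addnA modnDr. Qed.

Lemma cyc_dist_shift n (a : 'I_n) d e : d < n -> e < n ->
  cyc_dist n (shift a d) (shift a e) = cyc_dist n d e.
Proof.
wlog le_de : d e / d <= e => [hw dn en|dn en].
  have [/hw|/ltnW/hw] := leqP d e; first exact.
  by move=> H; rewrite cyc_distC [RHS]cyc_distC; exact: H.
have := shiftE a (ltnW dn); have := shiftE a (ltnW en); rewrite /cyc_dist.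
by rewrite le_de; case: (leqP (shift a d) (shift a e)) => ?; nlia.
Qed.

Definition cyc_clique n k (X : {set 'I_n}) : bool :=
  (X != set0) && [forall x in X, [forall y in X, cyc_dist n x y <= k]].

Lemma cyc_cliqueP n k (X : {set 'I_n}) :
  reflect (X != set0 /\ forall x y, x \in X -> y \in X -> cyc_dist n x y <= k)
          (cyc_clique k X).
Proof.
apply: (iffP andP) => -[X0 XX]; split=> //.
  by move=> x y xX yX; move/forall_inP/(_ x xX)/forall_inP: XX; exact.
by apply/forall_inP => x xX; apply/forall_inP => y yX; exact: XX.
Qed.

Lemma setU1_neq0 (T : finType) (x : T) (X : {set T}) : x |: X != set0.
Proof. by apply/set0Pn; exists x; rewrite setU11. Qed.

Lemma cyc_cliqueU n k (X : {set 'I_n}) (w : 'I_n) : cyc_clique k X ->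
  (forall c, c \in X -> cyc_dist n w c <= k) -> cyc_clique k (w |: X).
Proof.
move=> /cyc_cliqueP[_ XX] wX; apply/cyc_cliqueP; split; first exact: setU1_neq0.
move=> x y; rewrite !in_setU1 => /predU1P[->|xX] /predU1P[->|yX].
- by rewrite cyc_dist0.
- exact: wX.
- by rewrite cyc_distC; exact: wX.
- exact: XX.
Qed.

Lemma sub_set2 (T : finType) (a b : T) (X : {set T}) :
  ([set a; b] \subset X) = (a \in X) && (b \in X).
Proof. by rewrite subUset !sub1set. Qed.

Lemma sub_set3 (T : finType) (a b c : T) (X : {set T}) :
  ([set a; b; c] \subset X) = [&& a \in X, b \in X & c \in X].
Proof. by rewrite !subUset !sub1set andbA. Qed.

Definition lin_cliques n m (X : {set 'I_n}) : bool :=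
  (X != set0) && [forall x in X, [forall y in X, x <= y + m]].

Lemma lin_cliquesP n m (X : {set 'I_n}) :
  reflect (X != set0 /\ forall x y, x \in X -> y \in X -> x <= y + m)
          (lin_cliques m X).
Proof.
apply: (iffP andP) => -[X0 XX]; split=> //.
  by move=> x y xX yX; move/forall_inP/(_ x xX)/forall_inP: XX; exact.
by apply/forall_inP => x xX; apply/forall_inP => y yX; exact: XX.
Qed.

(** Long edges go first: a simplex through a longest remaining edge from [x] to [y] has all its
    vertices between them, so [x + 1] can be added. *)
Lemma collapses_lin n m : 0 < m -> collapses (@lin_cliques n m) (@lin_cliques n 1).
Proof.
move=> m0; pose P (p : 'I_n * 'I_n) := (p.1 + 1 < p.2) && (p.2 <= p.1 + m).
apply: collapses_trans (collapses_batch (P := P) (rk := fun p => m - (p.2 - p.1))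
  (s := fun p => [set p.1; p.2]) (w := fun p => shift p.1 1) _ _) _.
- move=> [x y] /andP[/= xy1 xy2]; have yn := ltn_ord y.
  have h1 := shiftE x (ltac:(nlia) : 1 <= n).
  split; first by apply/set0Pn; exists x; rewrite !inE eqxx.
  by rewrite !inE !ord_eqE; nlia.
- move=> [x y] X /andP[/= xy1 xy2] /lin_cliquesP[_ XX].
  rewrite sub_set2 => /andP[xX yX] rX; have yn := ltn_ord y.
  have h1 := shiftE x (ltac:(nlia) : 1 <= n).
  have arc c : c \in X -> x <= c <= y.
    move=> cX; have xc := XX _ _ xX cX; have cx := XX _ _ cX xX.
    have yc := XX _ _ yX cX; have cy := XX _ _ cX yX.
    apply/andP; split; rewrite leqNgt; apply/negP => h.
      have Pc : P (c, y) by rewrite /P /=; nlia.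
      by have := rX _ Pc; rewrite sub_set2 cX yX /= => H; have := H ltac:(nlia).
    have Pc : P (x, c) by rewrite /P /=; nlia.
    by have := rX _ Pc; rewrite sub_set2 cX xX /= => H; have := H ltac:(nlia).
  have arcw c : c \in shift x 1 |: X -> x <= c <= y.
    by rewrite in_setU1 => /predU1P[->|/arc //]; nlia.
  split.
    apply/lin_cliquesP; split; first exact: setU1_neq0.
    by move=> a b /arcw aX /arcw bX; nlia.
  move=> [a b] /andP[/= ab1 ab2] rk; rewrite sub_set2 => /andP[/arcw aX /arcw bX].
  by rewrite !inE negb_or !ord_eqE; nlia.
apply: collapses_eq => X /=; apply/idP/lin_cliquesP.
  case/andP=> /lin_cliquesP[X0 XX] /forallP nX; split=> // x y xX yX.
  rewrite leqNgt; apply/negP => h; have := nX (y, x).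
  rewrite sub_set2 /= xX yX implybF /P /=; have := XX _ _ xX yX; nlia.
move=> [X0 XX]; apply/andP; split.
  by apply/lin_cliquesP; split=> // x y xX yX; have := XX _ _ xX yX; nlia.
apply/forallP => -[x y]; apply/implyP => /andP[/= xy1 xy2].
by rewrite sub_set2; apply/negP => /andP[xX yX]; have := XX _ _ yX xX; nlia.
Qed.

(** * The clique complex of one cycle of length 3k - 1 *)

Section Cycle.
Variables (n k : nat).
Hypotheses (Hn : n = 3 * k - 1) (Hk : 3 <= k).

Definition wtri (a : 'I_n) : {set 'I_n} := [set a; shift a k; shift a (2 * k)].
(** This is the union of the wrapping triangles at [a] and at [a + k], because [a + 3k = a + 1]
    modulo [n]. *)
Definition wtetra (a : 'I_n) : {set 'I_n} := shift a 1 |: wtri a.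

Lemma wtriP (a : 'I_n) (X : {set 'I_n}) :
  reflect [/\ a \in X, shift a k \in X & shift a (2 * k) \in X] (wtri a \subset X).
Proof. by rewrite sub_set3; exact: and3P. Qed.

(** The last two candidates complete the triangle to [wtetra a] and to the tetrahedron at [a - k],
    which equals [a + 2k - 1] modulo [n]. So each wrapping triangle has two neighbours in the
    ring. *)
Lemma wtri_link (a : 'I_n) (X : {set 'I_n}) c :
  cyc_clique k X -> wtri a \subset X -> c \in X ->
  [|| c == a, c == shift a k, c == shift a (2 * k), c == shift a 1
    | c == shift a (2 * k - 1)].
Proof.
move=> /cyc_cliqueP[_ XX] /wtriP[aX akX a2kX] cX.
rewrite -(shift0 a) in aX; have := XX _ _ aX cX.
have := XX _ _ akX cX; have := XX _ _ a2kX cX.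
have [d dn ->] := shift_surj a c.
rewrite !cyc_dist_shift ?cyc_dist_le ?shift_eq0 ?shift_eq; nlia.
Qed.

(* Since [3 * k = 1] modulo [n], this is the number of steps of length [k] that
   lead from 0 to [a]. *)
Definition ring_rank (a : 'I_n) : nat :=
  if (3 * a < n) then 3 * a else if (3 * a < 2 * n) then 3 * a - n
  else 3 * a - 2 * n.

(** The hypothesis excludes only the step that closes the ring at 0. *)
Lemma ring_rank_shift (a : 'I_n) :
  (0 < shift a k) -> ring_rank (shift a k) = (ring_rank a).+1.
Proof.
have := ltn_ord a; have := ltn_ord (shift a k).
have := shiftE a (ltac:(nlia) : k <= n); rewrite /ring_rank; move: (shift a k : nat) => b.
by case: (ltnP (3 * b) n); case: (ltnP (3 * a) n); try nlia;
  case: (ltnP (3 * b) (2 * n)); case: (ltnP (3 * a) (2 * n)); nlia.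
Qed.

Variable z : 'I_n.
Hypothesis Hz : z = 0 :> nat.

Definition cliques_no_tetra (X : {set 'I_n}) := cyc_clique k X && (X != wtetra z).
Definition cliques_one_tri (X : {set 'I_n}) :=
  cyc_clique k X && [forall a, (a != z) ==> ~~ (wtri a \subset X)].

Lemma shift_wrap (a : 'I_n) d e : d < n -> e <= n ->
  exists2 f, f < n /\ (f = d + e \/ f + n = d + e) & shift (shift a d) e = shift a f.
Proof.
move=> dn en; rewrite shift_shift; have [lt|ge] := ltnP (d + e) n.
  by exists (d + e); [nlia|].
exists (d + e - n); first by nlia.
by rewrite -(shiftDn a (d + e - n)) subnK.
Qed.

Lemma shift1_notin_wtri (a : 'I_n) : shift a 1 \notin wtri a.
Proof. by rewrite !inE shift_eq0 ?shift_eq; nlia. Qed.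

Lemma mem_wtetra (a : 'I_n) d : d < n ->
  (shift a d \in wtetra a) = [|| d == 1, d == 0, d == k | d == 2 * k].
Proof.
move=> dn; rewrite !inE shift_eq0 ?shift_eq; nlia.
Qed.

Lemma wtetra_link (a x : 'I_n) (X : {set 'I_n}) : cyc_clique k X ->
  wtetra a \subset X -> x \in X -> x \in wtetra a.
Proof.
move=> /cyc_cliqueP[_ XX]; rewrite subUset sub1set => /andP[a1X sX] xX.
have /wtriP[] := sX; rewrite -{1}(shift0 a) => aX akX a2kX.
have := XX _ _ aX xX; have := XX _ _ akX xX; have := XX _ _ a2kX xX.
have := XX _ _ a1X xX; have [d dn ->] := shift_surj a x.
rewrite mem_wtetra // !cyc_dist_shift ?cyc_dist_le; nlia.
Qed.

Lemma wtri_sub_wtetra (a b : 'I_n) :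
  wtri b \subset wtetra a -> (b == a) || (b == shift a k).
Proof.
have [d dn ->] := shift_surj a b.
have [e ed E] := shift_wrap a dn (ltac:(nlia) : k <= n).
have [f fd F] := shift_wrap a dn (ltac:(nlia) : 2 * k <= n).
case/wtriP; rewrite E F !mem_wtetra; try nlia.
rewrite shift_eq0 ?shift_eq; nlia.
Qed.

(** The ring is unrolled from the gap left by [wtetra z]: when the turn of [wtri a] comes, the
    tetrahedron at [a - k] is already gone, and [wtri a] disappears together with [wtetra a]. The
    process ends at [wtri z]. *)
Lemma collapses_ring : collapses cliques_no_tetra cliques_one_tri.
Proof.
apply: collapses_trans (collapses_batch (P := fun a : 'I_n => a != z)
  (rk := ring_rank) (s := wtri) (w := fun a => shift a 1) _ _) _.
- move=> a _; split; last exact: shift1_notin_wtri.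
  by apply/set0Pn; exists a; rewrite !inE eqxx.
- move=> a X az /andP[XX XN] sX rkX.
  have [aX akX a2kX] := wtriP _ _ sX.
  have XT : X \subset wtetra a.
    apply/subsetP => c cX; have := wtri_link XX sX cX.
    rewrite !inE => /or4P[-> | -> | -> | /orP[-> | /eqP cE]]; rewrite ?orbT //.
    (* The remaining candidate [c] is [a - k]. Its triangle consists of [c], [a] and [a + k], so it
       lies in [X] although it was removed before, or [c = z] and [X] is the missing tetrahedron. *)
    exfalso; have ca : shift c k = a.
      by rewrite cE shift_shift (_ : _ + _ = 0 + n) ?shiftDn ?shift0 //; nlia.
    have cak : shift c (2 * k) = shift a k.
      by rewrite cE shift_shift (_ : _ + _ = k + n) ?shiftDn ?shift0 //; nlia.
    have scX : wtri c \subset X by apply/wtriP; rewrite ca cak.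
    have [cz|cz] := eqVneq c z.
      have c1X : shift c 1 \in X.
        by move: a2kX; rewrite -ca shift_shift (_ : _ + _ = 1 + n) ?shiftDn //; nlia.
      have sX4 : wtetra c \subset X by rewrite subUset sub1set scX c1X.
      move/negP: XN; apply; rewrite eqEsubset -cz sX4 andbT.
      apply/subsetP => x; exact: wtetra_link XX sX4.
    have a0 : 0 < a by move: az; rewrite ord_eqE Hz; nlia.
    have := ring_rank_shift (a := c); rewrite ca => /(_ a0) rka.
    by move/negP: (rkX c cz (ltac:(rewrite rka; nlia))); apply.
  have wXT : shift a 1 |: X \subset wtetra a by rewrite subUset sub1set setU11.
  have notz j : j != z -> wtri j \subset shift a 1 |: X -> (j == a) || (j == shift a k).
    by move=> _ sj; apply: wtri_sub_wtetra; exact: subset_trans wXT.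
  split; last first.
    move=> j jz rkj /[dup] sj /(notz j jz) /orP[/eqP->|/eqP jE].
      exact: shift1_notin_wtri.
    move: rkj; rewrite jE ring_rank_shift; first by nlia.
    by move: jz; rewrite jE ord_eqE Hz; nlia.
  apply/andP; split.
    apply: cyc_cliqueU => // c /(subsetP XT); have [d dn ->] := shift_surj a c.
    rewrite mem_wtetra // cyc_dist_shift ?cyc_dist_le; nlia.
  apply/eqP => wXE; have /wtri_sub_wtetra : wtri a \subset wtetra z.
    by rewrite -wXE; exact: subset_trans (subsetUr _ _).
  rewrite (negPf az) /= => /eqP az'.
  have : wtri z \subset wtetra a.
    by apply: subset_trans wXT; rewrite wXE subsetUr.
  move=> /wtri_sub_wtetra; rewrite eq_sym (negPf az) /= az' shift_shift eq_sym.
  rewrite shift_eq0; nlia.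
(* [wtetra z] contains the removed triangle at [shift z k], so [cliques_one_tri] excludes it without
   naming it. *)
apply: collapses_eq => X /=; rewrite /cliques_one_tri /cliques_no_tetra.
case: cyc_clique => //=; case: eqP => [->|_] //=; symmetry; apply/negbTE/negP.
move=> /forallP /(_ (shift z k)); rewrite ord_eqE /= Hz add0n modn_small; last nlia.
rewrite (_ : k != 0) /=; last nlia.
move=> /wtriP; apply; rewrite !shift_shift (_ : k + 2 * k = 1 + n); last by nlia.
by rewrite shiftDn !mem_wtetra; try split; nlia.
Qed.

(** Since the gaps are k, k and k - 1, the place of the short gap tells which of [x], [y], [c] is
    the base of the wrapping triangle; only base 0 is allowed. The condition is in linear order so
    that [lia] can use it. *)
Lemma cliques_one_triP (X : {set 'I_n}) :
  reflect (cyc_clique k X /\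
    forall x y c : 'I_n, x \in X -> y \in X -> c \in X -> x < y < c -> y <= x + k ->
      c <= y + k -> n + x <= c + k -> [&& x == 0 :> nat, y == k :> nat & c == 2 * k :> nat])
    (cliques_one_tri X).
Proof.
apply: (iffP andP) => -[XX tX]; split=> //.
  move=> x y c xX yX cX xyc xy yc cx.
  have xn := ltn_ord x; have yn := ltn_ord y; have cn := ltn_ord c.
  have noT (a : 'I_n) : 0 < a -> ~~ (wtri a \subset X).
    move=> a0; move/forallP: tX => /(_ a) /implyP; apply.
    by apply: contraTneq a0 => ->; rewrite Hz.
  have TX (a b d : 'I_n) : a \in X -> b \in X -> d \in X -> 0 < a ->
      (a + k == b :> nat) || (a + k == b + n :> nat) ->
      (a + 2 * k == d :> nat) || (a + 2 * k == d + n :> nat) -> False.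
    move=> aX bX dX a0 ab ad; move/negP: (noT a a0); apply; apply/wtriP; split=> //.
      rewrite (_ : shift a k = b) //; apply/val_inj => /=.
      have bn := ltn_ord b; case/orP: ab => /eqP->; first by rewrite modn_small.
      by rewrite modnDr modn_small.
    rewrite (_ : shift a (2 * k) = d) //; apply/val_inj => /=.
    have dn := ltn_ord d; case/orP: ad => /eqP->; first by rewrite modn_small.
    by rewrite modnDr modn_small.
  have [/TX T1 /TX T2 /TX T3] := And3 xX yX cX.
  have [cE|cN] := eqVneq (c : nat) (x + 2 * k).
    have [//|xN] := boolP [&& x == 0 :> nat, y == k :> nat & c == 2 * k :> nat].
    by exfalso; apply: (T1 y c yX cX); nlia.
  by exfalso; have [yE|yN] := eqVneq (y : nat) (x + k);
    [apply: (T3 x y xX yX) | apply: (T2 c x cX xX)]; nlia.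
apply/forallP => a; apply/implyP => az; apply/negP => /wtriP[aX akX a2kX].
have an := ltn_ord a; have a0 : 0 < a.
  by move: az; rewrite ord_eqE Hz; nlia.
have hk := shiftE a (ltac:(nlia) : k <= n).
have h2k := shiftE a (ltac:(nlia) : 2 * k <= n).
have := tX _ _ _ aX akX a2kX; have := tX _ _ _ a2kX aX akX; have := tX _ _ _ akX a2kX aX.
nlia.
Qed.

(* The edges across 0 that are removed; [{n - 1, 0}] and [{2 * k, 0}] are left, as
   they need a different apex. *)
Definition wrap (p : 'I_n * 'I_n) : bool :=
  [&& p.2 < p.1, p.2 + n <= p.1 + k & p.1 + 1 < p.2 + n] &&
  ~~ ((p.1 == 2 * k :> nat) && (p.2 == 0 :> nat)).

Definition wrap_rank (p : 'I_n * 'I_n) : nat := k - (p.2 + n - p.1).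

Definition cliques_no_wrap (X : {set 'I_n}) :=
  cliques_one_tri X && [forall p, wrap p ==> ~~ ([set p.1; p.2] \subset X)].

(** This repeats [collapses_lin] across 0, longest edges first. The edge from 2k to 0 has to wait:
    it also lies in the triangle 0, k, 2k, and the usual apex 2k + 1 is too far from k. Hence the
    exception in [arc]. *)
Lemma collapses_wrap : collapses cliques_one_tri cliques_no_wrap.
Proof.
apply: (collapses_batch (rk := wrap_rank) (s := fun p => [set p.1; p.2])
  (w := fun p => shift p.1 1)) => [[x y] /andP[/= W _]|[x y] X W KX].
  have xn := ltn_ord x; have yn := ltn_ord y.
  have h1 := shiftE x (ltac:(nlia) : 1 <= n).
  split; first by apply/set0Pn; exists x; rewrite !inE eqxx.
  by rewrite !inE !ord_eqE; nlia.
have /cliques_one_triP[XX tX] := KX; have /cyc_cliqueP[_ XX'] := XX.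
have /andP[/= W1 W2] := W; rewrite sub_set2 => /andP[xX yX] rX.
have xn := ltn_ord x; have yn := ltn_ord y; have zn := ltn_ord z.
have h1 := shiftE x (ltac:(nlia) : 1 <= n).
have arc c : c \in X -> [|| x <= c, c <= y | (c == 2 * k :> nat) && (y == 0 :> nat)].
  move=> cX; have cn := ltn_ord c.
  have tc := tX _ _ _ yX cX xX.
  have rc1 : wrap (x, c) -> wrap_rank (x, c) < wrap_rank (x, y) -> False.
    by move=> Wc rc; have := rX _ Wc rc; rewrite sub_set2 xX cX.
  have rc2 : wrap (c, y) -> wrap_rank (c, y) < wrap_rank (x, y) -> False.
    by move=> Wc rc; have := rX _ Wc rc; rewrite sub_set2 yX cX.
  have := XX' _ _ xX cX; have := XX' _ _ yX cX; rewrite !cyc_dist_le // => yc xc.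
  have [cy|cy] := leqP c y; first by rewrite orbT.
  have [//|cx] := leqP x c; apply: contraT => /= sp.
  have c1 : c <= y + k.
    rewrite leqNgt; apply/negP => h.
    by apply: rc2; rewrite /wrap /wrap_rank /=; clear rc1 tc; nlia.
  have c2 : x <= c + k.
    rewrite leqNgt; apply/negP => h.
    by apply: rc1; rewrite /wrap /wrap_rank /=; clear rc2 tc; nlia.
  by have := tc (ltac:(nlia)) c1 c2 (ltac:(nlia)); clear rc1 rc2 tc; nlia.
have arcw c : c \in shift x 1 |: X ->
    [|| x <= c, c <= y | (c == 2 * k :> nat) && (y == 0 :> nat)].
  by rewrite in_setU1 => /predU1P[->|/arc //]; nlia.
split.
  apply/cliques_one_triP; split.
    apply: cyc_cliqueU => // c /arc ac; have cn := ltn_ord c.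
    by rewrite cyc_dist_le //; nlia.
  move=> a b c /arcw aX /arcw bX /arcw cX; have := ltn_ord c; nlia.
move=> [a b] /= /andP[/= Wa1 Wa2] ra; rewrite sub_set2 => /andP[/arcw aX /arcw bX].
have an := ltn_ord a; have bn := ltn_ord b.
rewrite /wrap_rank /= in ra; rewrite !inE negb_or !ord_eqE; nlia.
Qed.

Lemma cliques_no_wrapP (X : {set 'I_n}) :
  reflect (cliques_one_tri X /\ forall x y, x \in X -> y \in X -> ~~ wrap (x, y))
    (cliques_no_wrap X).
Proof.
apply: (iffP andP) => -[XX wX]; split=> //.
  move=> x y xX yX; move/forallP: wX => /(_ (x, y)).
  by rewrite sub_set2 xX yX implybF.
apply/forallP => -[x y]; apply/implyP => W; rewrite sub_set2; apply/negP => /andP[xX yX].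
by move: W; rewrite (negPf (wX _ _ xX yX)).
Qed.

(** Only 2k is still joined to both ends of the edge from n - 1 to 0. Once that edge is gone, only k
    is joined to both ends of the edge from 2k to 0, and the last wrapping triangle goes with it;
    then nothing crosses 0. *)
Lemma collapses_unwrap : collapses cliques_no_wrap (@lin_cliques n k).
Proof.
have ex d : d < n -> exists v : 'I_n, v = d :> nat by move=> dn; exists (Ordinal dn).
have [m hm] := ex (2 * k) (ltac:(nlia)); have [v hk] := ex k (ltac:(nlia)).
have [l hl] := ex (n - 1) (ltac:(nlia)).
have zN : z < n := ltn_ord z.
apply: (@collapses_step _ _ _ [set l; z] m).
- by apply/set0Pn; exists z; rewrite !inE eqxx orbT.
- by rewrite !inE !ord_eqE; nlia.
- move=> X /cliques_no_wrapP[/cliques_one_triP[XX tX] wX].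
  rewrite sub_set2 => /andP[lX zX]; have /cyc_cliqueP[_ XX'] := XX.
  have arcw c : c \in m |: X -> [|| c == 0 :> nat, c == 2 * k :> nat | c == n - 1 :> nat].
    rewrite in_setU1 => /predU1P[->|cX]; first by nlia.
    have cn := ltn_ord c; have ln := ltn_ord l.
    have := wX _ _ lX cX; have := wX _ _ cX zX; have := XX' _ _ zX cX.
    have := XX' _ _ lX cX; rewrite /wrap /= !cyc_dist_le //; nlia.
  apply/cliques_no_wrapP; split; first (apply/cliques_one_triP; split).
  + apply: cyc_cliqueU => // c cX; have := arcw c (ltac:(by rewrite in_setU1 cX orbT)).
    by have cn := ltn_ord c; rewrite cyc_dist_le; nlia.
  + by move=> a b c /arcw aX /arcw bX /arcw cX; nlia.
  + by move=> a b /arcw aX /arcw bX; rewrite /wrap /=; nlia.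
apply: (@collapses_step _ _ _ [set m; z] v).
- by apply/set0Pn; exists z; rewrite !inE eqxx orbT.
- by rewrite !inE !ord_eqE; nlia.
- move=> X /andP[/cliques_no_wrapP[/cliques_one_triP[XX tX] wX] lX].
  rewrite sub_set2 => /andP[mX zX]; have /cyc_cliqueP[_ XX'] := XX.
  have arcw c : c \in v |: X -> [|| c == 0 :> nat, c == 2 * k :> nat | c == k :> nat].
    rewrite in_setU1 => /predU1P[->|cX]; first by nlia.
    have cl : c != n - 1 :> nat.
      apply: contraNneq lX => cl; rewrite sub_set2 zX andbT.
      by rewrite (_ : l = c) //; apply: val_inj; rewrite /= hl.
    have cn := ltn_ord c.
    have := wX _ _ mX cX; have := wX _ _ cX zX; have := XX' _ _ zX cX.
    have := XX' _ _ mX cX; rewrite /wrap /= !cyc_dist_le //; nlia.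
  rewrite sub_set2; apply/andP; split; last first.
    by apply/negP => /andP[/arcw lX' _]; nlia.
  apply/cliques_no_wrapP; split; first (apply/cliques_one_triP; split).
  + apply: cyc_cliqueU => // c cX; have := arcw c (ltac:(by rewrite in_setU1 cX orbT)).
    by have cn := ltn_ord c; rewrite cyc_dist_le //; nlia.
  + by move=> a b c /arcw aX /arcw bX /arcw cX; nlia.
  + by move=> a b /arcw aX /arcw bX; rewrite /wrap /=; nlia.
apply: collapses_eq => X; apply/idP/lin_cliquesP.
  rewrite !sub_set2 => /andP[/andP[/cliques_no_wrapP[/cliques_one_triP[XX tX] wX] lX] mX].
  have /cyc_cliqueP[X0 XX'] := XX; split=> // x y xX yX.
  have xn := ltn_ord x; have yn := ltn_ord y.
  have := XX' _ _ xX yX; rewrite cyc_dist_le // => xy.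
  rewrite leqNgt; apply/negP => h; have := wX _ _ xX yX; rewrite /wrap /=.
  have [/eqP y0|y0] := boolP (y == z); last by move: y0; rewrite ord_eqE; nlia.
  move: lX mX; rewrite -y0 yX !andbT => lX mX.
  have xl : x != l by apply: contraNneq lX => <-.
  have xm : x != m by apply: contraNneq mX => <-.
  by move: xl xm; rewrite !ord_eqE y0; nlia.
move=> [X0 XX]; rewrite !sub_set2.
have XXn x y : x \in X -> y \in X -> [/\ x <= y + k, y <= x + k, x < n & y < n].
  by move=> xX yX; split; rewrite ?XX.
apply/andP; split; last by apply/negP => /andP[/XXn h /h[]]; nlia.
apply/andP; split; last by apply/negP => /andP[/XXn h /h[]]; nlia.
apply/cliques_no_wrapP; split; first (apply/cliques_one_triP; split).
+ apply/cyc_cliqueP; split=> // x y xX yX; have [? ? ? ?] := XXn _ _ xX yX.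
  by rewrite cyc_dist_le; nlia.
+ by move=> a b c aX bX cX; have [] := XXn _ _ aX cX; nlia.
+ by move=> a b aX bX; have [] := XXn _ _ aX bX; rewrite /wrap /=; nlia.
Qed.

Lemma collapses_cycle : collapses cliques_no_tetra (@lin_cliques n 1).
Proof.
apply: collapses_trans collapses_ring _; apply: collapses_trans collapses_wrap _.
apply: collapses_trans collapses_unwrap _; apply: collapses_lin; nlia.
Qed.

End Cycle.

(** * The grid complex *)

Lemma negb_neq (a b : bool) : a != b -> ~~ a = b.
Proof. by case: a b => [] []. Qed.

Section Grid.
Variable n : nat.
Implicit Types (d : bool) (p q : 'I_n * 'I_n) (S : {set 'I_n * 'I_n}).
Implicit Types (X s : {set 'I_n}) (j x : 'I_n) (T : pred ('I_n * 'I_n)).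
Implicit Types RC : {set 'I_n} -> bool.

(* [d = true] refers to horizontal lines and steps, [d = false] to vertical ones. *)
Definition along d p : 'I_n := if d then p.1 else p.2.
Definition across d p : 'I_n := if d then p.2 else p.1.
Definition on_line d j x : 'I_n * 'I_n := if d then (x, j) else (j, x).

Lemma along_on_line d j x : along d (on_line d j x) = x. Proof. by case: d. Qed.
Lemma across_on_line d j x : across d (on_line d j x) = j. Proof. by case: d. Qed.
Lemma across_negb_on_line d j x : across (~~ d) (on_line d j x) = x.
Proof. by case: d. Qed.
Lemma on_lineK d p : on_line d (across d p) (along d p) = p.
Proof. by case: d p => [] []. Qed.

Definition in_line d S := [forall p in S, [forall q in S, across d p == across d q]].

Lemma in_lineP d S :
  reflect (forall p q, p \in S -> q \in S -> across d p = across d q) (in_line d S).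
Proof.
apply: (iffP forall_inP) => [H p q pS qS|H p pS]; last first.
  by apply/forall_inP => q qS; apply/eqP; exact: H.
by move/forall_inP: (H p pS) => /(_ q qS)/eqP.
Qed.

Definition step d p : 'I_n * 'I_n :=
  if d then (shift p.1 1, p.2) else (p.1, shift p.2 1).
Definition diag p : 'I_n * 'I_n := (shift p.1 1, shift p.2 1).
Definition tri d p : {set 'I_n * 'I_n} := [set p; step d p; diag p].

Definition in_tri (T : pred ('I_n * 'I_n)) S :=
  [exists d, exists p, T p && (S \subset tri d p)].

Lemma in_triP T S :
  reflect (exists d p, T p /\ S \subset tri d p) (in_tri T S).
Proof.
apply: (iffP existsP) => [[d /existsP[p /andP[Tp Sp]]]|[d [p [Tp Sp]]]].
  by exists d, p.
by exists d; apply/existsP; exists p; rewrite Tp.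
Qed.

(* Horizontal and vertical copies of the complex [RC] on the cycle, together
   with the two triangles of each unit square whose lower left corner is in [T]. *)
Definition grid (RC : {set 'I_n} -> bool) (T : pred ('I_n * 'I_n)) S : bool :=
  (S != set0) &&
  ([exists d, in_line d S && RC (along d @: S)] || in_tri T S).

Lemma gridP RC T S :
  reflect (S != set0 /\ ((exists d, in_line d S /\ RC (along d @: S)) \/ in_tri T S))
    (grid RC T S).
Proof.
apply: (iffP andP) => -[S0 H]; split=> //.
  case/orP: H => [/existsP[d /andP[]]|]; first by left; exists d.
  by right.
by case: H => [[d [dS RS]]|->]; rewrite ?orbT //; apply/orP; left; apply/existsP; exists d; rewrite dS.
Qed.

Definition inner p : bool := (p.1 + 1 < n) && (p.2 + 1 < n).

Lemma mem_tri d p q : inner p -> q \in tri d p ->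
  [\/ q.1 = p.1 :> nat /\ q.2 = p.2 :> nat,
      q.1 = p.1 + d :> nat /\ q.2 = p.2 + ~~ d :> nat |
      q.1 = p.1 + 1 :> nat /\ q.2 = p.2 + 1 :> nat].
Proof.
case: p q => [a b] [c e] /andP[/= an bn].
have := shiftE a (ltac:(nlia) : 1 <= n); have := shiftE b (ltac:(nlia) : 1 <= n).
rewrite !inE -orbA /step /diag /= => hb ha.
by case: d => /or3P[] /eqP[-> ->] /=;
  [constructor 1 | constructor 2 | constructor 3 |
   constructor 1 | constructor 2 | constructor 3]; nlia.
Qed.

Lemma tri_along d e p q q' : inner p -> q \in tri d p -> q' \in tri d p ->
  along e q <= along e q' + 1.
Proof.
move=> ip /(mem_tri ip) + /(mem_tri ip).
by case: e d => [] [] /= [[] | [] | []] ? ? [[] | [] | []] ? ?; nlia.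
Qed.

Lemma line_sub_tri d j s T S : (forall p, T p -> inner p) ->
  s != set0 -> ~~ lin_cliques 1 s -> on_line d j @: s \subset S -> ~~ in_tri T S.
Proof.
move=> Ti s0 sN sS; apply: contra sN => /in_triP[d' [p [/Ti ip Sp]]].
apply/lin_cliquesP; split=> // x y xs ys.
have xp : on_line d j x \in tri d' p.
  by apply/(subsetP Sp)/(subsetP sS); exact: imset_f.
have yp : on_line d j y \in tri d' p.
  by apply/(subsetP Sp)/(subsetP sS); exact: imset_f.
by have := tri_along d ip xp yp; rewrite !along_on_line.
Qed.

Lemma two_lines d j s S : s != set0 -> ~~ lin_cliques 1 s ->
  on_line d j @: s \subset S -> ~~ in_line (~~ d) S.
Proof.
move=> s0 sN sS; apply: contra sN => /in_lineP SL; apply/lin_cliquesP; split=> // x y xs ys.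
have := SL (on_line d j x) (on_line d j y).
rewrite !across_negb_on_line => -> //; first by nlia.
  by apply: (subsetP sS); exact: imset_f.
by apply: (subsetP sS); exact: imset_f.
Qed.

Lemma grid_line RC T d j s S : (forall p, T p -> inner p) ->
  s != set0 -> ~~ lin_cliques 1 s -> on_line d j @: s \subset S -> grid RC T S ->
  RC (along d @: S) /\ S = on_line d j @: (along d @: S).
Proof.
move=> Ti s0 sN sS /gridP[_ [[d' [SL RS]]|]]; last first.
  by move=> St; move: (line_sub_tri Ti s0 sN sS); rewrite St.
have dd : d' = d.
  apply: contraTeq SL; rewrite eq_sym => /negb_neq <-; exact: two_lines s0 sN sS.
move: RS SL; rewrite {}dd => RS /in_lineP SL; split=> //.
have [x xs] := set0Pn _ s0.
have xS : on_line d j x \in S by apply: (subsetP sS); exact: imset_f.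
rewrite -imset_comp; apply/setP => p; apply/idP/imsetP => [pS|[q qS ->]].
  by exists p; rewrite //= -[in LHS](on_lineK d p) (SL _ _ pS xS) across_on_line.
have := SL _ _ qS xS; rewrite across_on_line => <- /=.
by rewrite on_lineK.
Qed.

Lemma imset_on_line_sub d j s X :
  (on_line d j @: s \subset on_line d j @: X) = (s \subset X).
Proof.
apply/idP/idP => [|/imsetS->//] sX; apply/subsetP => x xs.
have := subsetP sX _ (imset_f _ xs) => /imsetP[y yX /(congr1 (along d))].
by rewrite !along_on_line => ->.
Qed.

Lemma along_on_line_imset d j X : along d @: (on_line d j @: X) = X.
Proof.
rewrite -imset_comp (eq_imset (g := id)) ?imset_id // => x /=; exact: along_on_line.
Qed.

Lemma in_line_on_line d j X : in_line d (on_line d j @: X).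
Proof.
by apply/in_lineP => p q /imsetP[x _ ->] /imsetP[y _ ->]; rewrite !across_on_line.
Qed.

Lemma grid_on_line RC T d j X : X != set0 -> RC X -> grid RC T (on_line d j @: X).
Proof.
move=> X0 RX; apply/gridP; split; first by rewrite imset_eq0.
by left; exists d; rewrite in_line_on_line along_on_line_imset.
Qed.

(** A face removed on the cycle has two points more than one step apart, since the path survives. On
    the torus its copies therefore determine their line and its direction and lie in no inner
    triangle, so the 2n lines do not interfere and all copies may have the same rank. *)
Lemma collapses_lines RC RC' T : (forall p, T p -> inner p) ->
  (forall X, lin_cliques 1 X -> RC' X) ->
  collapses RC RC' -> collapses (grid RC T) (grid RC' T).
Proof.
move=> Ti lRC' col; elim: col lRC' => {RC RC'} [RC RC' eqRC _|RC RC' s w s0 ws RCw col IH lRC'].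
  apply: collapses_eq => S; rewrite /grid; congr (_ && (_ || _)).
  by apply: eq_existsb => d; rewrite eqRC.
have sN : ~~ lin_cliques 1 s.
  by apply/negP => /lRC' /(collapses_sub col) /andP[_]; rewrite subxx.
pose I := (bool * 'I_n)%type.
apply: collapses_trans (IH lRC').
apply: collapses_trans (collapses_batch (P := xpredT) (rk := fun=> 0)
  (s := fun i : I => on_line i.1 i.2 @: s) (w := fun i => on_line i.1 i.2 w) _ _) _.
- move=> [d j] _ /=; split; first by rewrite imset_eq0.
  by apply: contra ws => /imsetP[x xs /(congr1 (along d))]; rewrite !along_on_line => ->.
- move=> [d j] S _ /= GS sS _; have [RS SE] := grid_line Ti s0 sN sS GS.
  set X := along d @: S in RS SE; rewrite SE imset_on_line_sub in sS.
  have wSE : on_line d j w |: S = on_line d j @: (w |: X) by rewrite imsetU1 -SE.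
  have GwS : grid RC T (on_line d j w |: S).
    by rewrite wSE; apply: grid_on_line; [exact: setU1_neq0|exact: RCw].
  split=> // -[d' j'] _ _ /= s'S.
  have [_ S'E] := grid_line Ti s0 sN s'S GwS.
  have dd : d' = d.
    apply/eqP; apply: contraT => /negb_neq nd; have := two_lines s0 sN s'S.
    by rewrite nd wSE in_line_on_line.
  rewrite dd in s'S S'E *; apply: contra ws => /imsetP[x xs /(congr1 (along d))].
  by rewrite !along_on_line => ->.
apply: collapses_eq => S /=; apply/andP/gridP.
  case=> /gridP[S0 GS] /forallP aS; split=> //; case: GS => [[d [SL RS]]|]; last by right.
  left; exists d; split=> //; rewrite RS /=; have [p pS] := set0Pn _ S0.
  apply/negP => sS; have /negP := aS (d, across d p); apply => /=.
  apply/subsetP => _ /imsetP[x xs ->]; have /imsetP[q qS ->] := subsetP sS x xs.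
  by move/in_lineP: SL => /(_ _ _ pS qS) ->; rewrite on_lineK.
case=> S0 GS; split.
  apply/gridP; split=> //; case: GS => [[d [SL /andP[RS _]]]|]; last by right.
  by left; exists d.
apply/forallP => -[d j] /=; apply/negP => sS.
case: GS => [[d' [SL /andP[RS nsS]]]|]; last by apply/negP; exact: line_sub_tri sS.
have GS : grid RC T S by apply/gridP; split=> //; left; exists d'.
have [_ SE] := grid_line Ti s0 sN sS GS.
have dd : d' = d.
  apply/eqP; apply: contraT; rewrite eq_sym => /negb_neq nd.
  by have := two_lines s0 sN sS; rewrite nd SL.
by move/negP: nsS; apply; rewrite dd -(imset_on_line_sub d j) -SE.
Qed.

Lemma mem_triE d p q : inner p ->
  (q \in tri d p) = [|| (q.1 == p.1 :> nat) && (q.2 == p.2 :> nat),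
    (q.1 == p.1 + d :> nat) && (q.2 == p.2 + ~~ d :> nat)
    | (q.1 == p.1 + 1 :> nat) && (q.2 == p.2 + 1 :> nat)].
Proof.
case: p q => [a b] [c e] /andP[/= an bn].
have := shiftE a (ltac:(nlia) : 1 <= n); have := shiftE b (ltac:(nlia) : 1 <= n).
rewrite !inE /step /diag; cbn [fst snd].
move: (shift a 1) (shift b 1) => a1 b1 hb ha.
by case: d; rewrite !xpair_eqE !ord_eqE /=; apply/idP/idP; nlia.
Qed.

Lemma in_tri_nat S d a b : a + 1 < n -> b + 1 < n ->
  (forall q, q \in S -> [|| (q.1 == a :> nat) && (q.2 == b :> nat),
    (q.1 == a + d :> nat) && (q.2 == b + ~~ d :> nat)
    | (q.1 == a + 1 :> nat) && (q.2 == b + 1 :> nat)]) -> in_tri inner S.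
Proof.
move=> an bn Sq; have an' : a < n by nlia.
have bn' : b < n by nlia.
apply/in_triP; exists d, (Ordinal an', Ordinal bn'); split.
  by rewrite /inner /= an bn.
by apply/subsetP => q /Sq; rewrite mem_triE // /inner /= an bn.
Qed.

(** Each edge of a path is a side of an inner square, so what remains is a triangulated square. *)
Lemma grid_lin S : 1 < n -> grid (lin_cliques 1) inner S -> in_tri inner S.
Proof.
move=> n1 /gridP[S0 [[d [/in_lineP SL /lin_cliquesP[_ SX]]]|//]].
have [p0 p0S] := set0Pn _ S0.
have SX' p q : p \in S -> q \in S -> along d p <= along d q + 1.
  by move=> pS qS; apply: SX; exact: imset_f.
have [p pS pm] : exists2 p, p \in S & forall q, q \in S -> along d p <= along d q.
  case: (@arg_minnP _ p0 (mem S) (fun p => along d p : nat)) => // p pS pm.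
  by exists p.
have pn := ltn_ord (along d p); have jn := ltn_ord (across d p).
have Sq q : q \in S -> [/\ across d q = across d p, along d p <= along d q,
    along d q <= along d p + 1 & along d q < n].
  by move=> qS; split; [exact: SL|exact: pm|exact: SX'|exact: ltn_ord].
(* At the end of a line or on the last line the square is the one before, with corner [n - 2]. In
   the latter case the edge is the opposite side of that square and belongs to the triangle of the
   other type. *)
pose a := if along d p + 1 < n then along d p : nat else n - 2.
pose b := if across d p + 1 < n then across d p : nat else n - 2.
pose e := if across d p + 1 < n then d else ~~ d.
have ha : (along d p + 1 < n /\ a = along d p) \/ (along d p + 1 = n /\ a = n - 2).
  by rewrite /a; case: ltnP; nlia.
have hb : (across d p + 1 < n /\ b = across d p /\ e = d) \/
    (across d p + 1 = n /\ b = n - 2 /\ e = ~~ d).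
  by rewrite /b /e; case: ltnP; [left|right; split]; nlia.
have an : a + 1 < n by nlia.
have bn : b + 1 < n by move: hb => [[]|[]] + [? _]; nlia.
apply: (@in_tri_nat S e (if d then a else b) (if d then b else a)); [by case: ifP..|].
move=> q /Sq[]; clearbody a b e; clear -ha hb.
case: d ha hb; rewrite /along /across /= => ha hb -> pq qp qn;
  case: hb => -[hb [bE ->]] /=; nlia.
Qed.

Definition next x : 'I_n := if x + 1 < n then shift x 1 else x.

Lemma nextE x : (x + 1 < n /\ next x = x + 1 :> nat) \/ (x + 1 = n /\ next x = x :> nat).
Proof.
have xn := ltn_ord x; rewrite /next; case: ltnP => xn'; last by right; split=> //; nlia.
by left; split=> //; have := shiftE x (ltac:(nlia) : 1 <= n); nlia.
Qed.

Definition lex_rank p : nat := p.2 * n + p.1.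

Lemma lex_rank_lt p q : (lex_rank p < lex_rank q) =
  (p.2 < q.2) || (p.2 == q.2 :> nat) && (p.1 < q.1).
Proof.
rewrite /lex_rank; have := ltn_ord p.1; have := ltn_ord q.1.
have [lt|gt|->] := ltngtP p.2 q.2 => /= qn pn; last by rewrite ltn_add2l.
  by have := leq_mul lt (leqnn n); rewrite mulSn; nlia.
by have := leq_mul gt (leqnn n); rewrite mulSn; nlia.
Qed.

(** Vertices are removed row by row. When the turn of [p] comes, its remaining neighbours are among
    [p + (1, 0)], [p + (0, 1)] and [p + (1, 1)], and the last is joined to the other two. On the
    last row or column one neighbour remains, and [next] clamps the apex to it. *)
Lemma collapses_square (t : 'I_n) : t + 1 = n -> 1 < n ->
  collapses (grid (lin_cliques 1) inner) (fun S => S == [set (t, t)]).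
Proof.
move=> tn n1; pose w p := (next p.1, next p.2).
apply: collapses_trans (collapses_batch (P := fun p => p != (t, t)) (rk := lex_rank)
  (s := fun p => [set p]) (w := w) _ _) _.
- move=> [a b]; rewrite /w xpair_eqE !ord_eqE /= => pt.
  split; first by apply/set0Pn; exists (a, b); rewrite inE.
  rewrite inE xpair_eqE !ord_eqE; have := nextE a; have := nextE b; nlia.
- move=> [a b] S pt GS; rewrite sub1set => pS rS.
  have rS' q : q \in S -> (b < q.2) || (b == q.2 :> nat) && (a <= q.1).
    move=> qS; have bq := ltn_ord q.2; have aq := ltn_ord q.1.
    have [qt|qt] := eqVneq q (t, t).
      by rewrite qt /=; have := ltn_ord a; have := ltn_ord b; nlia.
    have := rS q qt; rewrite sub1set qS /= lex_rank_lt /=; nlia.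
  have hw1 := nextE a; have hw2 := nextE b; have an := ltn_ord a; have bn := ltn_ord b.
  split; last first.
    move=> q qt; rewrite leqNgt lex_rank_lt /= => qr _; rewrite inE.
    apply: contra qr => /eqP <- /=; move: pt; rewrite xpair_eqE !ord_eqE; nlia.
  apply/gridP; split; first exact: setU1_neq0; right.
  have /in_triP[d [p' [ip' Sp']]] := grid_lin n1 GS.
  have Sq q : q \in S ->
      [|| (q.1 == p'.1 :> nat) && (q.2 == p'.2 :> nat),
        (q.1 == p'.1 + d :> nat) && (q.2 == p'.2 + ~~ d :> nat)
        | (q.1 == p'.1 + 1 :> nat) && (q.2 == p'.2 + 1 :> nat)] /\
      ((b < q.2) || (b == q.2 :> nat) && (a <= q.1)).
    by move=> qS; split; [rewrite -mem_triE //; exact: (subsetP Sp') | exact: rS'].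
  have /andP[ip1 ip2] := ip'.
  have [Hp _] := Sq _ pS; rewrite /= in Hp.
  have [e [a' [b' [an' [bn' H]]]]] : exists (e : bool) (a' b' : nat),
      a' + 1 < n /\ b' + 1 < n /\ forall q : 'I_n * 'I_n, q = w (a, b) \/ q \in S ->
      [|| (q.1 == a' :> nat) && (q.2 == b' :> nat),
        (q.1 == a' + e :> nat) && (q.2 == b' + ~~ e :> nat)
        | (q.1 == a' + 1 :> nat) && (q.2 == b' + 1 :> nat)].
    have fin (e : bool) (a' b' : nat) : a' + 1 < n -> b' + 1 < n ->
      (forall q : 'I_n * 'I_n, q.1 = next a :> nat /\ q.2 = next b :> nat \/ q \in S ->
        [|| (q.1 == a' :> nat) && (q.2 == b' :> nat),
         (q.1 == a' + e :> nat) && (q.2 == b' + ~~ e :> nat)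
         | (q.1 == a' + 1 :> nat) && (q.2 == b' + 1 :> nat)]) ->
      exists (e : bool) (a' b' : nat), a' + 1 < n /\ b' + 1 < n /\
       forall q : 'I_n * 'I_n, q = w (a, b) \/ q \in S ->
         [|| (q.1 == a' :> nat) && (q.2 == b' :> nat),
           (q.1 == a' + e :> nat) && (q.2 == b' + ~~ e :> nat)
           | (q.1 == a' + 1 :> nat) && (q.2 == b' + 1 :> nat)].
      move=> an' bn' H; exists e, a', b'; split=> //; split=> // q [->|qS]; apply: H.
        by left.
      by right.
    move: (p'.1 : nat) (p'.2 : nat) Sq Hp ip1 ip2 => a' b' Sq Hp ip1 ip2.
    clear - fin Sq Hp ip1 ip2 hw1 hw2 an bn pt tn.
    have {}pt : ~~ ((a == t :> nat) && (b == t :> nat)) by [].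
    have {}Sq q : q \in S -> [\/ q.1 = a' :> nat /\ q.2 = b' :> nat,
        q.1 = a' + d :> nat /\ q.2 = b' + ~~ d :> nat |
        q.1 = a' + 1 :> nat /\ q.2 = b' + 1 :> nat] /\
        (b < q.2 \/ b = q.2 :> nat /\ a <= q.1).
      move=> /Sq[h l]; split; last by clear h; nlia.
      case/or3P: h => /andP[/eqP ? /eqP ?];
        by [constructor 1 | constructor 2 | constructor 3].
    (* If [(a, b)] is the lower left corner of the triangle around [S], that triangle contains the
       apex. Otherwise the corner comes earlier and is gone, so [S] lies in the side from [(a, b)]
       to the upper right corner, and a triangle with that side and the apex is given. *)
    have [pE|pE] := boolP ((a == a' :> nat) && (b == b' :> nat)).
      apply: (fin d a' b') => // q [[-> ->]|/Sq[[] [-> ->] _]]; nlia.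
    have {}Hp : a = a' + d :> nat /\ b = b' + ~~ d :> nat \/
        a = a' + 1 :> nat /\ b = b' + 1 :> nat by nlia.
    have [a2|a2] := ltnP (a + 1) n; have [b2|b2] := ltnP (b + 1) n.
    - have [ha hb] : next a = a + 1 :> nat /\ next b = b + 1 :> nat by nlia.
      clear hw1 hw2 pt pE; apply: (fin (~~ d) a b) => // q.
      by case: d Hp Sq => /= Hp Sq [[-> ->]|/Sq[[] [-> ->] ?]]; nlia.
    - have [ha hb] : next a = a + 1 :> nat /\ next b = b :> nat by nlia.
      clear hw1 hw2 pt pE; apply: (fin false a (b - 1)) => [||q]; try nlia.
      by case: d Hp Sq => /= Hp Sq [[-> ->]|/Sq[[] [-> ->] ?]]; nlia.
    - have [ha hb] : next a = a :> nat /\ next b = b + 1 :> nat by nlia.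
      clear hw1 hw2 pt pE; apply: (fin true (a - 1) b) => [||q]; try nlia.
      by case: d Hp Sq => /= Hp Sq [[-> ->]|/Sq[[] [-> ->] ?]]; nlia.
    - by exfalso; nlia.
  apply: (@in_tri_nat _ e a' b') => // q; rewrite in_setU1 => /predU1P H'; exact: H.
apply: collapses_eq => S /=; apply/andP/eqP.
  case=> /gridP[S0 _] /forallP aS; apply/setP => p; rewrite inE.
  have pN q : q \in S -> q = (t, t).
    by move=> qS; apply/eqP; apply: contraT => qt; have := aS q; rewrite qt sub1set qS.
  apply/idP/eqP => [/pN//|->]; have [q qS] := set0Pn _ S0.
  by rewrite -(pN q qS).
move=> ->; split; last first.
  by apply/forallP => p; apply/implyP; rewrite sub1set inE.
apply/gridP; split; first by apply/set0Pn; exists (t, t); rewrite inE.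
by right; apply: (@in_tri_nat _ true (n - 2) (n - 2)) => [||q]; try nlia;
  rewrite inE => /eqP -> /=; nlia.
Qed.

End Grid.

Arguments inner {n} p.

(** * Removing the diagonals of the seam squares *)

Section Critical.
Variable n : nat.
Hypothesis n_gt2 : 2 < n.
Implicit Types (d : bool) (p q : 'I_n * 'I_n) (S : {set 'I_n * 'I_n}).
Implicit Types (X s : {set 'I_n}) (j x : 'I_n) (T : pred ('I_n * 'I_n)).
Implicit Types RC : {set 'I_n} -> bool.

Lemma mem_tri_shift d p e f : e < n -> f < n ->
  ((shift p.1 e, shift p.2 f) \in tri d p) =
  [|| (e == 0) && (f == 0), (e == d :> nat) && (f == ~~ d :> nat) | (e == 1) && (f == 1)].
Proof.
case: p => a b en fn; rewrite !inE /step /diag !xpair_eqE; cbn [fst snd].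
by case: d => /=; rewrite !xpair_eqE !shift_eq0 ?shift_eq //=; try nlia; rewrite -orbA.
Qed.

(** A diagonal determines its square because [n > 2]; for [n = 2] the map [diag] would be an
    involution. *)
Lemma diag_sub_tri d p q : p \in tri d q -> diag p \in tri d q -> p = q.
Proof.
case: p => p1 p2.
have [e en ->] := shift_surj q.1 p1; have [f fn ->] := shift_surj q.2 p2.
rewrite mem_tri_shift // => ef.
have [e2 f2] : e <= 1 /\ f <= 1 by case: d ef => /= ef; split; nlia.
rewrite /diag; cbn [fst snd]; rewrite !shift_shift mem_tri_shift; try nlia.
move=> ef'; have [-> ->] : e = 0 /\ f = 0 by case: d ef ef' => /= ef ef'; split; nlia.
by rewrite !shift0 -surjective_pairing.
Qed.

Lemma shift1_neq x : shift x 1 != x.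
Proof. by rewrite shift_eq0; nlia. Qed.

Lemma diag_in_line d p S : in_line d S -> p \in S -> diag p \in S -> False.
Proof.
move=> /in_lineP SL pS dS; have := SL _ _ pS dS; have := shift1_neq p.1.
have := shift1_neq p.2; rewrite /diag /across.
by case: d {SL} => /= h1 h2 h3; [rewrite -h3 eqxx in h1|rewrite -h3 eqxx in h2].
Qed.

Lemma grid_diag RC T p S : grid RC T S -> p \in S -> diag p \in S ->
  T p /\ exists d, S \subset tri d p.
Proof.
move=> /gridP[S0 [[d [SL _]]|/in_triP[d [q [Tq Sq]]]]] pS dS.
  by case: (diag_in_line SL pS dS).
have pq := diag_sub_tri (subsetP Sq _ pS) (subsetP Sq _ dS).
by split; [rewrite pq|exists d; rewrite pq].
Qed.

Lemma card_tri d p : #|tri d p| = 3.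
Proof.
rewrite /tri -setUA cardsU1 cards2 !inE; case: p => a b; rewrite /step /diag.
have := shift1_neq a; have := shift1_neq b; cbn [fst snd].
by case: d; rewrite /= !xpair_eqE !eqxx !(eq_sym _ (shift _ _)) /= ?andbT ?andbF /= => /negPf-> /negPf->.
Qed.

Lemma step_notin p : step false p \notin tri true p.
Proof.
case: p => a b; rewrite /step; cbn [fst snd]; rewrite -{1}(shift0 a).
by rewrite (mem_tri_shift true (a, b)) /=; nlia.
Qed.

(** Without the critical lower triangle, the diagonal of a seam square lies only in the upper
    triangle, whose third vertex is the apex. The sides that are left belong to lines, by the
    hypothesis on [RC]. *)
Lemma collapses_diagonals RC :
  (forall X a, X != set0 -> X \subset [set a; shift a 1] -> RC X) ->
  collapses (fun S => grid RC xpredT S && [forall p, ~~ inner p ==> (S != tri true p)])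
            (grid RC inner).
Proof.
move=> RC2.
have dtri d p : p \in tri d p /\ diag p \in tri d p.
  by rewrite !inE !eqxx !orbT.
apply: collapses_trans (collapses_batch (P := fun p => ~~ inner p) (rk := fun=> 0)
  (s := fun p => [set p; diag p]) (w := step false) _ _) _.
- move=> p _; split; first by apply/set0Pn; exists p; rewrite !inE eqxx.
  apply: contra (step_notin p); rewrite !inE => /orP[] /eqP->; rewrite eqxx ?orbT //.
- move=> p S ip /andP[GS /forallP cS]; rewrite sub_set2 => /andP[pS dS] _.
  have [_ [d Sd]] := grid_diag GS pS dS.
  have wS : step false p |: S \subset tri false p.
    rewrite subUset sub1set {1}/tri !inE eqxx orbT /=; case: d Sd => // Sd.
    have := implyP (cS p) ip; apply: contraNT => nS; rewrite eqEsubset Sd /=.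
    rewrite /tri !subUset !sub1set pS dS andbT andTb.
    apply: contraNT nS => nS; apply/subsetP => q qS.
    have := subsetP Sd q qS; rewrite !inE => /orP[/orP[->//|/eqP qE]|->]; rewrite ?orbT //.
    by move: nS; rewrite -qE qS.
  split; last first.
    move=> q iq _; rewrite sub_set2 => /andP[/(subsetP wS) qT /(subsetP wS) dT].
    have pq := diag_sub_tri qT dT; rewrite pq; apply: contra (step_notin p).
    by rewrite !inE => /orP[] /eqP->; rewrite eqxx ?orbT.
  apply/andP; split.
    apply/gridP; split; first exact: setU1_neq0.
    by right; apply/in_triP; exists false, p.
  apply/forallP => q; apply/implyP => iq; apply/eqP => E.
  have [qT dT] := dtri true q.
  have qp : q = p by apply: (diag_sub_tri (d := false)); apply: (subsetP wS); rewrite E.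
  by move: (step_notin p); rewrite -{2}qp -E setU11.
apply: collapses_eq => S /=; apply/andP/idP.
  case=> /andP[/gridP[S0 [[d [SL RS]]|/in_triP[d [p [_ Sp]]]]] /forallP cS] /forallP dS.
    by apply/gridP; split=> //; left; exists d.
  apply/gridP; split=> //; have [ip|ip] := boolP (inner p).
    by right; apply/in_triP; exists d, p.
  left; have := implyP (dS p) ip; rewrite sub_set2 negb_and => /orP[pN|dN].
    exists (~~ d).
    have SE q : q \in S -> q = step d p \/ q = diag p.
      move=> qS; have := subsetP Sp q qS; rewrite !inE -orbA.
      by case/or3P=> /eqP qE; [move: pN; rewrite -qE qS|left|right].
    split.
      by apply/in_lineP => q q' /SE[]-> /SE[]->; case: d {Sp SE}.
    apply: (RC2 _ (along (~~ d) p)); first by rewrite imset_eq0.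
    apply/subsetP => _ /imsetP[q /SE qE ->]; case: qE => ->; rewrite !inE;
      by case: d {Sp SE} => /=; rewrite eqxx ?orbT.
  exists d.
  have SE q : q \in S -> q = p \/ q = step d p.
    move=> qS; have := subsetP Sp q qS; rewrite !inE -orbA.
    by case/or3P=> /eqP qE; [left|right|move: dN; rewrite -qE qS].
  split.
    by apply/in_lineP => q q' /SE[]-> /SE[]->; case: d {Sp SE}.
  apply: (RC2 _ (along d p)); first by rewrite imset_eq0.
  apply/subsetP => _ /imsetP[q /SE qE ->]; case: qE => ->; rewrite !inE;
    by case: d {Sp SE} => /=; rewrite eqxx ?orbT.
move=> GS; split.
  apply/andP; split.
    move/gridP: GS => [S0 [[d [SL RS]]|/in_triP[d [p [_ Sp]]]]]; apply/gridP; split=> //.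
      by left; exists d.
    by right; apply/in_triP; exists d, p.
  apply/forallP => p; apply/implyP; apply: contra => /eqP SE.
  by have [pT dT] := dtri true p; rewrite -SE in pT dT; case: (grid_diag GS pT dT).
apply/forallP => p; apply/implyP; apply: contra; rewrite sub_set2 => /andP[pS dS].
by case: (grid_diag GS pS dS).
Qed.

Lemma collapses_noncritical RC (t : 'I_n) : t + 1 = n ->
  (forall X a, X != set0 -> X \subset [set a; shift a 1] -> RC X) ->
  collapses RC (@lin_cliques n 1) ->
  collapses (fun S => grid RC xpredT S && [forall p, ~~ inner p ==> (S != tri true p)])
            (fun S => S == [set (t, t)]).
Proof.
move=> tn RC2 RC1; apply: collapses_trans (collapses_diagonals RC2) _.
apply: collapses_trans (collapses_square tn _); last by nlia.
exact: collapses_lines RC1.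
Qed.

End Critical.

(** * Collapsing the Rips complex of the torus onto the grid complex *)

Lemma cyc_dist_spec n a b : a < n -> b < n ->
  [\/ a <= b /\ cyc_dist n a b + a = b /\ 2 * cyc_dist n a b <= n,
      a <= b /\ cyc_dist n a b + b = n + a /\ 2 * cyc_dist n a b <= n,
      b <= a /\ cyc_dist n a b + b = a /\ 2 * cyc_dist n a b <= n |
      b <= a /\ cyc_dist n a b + a = n + b /\ 2 * cyc_dist n a b <= n].
Proof.
move=> an bn; rewrite /cyc_dist; case: (leqP a b) => ab.
  have [h|h] := leqP (b - a) (n - (b - a)); [constructor 1|constructor 2]; nlia.
have [h|h] := leqP (a - b) (n - (a - b)); [constructor 3|constructor 4]; nlia.
Qed.

Lemma cyc_dist0_spec n a : a < n ->
  (cyc_dist n 0 a = a /\ 2 * a <= n) \/ (cyc_dist n 0 a + a = n /\ n <= 2 * a).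
Proof. by move=> an; case: (@cyc_dist_spec n 0 a _ an) => *; nlia. Qed.

Ltac cyc_case n a b :=
  let D := fresh "D" in
  have := @cyc_dist_spec n a b; move: (cyc_dist n a b) => D;
  move=> /(_ (ltac:(nlia)) (ltac:(nlia))) [] [? [? ?]].

Ltac cyc0_case n a :=
  let D := fresh "D" in
  have := @cyc_dist0_spec n a; move: (cyc_dist n 0 a) => D;
  move=> /(_ (ltac:(nlia))) [] [? ?].

(** The segment runs from [(0, 0)] to [(r, 0)] and the apex is [(1, 0)]. A point off the line has
    spent part of [r] on [f], so it cannot reach both ends by going around, and [e] lies strictly
    between 0 and [r]. *)
Lemma triple_arith1 n k r e f : n = 3 * k - 1 -> 1 < r <= k -> e < n -> f < n -> 0 < f ->
  cyc_dist n 0 e + cyc_dist n 0 f <= r -> cyc_dist n r e + cyc_dist n 0 f <= r ->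
  cyc_dist n 1 e + cyc_dist n 0 f < r /\ e + cyc_dist n 0 f <= r /\
  0 < cyc_dist n 0 f <= e.
Proof.
move=> nk rk en fn f0.
by cyc0_case n f; cyc0_case n e; cyc_case n r e; cyc_case n 1 e; nlia.
Qed.

(** Here [(e, 0)] is on the line and [ec], [F] describe a vertex off it. Without that vertex,
    [r = k] and [e = 2k] would be possible: a wrapping triangle, with 1 at distance exactly [r] from
    [e]. *)
Lemma triple_arith2 n k r e ec F : n = 3 * k - 1 -> 1 < r <= k -> e < n ->
  ec + F <= r -> 0 < F <= ec ->
  cyc_dist n 0 e <= r -> cyc_dist n r e <= r -> cyc_dist n e ec + F <= r ->
  cyc_dist n 1 e < r.
Proof.
move=> nk rk en ecF F0.
by cyc0_case n e; cyc_case n r e; cyc_case n 1 e; cyc_case n e ec; nlia.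
Qed.

(* In the next lemmas an edge of length [r] runs from [(0, 0)] to [(x, y)], the
   point [(e, f)] lies within distance [r] of both ends, and [(wx, wy)] is the
   apex used to remove the edge. *)
Definition apex_coords (x y wx wy : nat) :=
  y < x /\ wx = 1 /\ wy = 0 \/ x < y /\ wx = 0 /\ wy = 1 \/ x = y /\ wx = 1 /\ wy = 1.

(** For [y < x] a common neighbour with negative first coordinate is within [2y < r] of the origin,
    so a step in direction [(1, 0)] is affordable. For [x = y] the point [(-x, x)] is at distance
    [r] from both ends and [r + 1] from [(1, 0)], whence the apex [(1, 1)]. *)
Lemma edge_arith n k r x y e f wx wy : n = 3 * k - 1 -> 2 < r <= k -> e < n -> f < n ->
  0 < x -> 0 < y -> x + y = r -> apex_coords x y wx wy ->
  cyc_dist n 0 e + cyc_dist n 0 f <= r -> cyc_dist n x e + cyc_dist n y f <= r ->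
  cyc_dist n wx e + cyc_dist n wy f <= r.
Proof.
move=> nk rk en fn x0 y0 xy.
case=> [[? [-> ->]]|[[? [-> ->]]|[? [-> ->]]]].
- by cyc_case n x e; cyc_case n y f; cyc0_case n f; cyc0_case n e;
  try solve [nlia]; cyc_case n 1 e; nlia.
- by cyc_case n x e; cyc_case n y f; cyc0_case n f; cyc0_case n e;
  try solve [nlia]; cyc_case n 1 f; nlia.
- by cyc_case n x e; cyc_case n y f; cyc0_case n f; cyc0_case n e;
  try solve [nlia]; cyc_case n 1 e; try solve [nlia]; cyc_case n 1 f; nlia.
Qed.

(** Used to see that the apex creates no pair at distance [r] on a grid line, so that the enlarged
    simplex stays in [thin]. *)
Lemma edge_arith_axis n k r x y e f wx wy :
  n = 3 * k - 1 -> 2 < r <= k -> e < n -> f < n ->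
  0 < x -> 0 < y -> x + y = r -> apex_coords x y wx wy ->
  cyc_dist n 0 e + cyc_dist n 0 f <= r -> cyc_dist n x e + cyc_dist n y f <= r ->
  (f = wy -> cyc_dist n wx e < r) /\ (e = wx -> cyc_dist n wy f < r).
Proof.
move=> nk rk en fn x0 y0 xy w H1 H2; split=> E.
  rewrite E in H1 H2; move: H1 H2; clear f fn E.
  case: w => [[? [-> ->]]|[[? [-> ->]]|[? [-> ->]]]].
  - by cyc_case n x e; cyc_case n y 0; cyc0_case n 0; cyc0_case n e;
    try solve [nlia]; cyc_case n 1 e; nlia.
  - by cyc_case n x e; cyc_case n y 1; cyc0_case n 1; cyc0_case n e; nlia.
  - by cyc_case n x e; cyc_case n y 1; cyc0_case n 1; cyc0_case n e;
    try solve [nlia]; cyc_case n 1 e; nlia.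
rewrite E in H1 H2; move: H1 H2; clear e en E.
case: w => [[? [-> ->]]|[[? [-> ->]]|[? [-> ->]]]].
- by cyc_case n y f; cyc_case n x 1; cyc0_case n 1; cyc0_case n f; nlia.
- by cyc_case n y f; cyc_case n x 0; cyc0_case n 0; cyc0_case n f;
  try solve [nlia]; cyc_case n 1 f; nlia.
- by cyc_case n y f; cyc_case n x 1; cyc0_case n 1; cyc0_case n f;
  try solve [nlia]; cyc_case n 1 f; nlia.
Qed.

(** Used to see that the apex and [(e, f)] do not form another pair of the same slope, with either
    of them as the origin. *)
Lemma edge_arith_pos n k r x y e f wx wy x' y' :
  n = 3 * k - 1 -> 2 < r <= k -> e < n -> f < n ->
  0 < x -> 0 < y -> x + y = r -> apex_coords x y wx wy -> 0 < x' -> 0 < y' -> x' + y' = r ->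
  cyc_dist n 0 e + cyc_dist n 0 f <= r -> cyc_dist n x e + cyc_dist n y f <= r ->
  ~ (e = wx + x' /\ f = wy + y') /\
  ~ ((e + x' = wx \/ e + x' = wx + n) /\ (f + y' = wy \/ f + y' = wy + n)).
Proof.
move=> nk rk en fn x0 y0 xy w x'0 y'0 xy' H1 H2; split=> -[He Hf]; move: H1 H2.
  have {}w : 0 < wx + wy <= 2 /\ wx <= 1 /\ wy <= 1 by clear He Hf; case: w => *; nlia.
  by cyc0_case n e; cyc0_case n f; nlia.
case: w He Hf => [[? [-> ->]]|[[? [-> ->]]|[? [-> ->]]]] He Hf.
- by cyc_case n x e; cyc_case n y f; cyc0_case n e; cyc0_case n f; nlia.
- by cyc_case n x e; cyc_case n y f; cyc0_case n e; cyc0_case n f; nlia.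
- by cyc_case n x e; cyc_case n y f; cyc0_case n e; cyc0_case n f; nlia.
Qed.

(** With [E] and [X] the cyclic distances of [e] from 0 and from [x], this says that nothing wraps
    around: [e] behaves like the integer [E] or [-E]. *)
Definition signed_pos n x e E X :=
  e = E /\ (X + E = x \/ X + x = E) \/ e + E = n /\ X = x + E.

Lemma edge_arith_signed n k r x y e f :
  n = 3 * k - 1 -> 2 < r <= k -> e < n -> f < n -> 0 < x -> 0 < y -> x + y = r ->
  cyc_dist n 0 e + cyc_dist n 0 f <= r -> cyc_dist n x e + cyc_dist n y f <= r ->
  signed_pos n x e (cyc_dist n 0 e) (cyc_dist n x e) /\
  signed_pos n y f (cyc_dist n 0 f) (cyc_dist n y f).
Proof.
move=> nk rk en fn x0 y0 xy; rewrite /signed_pos.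
by cyc_case n x e; cyc_case n y f; cyc0_case n e; cyc0_case n f; nlia.
Qed.

Lemma cyc_dist_ub n a b : (a <= b -> cyc_dist n a b <= b - a /\ cyc_dist n a b <= n - (b - a))
  /\ (b <= a -> cyc_dist n a b <= a - b /\ cyc_dist n a b <= n - (a - b)).
Proof. by rewrite /cyc_dist; case: (leqP a b) => ab; split; nlia. Qed.

(** When neither end forms a pair at distance [r] with [(e, f)] along an axis or with the opposite
    slope, the bound for the apex becomes strict. Then the apex is an end of no pair at distance
    [r], whatever its slope. *)
Lemma edge_arith_neg n k r x y e f wx wy :
  n = 3 * k - 1 -> 2 < r <= k -> e < n -> f < n ->
  0 < x -> 0 < y -> x + y = r -> apex_coords x y wx wy ->
  cyc_dist n 0 e + cyc_dist n 0 f <= r -> cyc_dist n x e + cyc_dist n y f <= r ->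
  ~ (f = 0 /\ cyc_dist n 0 e = r) -> ~ (e = 0 /\ cyc_dist n 0 f = r) ->
  ~ (f = y /\ cyc_dist n x e = r) -> ~ (e = x /\ cyc_dist n y f = r) ->
  (forall E F, 0 < E -> 0 < F -> E + F = r ->
     ~ (e = E /\ f + F = n) /\ ~ (e + E = n /\ f = F)) ->
  (forall E F, 0 < E -> 0 < F -> E + F = r ->
     ~ ((e = x + E \/ e + n = x + E) /\ (f + F = y \/ f + F = y + n)) /\
     ~ ((e + E = x \/ e + E = x + n) /\ (f = y + F \/ f + n = y + F))) ->
  cyc_dist n wx e + cyc_dist n wy f < r.
Proof.
move=> nk rk en fn x0 y0 xy w H1 H2 a1 a2 a3 a4.
have [] := edge_arith_signed nk rk en fn x0 y0 xy H1 H2; rewrite /signed_pos => sx sy.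
have ux0 := cyc_dist_ub n wx e; have uy0 := cyc_dist_ub n wy f.
move=> /(_ (cyc_dist n 0 e) (cyc_dist n 0 f)) Hp /(_ (cyc_dist n x e) (cyc_dist n y f)) Hq.
move: (cyc_dist n wx e) (cyc_dist n wy f) ux0 uy0 => W1 W2.
move: (cyc_dist n 0 e) (cyc_dist n 0 f) (cyc_dist n x e) (cyc_dist n y f) H1 H2 a1 a2 a3 a4 sx sy Hp Hq.
move=> E F X Y H1 H2 a1 a2 a3 a4 sx sy Hp Hq ux uy.
(* A point at distance exactly [r] from an end can now only lie in the two quadrants of positive
   slope at that end; [hp] treats the origin and [hq] the other end. *)
have hp : E + F < r \/ 0 < E /\ 0 < F /\ (e = E /\ f = F \/ e + E = n /\ f + F = n).
  clear Hq a3 a4 ux uy w; have [/eqP EF|EF] := boolP (E + F == r); last by clear Hp a1 a2; left; nlia.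
  have [E0|E0] := posnP E; first by clear Hp; nlia.
  have [F0|F0] := posnP F; first by clear Hp; nlia.
  have {}Hp := Hp E0 F0 EF; clear a1 a2.
  by case: sx => [[? ?]|[? ?]]; case: sy => [[? ?]|[? ?]]; nlia.
have hq : X + Y < r \/ 0 < X /\ 0 < Y /\ (e = E /\ X + x = E /\ f = F /\ Y + y = F \/
    (e = E /\ X + E = x \/ e + E = n /\ X = x + E) /\
    (f = F /\ Y + F = y \/ f + F = n /\ Y = y + F)).
  clear Hp a1 a2 hp ux uy w; have [/eqP EF|EF] := boolP (X + Y == r); last by clear Hq a3 a4; left; nlia.
  have [X0|X0] := posnP X; first by exfalso; clear Hq H1 H2 sy a3; case: sx => [[? [?|?]]|[? ?]]; nlia.
  have [Y0|Y0] := posnP Y; first by exfalso; clear Hq H1 H2 sx a4; case: sy => [[? [?|?]]|[? ?]]; nlia.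
  have [Hq1 Hq2] := Hq X0 Y0 EF; clear Hq a3 a4 H1 H2.
  have lx : (e = E /\ X + E = x \/ e + E = n /\ X = x + E) /\
      (e + X = x \/ e + X = x + n) \/ (e = E /\ X + x = E) /\ e = x + X.
    by clear Hq1 Hq2; case: sx => [[? [?|?]]|[? ?]]; nlia.
  have ly : (f = F /\ Y + F = y \/ f + F = n /\ Y = y + F) /\
      (f + Y = y \/ f + Y = y + n) \/ (f = F /\ Y + y = F) /\ f = y + Y.
    by clear Hq1 Hq2; case: sy => [[? [?|?]]|[? ?]]; nlia.
  right; do 2 split=> //; case: lx ly => [[lx lx']|[[rx rx1] rx']] [[ly ly']|[[ry ry1] ry']].
  - by right.
  - by exfalso; apply: Hq2; split; [|left].
  - by exfalso; apply: Hq1; split; [left|].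
  - by left.
clear Hp Hq a1 a2 a3 a4.
have [wx1 wy1] : wx <= 1 /\ wy <= 1 by clear - w; case: w => *; nlia.
have vx : e = E /\ (W1 + wx <= E \/ W1 + E <= wx) \/ e + E = n /\ W1 <= E + wx.
  case: ux => ux1 ux2; have [h|/ltnW h] := leqP wx e.
    by have {}ux1 := ux1 h; clear - nk rk en sx H1 h wx1 ux1; nlia.
  by have {}ux2 := ux2 h; clear - nk rk en sx H1 h wx1 ux2; nlia.
have vy : f = F /\ (W2 + wy <= F \/ W2 + F <= wy) \/ f + F = n /\ W2 <= F + wy.
  case: uy => uy1 uy2; have [h|/ltnW h] := leqP wy f.
    by have {}uy1 := uy1 h; clear - nk rk fn sy H1 h wy1 uy1; nlia.
  by have {}uy2 := uy2 h; clear - nk rk fn sy H1 h wy1 uy2; nlia.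
clear ux uy; have {}sx : e = E /\ X + E = x \/ e = E /\ X + x = E \/ e + E = n /\ X = x + E.
  by clear - sx; tauto.
have {}sy : f = F /\ Y + F = y \/ f = F /\ Y + y = F \/ f + F = n /\ Y = y + F.
  by clear - sy; tauto.
case: w => [[? [? ?]]|[[? [? ?]]|[? [? ?]]]]; subst wx wy;
case: sx => [[? ?]|[[? ?]|[? ?]]]; case: sy => [[? ?]|[[? ?]|[? ?]]];
case: hp => [?|[? [? [[? ?]|[? ?]]]]]; try solve [nlia];
case: hq => [?|[? [? [[? [? [? ?]]]|[? ?]]]]]; nlia.
Qed.

(** * Lowering the scale: pairs on a common grid line *)

Section Scale.
Variables n k : nat.
Hypotheses (Hn : n = 3 * k - 1) (Hk : 1 < k).
Implicit Types (d : bool) (p q c : 'I_n * 'I_n) (S : {set 'I_n * 'I_n}).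

Definition clique r S := [forall p in S, [forall q in S, torus_dist n p q <= r]].

Lemma cliqueP r S :
  reflect (forall p q, p \in S -> q \in S -> torus_dist n p q <= r) (clique r S).
Proof.
apply: (iffP forall_inP) => [H p q pS qS|H p pS]; last first.
  by apply/forall_inP => q; exact: H.
by move/forall_inP: (H p pS) => /(_ q qS).
Qed.

Definition on_cycle d S := in_line d S && cyc_clique k (along d @: S).

(* For [r = k] this is the Rips complex, for [r = 2] nearly the grid complex. *)
Definition scale r S : bool :=
  (S != set0) && (clique r S || [exists d, on_cycle d S]).

Lemma scaleP r S :
  reflect (S != set0 /\ (clique r S \/ exists d, on_cycle d S)) (scale r S).
Proof.
apply: (iffP andP) => -[S0 H]; split=> //.
  by case/orP: H => [|/existsP]; [left|right].
by apply/orP; case: H => [|/existsP]; [left|right].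
Qed.

Lemma torus_dist_sym p q : torus_dist n p q = torus_dist n q p.
Proof. by rewrite /torus_dist cyc_distC [X in _ + X]cyc_distC. Qed.

Lemma torus_dist0 p : torus_dist n p p = 0.
Proof. by rewrite /torus_dist !cyc_dist0. Qed.

Lemma cliqueU r w S : clique r S -> (forall c, c \in S -> torus_dist n w c <= r) ->
  clique r (w |: S).
Proof.
move=> /cliqueP SS wS; apply/cliqueP => p q; rewrite !in_setU1.
case/predU1P=> [->|pS] /predU1P[->|qS]; [by rewrite torus_dist0|exact: wS| |exact: SS].
by rewrite torus_dist_sym; exact: wS.
Qed.

Definition at_line d p (e f : nat) : 'I_n * 'I_n :=
  on_line d (shift (across d p) f) (shift (along d p) e).

Lemma at_line_surj d p c :
  exists e f, [/\ e < n, f < n & c = at_line d p e f].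
Proof.
have [e en E] := shift_surj (along d p) (along d c).
have [f fn F] := shift_surj (across d p) (across d c).
by exists e, f; split=> //; rewrite /at_line -E -F on_lineK.
Qed.

Lemma at_line0 d p : at_line d p 0 0 = p.
Proof. by rewrite /at_line !shift0 on_lineK. Qed.

Lemma torus_dist_at_line d p e f e' f' : e < n -> f < n -> e' < n -> f' < n ->
  torus_dist n (at_line d p e f) (at_line d p e' f') = cyc_dist n e e' + cyc_dist n f f'.
Proof.
move=> en fn en' fn'; rewrite /torus_dist /at_line.
by case: d; rewrite /= !cyc_dist_shift // addnC.
Qed.

Lemma torus_dist_at_line0 d p e f : e < n -> f < n ->
  torus_dist n p (at_line d p e f) = cyc_dist n 0 e + cyc_dist n 0 f.
Proof.
move=> en fn; have n0 := leq_ltn_trans (leq0n e) en.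
by rewrite -{1}(at_line0 d p) torus_dist_at_line.
Qed.

Lemma across_at_line d p e f : across d (at_line d p e f) = shift (across d p) f.
Proof. exact: across_on_line. Qed.

Lemma along_at_line d p e f : along d (at_line d p e f) = shift (along d p) e.
Proof. exact: along_on_line. Qed.

Lemma at_line_at_line d p e f e' f' :
  at_line d (at_line d p e f) e' f' = at_line d p (e + e') (f + f').
Proof. by rewrite {1}/at_line across_at_line along_at_line !shift_shift. Qed.

Lemma at_line_eq d p e f e' f' : e < n -> f < n -> e' < n -> f' < n ->
  (at_line d p e f == at_line d p e' f') = (e == e') && (f == f').
Proof.
move=> en fn en' fn'; rewrite /at_line /on_line.
by case: d; rewrite xpair_eqE !shift_eq // andbC.
Qed.

(* The index [(d, p, c)] stands for a segment of length [r] in direction [d] with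
   origin [p], and a third vertex [c]. *)
Definition triple r (i : bool * ('I_n * 'I_n) * ('I_n * 'I_n)) : {set 'I_n * 'I_n} :=
  [set i.1.2; at_line i.1.1 i.1.2 r 0; i.2].

Definition off_line (i : bool * ('I_n * 'I_n) * ('I_n * 'I_n)) : bool :=
  across i.1.1 i.2 != across i.1.1 i.1.2.

Definition thin r S : bool := scale r S && [forall i, off_line i ==> ~~ (triple r i \subset S)].

Lemma sub_triple r d p c S :
  (triple r (d, p, c) \subset S) = [&& p \in S, at_line d p r 0 \in S & c \in S].
Proof. by rewrite sub_set3. Qed.

(** Consequently the removal of triples does not touch the cliques kept inside the lines. *)
Lemma triple_not_line r d p c S d' : 0 < r <= k -> off_line (d, p, c) ->
  triple r (d, p, c) \subset S -> in_line d' S = false.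
Proof.
move=> rk off; rewrite sub_triple => /and3P[pS qS cS]; apply/negP => /in_lineP SL.
have [dd|dd] := eqVneq d' d.
  by move: off; rewrite /off_line /= -dd (SL _ _ cS pS) eqxx.
have := SL _ _ pS qS; rewrite (_ : d' = ~~ d); last by case: d d' dd {off SL qS} => [] [].
rewrite -{1}(at_line0 d p) /at_line !across_negb_on_line => /eqP.
by rewrite shift_eq; nlia.
Qed.

Lemma triple_clique r r' d p c S : 0 < r <= k -> off_line (d, p, c) -> scale r' S ->
  triple r (d, p, c) \subset S -> clique r' S.
Proof.
move=> rk off /scaleP[_ [//|[d' /andP[SL _]]]] sS.
by rewrite (triple_not_line d' rk off sS) in SL.
Qed.

(** The apex is closer than [r] to all vertices of [S], hence an end of no segment of length [r].
    The work is to show that it is not the third vertex of a triple whose ends are in [S]. *)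
Lemma collapses_thin r : 1 < r <= k -> collapses (scale r) (thin r).
Proof.
move=> rk; have rk0 : 0 < r <= k by nlia.
apply: (collapses_batch (P := off_line) (rk := fun i => i.1.1 : nat) (s := triple r)
  (w := fun i => at_line i.1.1 i.1.2 1 0)) => [[[d p] c]|[[d p] c] S] off.
  have [ec [fc [ecn fcn cE]]] := at_line_surj d p c.
  split; first by apply/set0Pn; exists p; rewrite !inE eqxx.
  move: off; rewrite /off_line /= cE across_at_line shift_eq0 // => fc0.
  rewrite !inE /= -[X in _ == X](at_line0 d) !at_line_eq; nlia.
move=> KS sS avS; have Sc := triple_clique rk0 off KS sS.
have /cliqueP SS := Sc.
move: (sS) (off); rewrite sub_triple /off_line => /and3P[pS qS cS] /=.
have [ec [fc [ecn fcn cE]]] := at_line_surj d p c.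
rewrite cE across_at_line shift_eq0 // => fc0.
set q := at_line d p r 0 in qS; set w := at_line d p 1 0.
have near x : x \in S -> torus_dist n w x < r /\
    exists e f, [/\ e < n, f < n, x = at_line d p e f & (0 < f) -> 0 < e < r].
  move=> xS; have [e [f [en fn xE]]] := at_line_surj d p x.
  have := SS _ _ pS xS; have := SS _ _ qS xS; have := SS _ _ xS cS.
  have := SS _ _ pS cS; have := SS _ _ qS cS.
  rewrite /q /w cE xE !torus_dist_at_line0 // !torus_dist_at_line; try nlia.
  move=> qc pc xc qx px.
  have [_ [h1 h2]] := triple_arith1 Hn rk ecn fcn (ltac:(nlia)) pc qc.
  have [f0|f0] := posnP f.
    split; last by exists e, f; split=> //; rewrite f0.
    rewrite f0 cyc_dist0 !addn0 in qx px xc *.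
    exact: triple_arith2 Hn rk en h1 h2 px qx xc.
  have [h3 [h4 h5]] := triple_arith1 Hn rk en fn f0 px qx.
  by split=> //; exists e, f; split=> //; nlia.
split; last first.
  move=> [[d' p'] c'] off' rk'; rewrite sub_triple => /and3P[].
  rewrite /= in rk'; rewrite !in_setU1 => pw qw cw.
  have wp0 : torus_dist n w w < r by rewrite torus_dist0; nlia.
  have nearw x : x = w \/ x \in S -> torus_dist n w x < r by case=> [->//|/near[]].
  have rn : r < n by nlia.
  have dpq : torus_dist n p' (at_line d' p' r 0) = r.
    rewrite torus_dist_at_line0 ?cyc_dist0; try nlia.
    by cyc0_case n r; nlia.
  have pS' : p' \in S.
    by case/predU1P: pw => // pw; have := nearw _ (predU1P qw); rewrite -pw dpq ltnn.
  have qS' : at_line d' p' r 0 \in S.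
    case/predU1P: qw => // qw.
    by have := nearw _ (or_intror pS'); rewrite -qw torus_dist_sym dpq ltnn.
  rewrite !inE !negb_or -!andbA.
  have -> : w != p'.
    by apply/eqP => wp; have := nearw _ (or_intror qS'); rewrite wp dpq ltnn.
  have -> : w != at_line d' p' r 0.
    by apply/eqP => wq; have := nearw _ (or_intror pS'); rewrite wq torus_dist_sym dpq ltnn.
  rewrite /=; apply/negP => /eqP wc.
  move: off'; rewrite /off_line /= -wc.
  have [dd|dd] := eqVneq d' d.
    (* Off the line of [w] all vertices lie strictly between 0 and [r] along it, so no parallel
       segment of length [r] fits. *)
    rewrite dd in pS' qS' * => off'.
    have [_ [e [f [en fn pE ef]]]] := near _ pS'.
    have [_ [e' [f' [en' fn' qE ef']]]] := near _ qS'.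
    move: off' qE; rewrite pE /w !across_at_line at_line_at_line shift0 eq_sym shift_eq0 //.
    rewrite addn0 => f0; have [er|er] := ltnP (e + r) n.
      by move/eqP; rewrite at_line_eq //; nlia.
    rewrite -(subnK er) /at_line shiftDn -/(at_line d p _ _) => /eqP.
    by rewrite at_line_eq //; nlia.
  (* The rank leaves only a vertical segment against a horizontal one. Its line cannot contain both
     [p] and [q], so one of them would have formed a removed vertical triple in [S] already. *)
  have [d'E dE] : d' = false /\ d = true.
    by move: rk' dd; case: (d') => /=; case: (d).
  move=> _; have av x : x \in S -> across d' x != across d' p' -> False.
    move=> xS offx; have := avS (d', p', x) offx.
    by rewrite sub_triple pS' qS' xS d'E dE /= => /(_ isT).
  have pq : across d' p != across d' q.
    by rewrite d'E /q dE /= eq_sym shift_eq0 //; nlia.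
  have [pE|/(av _ pS)//] := eqVneq (across d' p) (across d' p').
  by apply: (av _ qS); rewrite eq_sym -pE.
apply/scaleP; split; first exact: setU1_neq0.
by left; apply: cliqueU => // x /near[/ltnW].
Qed.

End Scale.

Lemma shift_congr n (a : 'I_n) d e : d = e \/ d = e + n \/ d = e + n + n ->
  shift a d = shift a e.
Proof. by case=> [->|[|]->] //; rewrite ?shiftDn. Qed.

Lemma shift_inj n (a : 'I_n) d e : e < n -> d < n + n -> shift a d = shift a e ->
  d = e \/ d = e + n.
Proof.
move=> en dn; have [dn'|dn'] := ltnP d n.
  by move/eqP; rewrite shift_eq // => /eqP; left.
rewrite -(subnK dn') shiftDn => /eqP; rewrite shift_eq //; last by clear -dn dn'; nlia.
by move/eqP => <-; right; rewrite subnK.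
Qed.

Lemma cyc_dist_oppn n (a : 'I_n) f f' : f < n -> f' < n ->
  cyc_dist n (shift a (n - f)) (shift a (n - f')) = cyc_dist n f f'.
Proof.
move=> fn fn'.
have opp g : g < n -> exists2 h, h < n /\ (h + g = n \/ h = 0 /\ g = 0) & shift a (n - g) = shift a h.
  move=> gn; have [->|g0] := posnP g.
    by exists 0; [nlia|rewrite subn0 (shift_congr _ (e := 0)) //; nlia].
  by exists (n - g); first by nlia.
have [h [hn hf] ->] := opp f fn; have [h' [hn' hf'] ->] := opp f' fn'.
rewrite cyc_dist_shift //; have := cyc_dist_spec hn hn'; have := cyc_dist_spec fn fn'.
by case=> -[? [? ?]] [] [? [? ?]]; nlia.
Qed.

Section Signed.
Variable n : nat.
Implicit Types (s : bool) (p c : 'I_n * 'I_n).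

(* The sign [s] tells whether the second coordinate runs forwards or backwards. *)
Definition at_sign s p (e f : nat) : 'I_n * 'I_n :=
  (shift p.1 e, shift p.2 (if s then f else n - f)).

Lemma at_sign_surj s p c : exists e f, [/\ e < n, f < n & c = at_sign s p e f].
Proof.
have [e en E] := shift_surj p.1 c.1; have [f fn F] := shift_surj p.2 c.2.
have [g gn G] : exists2 g, g < n & shift p.2 f = shift p.2 (if s then g else n - g).
  case: s; first by exists f.
  have [f0|f0] := posnP f; first by exists 0; [nlia|apply: esym; apply: shift_congr; nlia].
  by exists (n - f); [nlia|apply: shift_congr; nlia].
by exists e, g; split=> //; rewrite /at_sign -E -G -F -surjective_pairing.
Qed.

Lemma at_sign0 s p : at_sign s p 0 0 = p.
Proof.
rewrite /at_sign shift0 (shift_congr _ (e := 0)) ?shift0 -?surjective_pairing //.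
by case: s; nlia.
Qed.

Lemma torus_dist_at_sign s p e f e' f' : e < n -> f < n -> e' < n -> f' < n ->
  torus_dist n (at_sign s p e f) (at_sign s p e' f') = cyc_dist n e e' + cyc_dist n f f'.
Proof.
move=> en fn en' fn'; rewrite /torus_dist /at_sign; cbn [fst snd].
by rewrite cyc_dist_shift //; case: s; rewrite ?cyc_dist_oppn // cyc_dist_shift.
Qed.

Lemma torus_dist_at_sign0 s p e f : e < n -> f < n ->
  torus_dist n p (at_sign s p e f) = cyc_dist n 0 e + cyc_dist n 0 f.
Proof. by move=> en fn; rewrite -{1}(at_sign0 s p) torus_dist_at_sign; nlia. Qed.

Lemma at_sign_inj2 s p e f e' f' : f < n -> f' < n ->
  (at_sign s p e f).2 = (at_sign s p e' f').2 -> f = f'.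
Proof.
move=> fn fn'; rewrite /at_sign; cbn [fst snd].
case: s; first by move=> /shift_inj; nlia.
have [f0|f0] := posnP f.
  by rewrite f0 (shift_congr _ (e := 0)) => [/esym/shift_inj|]; nlia.
by move/esym/shift_inj; nlia.
Qed.

Lemma at_sign_inj1 s p e f e' f' : e < n -> e' < n ->
  (at_sign s p e f).1 = (at_sign s p e' f').1 -> e = e'.
Proof. by move=> en en' /shift_inj; nlia. Qed.

Lemma at_sign_inj s p e f e' f' : e < n -> f < n -> e' < n -> f' < n ->
  at_sign s p e f = at_sign s p e' f' -> e = e' /\ f = f'.
Proof.
move=> en fn en' fn' E; split.
  exact: at_sign_inj1 en en' (congr1 fst E).
exact: at_sign_inj2 fn fn' (congr1 snd E).
Qed.

Lemma slanted_across s p x y d : 0 < x < n -> 0 < y < n ->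
  across d (at_sign s p x y) != across d p.
Proof.
move=> xn yn; apply/eqP; rewrite -{2}(at_sign0 s p).
by case: d => E; [have := @at_sign_inj2 s p x y 0 0 (ltac:(nlia)) (ltac:(nlia)) E
  |have := @at_sign_inj1 s p x y 0 0 (ltac:(nlia)) (ltac:(nlia)) E]; nlia.
Qed.

End Signed.

(** * Lowering the scale: slanted pairs *)

Section Edges.
Variables n k : nat.
Hypotheses (Hn : n = 3 * k - 1) (Hk : 1 < k).
Implicit Types (s d : bool) (p q c u v : 'I_n * 'I_n) (S : {set 'I_n * 'I_n}).

Definition edge (i : bool * ('I_n * 'I_n) * ('I_n * 'I_n)) : {set 'I_n * 'I_n} :=
  [set i.1.2; at_sign i.1.1 i.1.2 i.2.1 i.2.2].

Definition slanted r (i : bool * ('I_n * 'I_n) * ('I_n * 'I_n)) : bool :=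
  [&& 0 < i.2.1, 0 < i.2.2 & i.2.1 + i.2.2 == r].

(* One unit from [p] towards the other end in the longer direction, and in both
   directions when they are equally long. *)
Definition apex (i : bool * ('I_n * 'I_n) * ('I_n * 'I_n)) : 'I_n * 'I_n :=
  at_sign i.1.1 i.1.2 (i.2.2 <= i.2.1) (i.2.1 <= i.2.2).

Lemma thin_axis r S d u v x : 0 < r <= k -> thin k r S -> u \in S -> v \in S -> x \in S ->
  across d u = across d v -> across d x != across d u -> torus_dist n u v <> r.
Proof.
move=> rk /andP[_ /forallP avS] uS vS xS uv xu; have rn : r < n by nlia.
have [e [f [en fn vE]]] := at_line_surj d u v.
have f0 : f = 0.
  by apply/eqP; rewrite -(shift_eq0 (across d u)) // -(across_at_line d u e) -vE uv.
rewrite vE f0 in uv vS *; rewrite torus_dist_at_line0 ?cyc_dist0 ?addn0 //; last by nlia.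
have av u' v' : u' \in S -> v' \in S -> across d u' = across d u -> v' = at_line d u' r 0 -> False.
  move=> uS' vS' uu' v'E; have := avS (d, u', x).
  by rewrite /off_line sub_triple /= uu' xu uS' -v'E vS' xS.
move=> er; have [er'|er'] := cyc_dist0_spec en.
  by apply: (av u (at_line d u e 0)) => //; rewrite -er; case: er' => -> _.
apply: (av (at_line d u e 0) u) => //; rewrite at_line_at_line -{1}(at_line0 d u).
by congr on_line; apply: esym; apply: shift_congr; nlia.
Qed.

Lemma slanted_clique r S s p x y : 0 < x < n -> 0 < y < n -> scale k r S ->
  p \in S -> at_sign s p x y \in S -> clique r S.
Proof.
move=> xn yn /scaleP[_ [//|[d /andP[/in_lineP SL _]]]] pS qS.
by have := slanted_across s p d xn yn; rewrite (SL _ _ qS pS) eqxx.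
Qed.

Lemma slanted_axis r S s p x y d u v : 0 < r <= k -> 0 < x < n -> 0 < y < n ->
  thin k r S -> p \in S -> at_sign s p x y \in S -> u \in S -> v \in S ->
  across d u = across d v -> torus_dist n u v <> r.
Proof.
move=> rk xn yn tS pS qS uS vS uv; have pq := slanted_across s p d xn yn.
have [pu|pu] := eqVneq (across d p) (across d u).
  by apply: thin_axis rk tS uS vS qS uv _; rewrite -pu.
exact: thin_axis rk tS uS vS pS uv pu.
Qed.

Definition straight r S : bool :=
  thin k r S && [forall i, slanted r i ==> ~~ (edge i \subset S)].

Lemma sub_edge s p x y S :
  (edge (s, p, (x, y)) \subset S) = (p \in S) && (at_sign s p x y \in S).
Proof. exact: sub_set2. Qed.

(** Positive slope has rank 0 and goes first. The bound on [r] keeps the apex away from the other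
    end of the pair: for [r = 2] both would be [(1, 1)]. *)
Lemma collapses_straight r : 2 < r <= k -> collapses (thin k r) (straight r).
Proof.
move=> rk; have rk0 : 0 < r <= k by nlia.
apply: (collapses_batch (P := slanted r) (rk := fun i => ~~ i.1.1 : nat) (s := edge)
  (w := apex)) => [[[s p] [x y]] /and3P[/= x0 y0 /eqP xy]|].
  split; first by apply/set0Pn; exists p; rewrite !inE eqxx.
  have xn := ltn_ord x; have yn := ltn_ord y.
  have wx1 : (y <= x) < n by apply: leq_ltn_trans (leq_b1 _) _; nlia.
  have wy1 : (x <= y) < n by apply: leq_ltn_trans (leq_b1 _) _; nlia.
  have n0 : 0 < n by nlia.
  rewrite /apex !inE /= -{2}(at_sign0 s p); apply/negP => /orP[] /eqP/at_sign_inj.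
    by move=> /(_ wx1 wy1 n0 n0)[]; case: (leqP y x); case: (leqP x y) => /=; nlia.
  by move=> /(_ wx1 wy1 xn yn)[]; case: (leqP y x); case: (leqP x y) => /=; nlia.
move=> [[s p] [x y]] S /and3P[/= x0 y0 /eqP xy] tS.
rewrite sub_edge => /andP[pS qS] avS; set q := at_sign s p x y in qS.
have xn := ltn_ord x; have yn := ltn_ord y.
pose wx : nat := (y <= x); pose wy : nat := (x <= y).
have wE : apex (s, p, (x, y)) = at_sign s p wx wy by [].
rewrite wE; have hw : apex_coords x y wx wy.
  by rewrite /apex_coords /wx /wy; case: (ltngtP x y) => xy'; [right; left|left|right; right].
have wx1 : wx < n by apply: leq_ltn_trans (leq_b1 _) _; nlia.
have wy1 : wy < n by apply: leq_ltn_trans (leq_b1 _) _; nlia.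
clearbody wx wy; set w := at_sign s p wx wy.
have x0' : 0 < x < n by nlia.
have y0' : 0 < y < n by nlia.
have /andP[sS _] := tS; have /cliqueP SS := slanted_clique x0' y0' sS pS qS.
have nax := slanted_axis rk0 x0' y0' tS pS qS.
have near c : c \in S -> exists e f, [/\ e < n, f < n, c = at_sign s p e f,
    cyc_dist n 0 e + cyc_dist n 0 f <= r & cyc_dist n x e + cyc_dist n y f <= r].
  move=> cS; have [e [f [en fn cE]]] := at_sign_surj s p c.
  have := SS _ _ pS cS; have := SS _ _ qS cS; rewrite /q cE torus_dist_at_sign //.
  by rewrite torus_dist_at_sign0 // => h1 h2; exists e, f.
have wS c : c \in S -> torus_dist n w c <= r.
  move=> /near[e [f [en fn -> h1 h2]]]; rewrite torus_dist_at_sign //.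
  exact: edge_arith Hn rk en fn x0 y0 xy hw h1 h2.
have wax d c : c \in S -> across d w = across d c -> torus_dist n w c <> r.
  move=> /near[e [f [en fn -> h1 h2]]]; rewrite torus_dist_at_sign //.
  have [hx hy] := edge_arith_axis Hn rk en fn x0 y0 xy hw h1 h2.
  case: d => E.
    have {}E := at_sign_inj2 (s := s) (p := p) (e := wx) (e' := e) wy1 fn E; have := hx (esym E).
    by rewrite E cyc_dist0 addn0 => h h'; rewrite h' ltnn in h.
  have {}E := at_sign_inj1 (s := s) (p := p) (f := wy) (f' := f) wx1 en E; have := hy (esym E).
  by rewrite E cyc_dist0 add0n => h h'; rewrite h' ltnn in h.
have waxS d u v : u \in w |: S -> v \in w |: S -> across d u = across d v ->
    torus_dist n u v <> r.
  rewrite !in_setU1 => /predU1P[->|uS] /predU1P[->|vS] uv.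
  - by rewrite torus_dist0; nlia.
  - exact: wax uv.
  - by rewrite torus_dist_sym; apply: wax (esym uv).
  - exact: nax uv.
split.
  apply/andP; split.
    apply/scaleP; split; first exact: setU1_neq0.
    by left; apply: cliqueU => //; exact: (slanted_clique x0' y0' sS pS qS).
  apply/forallP => -[[d u] c]; apply/implyP => off; rewrite sub_triple.
  apply/negP => /and3P[uS vS _]; apply: (waxS d _ _ uS vS).
    by rewrite across_at_line shift0.
  have rn : r < n by nlia.
  by rewrite torus_dist_at_line0 ?cyc_dist0 ?addn0; try nlia; cyc0_case n r; nlia.
move=> [[s' p'] [x' y']] /and3P[/= x'0 y'0 /eqP xy'] rks; rewrite sub_edge => /andP[pS' qS'].
rewrite !inE negb_or; cbn [fst snd].
have xn' := ltn_ord x'; have yn' := ltn_ord y'.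
have pqr : torus_dist n p' (at_sign s' p' x' y') = r.
  by rewrite torus_dist_at_sign0 //; cyc0_case n x'; cyc0_case n y'; nlia.
have wother a b : a = w -> b \in w |: S -> torus_dist n a b = r -> b \in S.
  move=> -> /[!in_setU1] /predU1P[->|//]; rewrite torus_dist0; nlia.
have wq'S : w = p' -> at_sign s' p' x' y' \in S.
  by move=> wp; apply: wother pqr.
have wp'S : w = at_sign s' p' x' y' -> p' \in S.
  by move=> wq; apply: (wother _ _ (esym wq)) => //; rewrite torus_dist_sym.
have wx2 : wx <= 1 /\ wy <= 1 by case: hw; nlia.
(* For positive slope only pairs of the same slope matter. For negative slope both kinds do, but
   pairs of positive slope are absent from [S]; in the mirrored coordinates of [at_sign] they are
   exactly the pairs of negative slope that [edge_arith_neg] excludes. *)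
have [sT|sF] : s = true \/ s = false by case: (s); [left|right].
  have s'T : s' = true by move: rks; rewrite sT; case: (s').
  apply/andP; split; apply/eqP => wE'.
    have [e [f [en fn E h1 h2]]] := near _ (wq'S wE').
    have [+ _] := edge_arith_pos Hn rk en fn x0 y0 xy hw x'0 y'0 xy' h1 h2; apply.
    rewrite -wE' /w sT s'T /at_sign in E.
    have E1 := congr1 fst E; have E2 := congr1 snd E.
    cbn [fst snd] in E1, E2; rewrite !shift_shift in E1 E2.
    have := shift_inj (d := wx + x') en (ltac:(nlia)) E1.
    have := shift_inj (d := wy + y') fn (ltac:(nlia)) E2.
    by move=> ? ?; split; nlia.
  have [e [f [en fn E h1 h2]]] := near _ (wp'S wE').
  have [_ +] := edge_arith_pos Hn rk en fn x0 y0 xy hw x'0 y'0 xy' h1 h2; apply.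
  rewrite E /w sT s'T /at_sign in wE'.
  have E1 := congr1 fst wE'; have E2 := congr1 snd wE'.
  cbn [fst snd] in E1, E2; rewrite !shift_shift in E1 E2.
  split; [apply: (shift_inj _ _ (esym E1)) | apply: (shift_inj _ _ (esym E2))] => //; nlia.
have av u E F : u \in S -> at_sign true u E F \in S -> 0 < E -> 0 < F -> E + F = r -> False.
  move=> uS vS E0 F0 EF; have En : E < n by nlia.
  have Fn : F < n by nlia.
  have := avS (true, u, (Ordinal En, Ordinal Fn)); rewrite sF sub_edge uS vS /slanted /= E0 F0 EF eqxx.
  by move/(_ isT isT).
have wlt c : c \in S -> torus_dist n w c < r.
  move=> cS; have [e [f [en fn cE h1 h2]]] := near _ cS.
  rewrite cE torus_dist_at_sign //.
  have pc d : across d p = across d c -> torus_dist n p c <> r by move=> E; exact: nax E.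
  have qc d : across d q = across d c -> torus_dist n q c <> r by move=> E; exact: nax E.
  rewrite cE torus_dist_at_sign0 // in pc; rewrite /q cE torus_dist_at_sign // in qc.
  apply: (edge_arith_neg Hn rk en fn x0 y0 xy hw h1 h2).
  - case=> f0 er; apply: (pc true); last by rewrite f0 er cyc_dist0 addn0.
    by rewrite -{1}(at_sign0 s p) f0.
  - case=> e0 er; apply: (pc false); last by rewrite e0 er cyc_dist0.
    by rewrite -{1}(at_sign0 s p) e0.
  - by case=> fy er; apply: (qc true); rewrite ?fy ?er ?cyc_dist0 ?addn0.
  - by case=> ex er; apply: (qc false); rewrite ?ex ?er ?cyc_dist0.
  - move=> E F E0 F0 EF; split=> -[eE fF].
      apply: (av p E F) => //; rewrite (_ : at_sign _ _ _ _ = c) //.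
      by rewrite cE sF /at_sign eE; congr pair; apply: shift_congr; nlia.
    apply: (av c E F) => //; rewrite (_ : at_sign _ _ _ _ = p) //.
    rewrite -[RHS](at_sign0 true) cE sF /at_sign; cbn [fst snd]; rewrite !shift_shift.
    by congr pair; apply: shift_congr; nlia.
  - move=> E F E0 F0 EF; split=> -[eE fF].
      apply: (av q E F) => //; rewrite (_ : at_sign _ _ _ _ = c) //.
      rewrite cE /q sF /at_sign; cbn [fst snd]; rewrite !shift_shift.
      congr pair; first by (case: eE => ?; [|symmetry]); apply: shift_congr; nlia.
      by apply: shift_congr; nlia.
    apply: (av c E F) => //; rewrite (_ : at_sign _ _ _ _ = q) //.
    rewrite cE /q sF /at_sign; cbn [fst snd]; rewrite !shift_shift.
    by congr pair; apply: shift_congr; nlia.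
apply/andP; split; apply/eqP => wE'.
  by have := wlt _ (wq'S wE'); rewrite wE' pqr ltnn.
by have := wlt _ (wp'S wE'); rewrite wE' torus_dist_sym pqr ltnn.
Qed.

End Edges.

(** * From the Rips complex at scale k to the grid complex *)

Section Reduction.
Variables n k : nat.
Hypotheses (Hn : n = 3 * k - 1) (Hk : 1 < k).
Implicit Types (s d : bool) (p q c u v : 'I_n * 'I_n) (S : {set 'I_n * 'I_n}).

Lemma clique_le r r' S : r <= r' -> clique r S -> clique r' S.
Proof.
by move=> rr /cliqueP SS; apply/cliqueP => p q pS qS; exact: leq_trans (SS _ _ pS qS) rr.
Qed.

Lemma clique_on_cycle r d S : S != set0 -> r <= k -> clique r S -> in_line d S ->
  on_cycle k d S.
Proof.
move=> S0 rk /cliqueP SS SL; rewrite /on_cycle SL; apply/cyc_cliqueP.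
rewrite imset_eq0; split=> // _ _ /imsetP[p pS ->] /imsetP[q qS ->].
apply: leq_trans (leq_trans (SS _ _ pS qS) rk).
by rewrite /torus_dist /along; case: d {SL}; rewrite ?leq_addr ?leq_addl.
Qed.

Lemma not_in_line d S u : in_line d S = false -> u \in S ->
  exists2 x, x \in S & across d x != across d u.
Proof.
move=> SL uS; apply/exists_inP; apply: contraFT SL.
rewrite negb_exists_in => /forall_inP SL; apply/in_lineP => p q pS qS.
by move: (SL _ pS) (SL _ qS); rewrite !negbK => /eqP-> /eqP->.
Qed.

Lemma thin_axis_line r d S u v : 0 < r <= k -> thin k r S -> in_line d S = false ->
  u \in S -> v \in S -> across d u = across d v -> torus_dist n u v <> r.
Proof.
move=> rk tS SL uS vS uv; have [x xS xu] := not_in_line SL uS.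
exact: (thin_axis Hn Hk rk tS uS vS xS uv xu).
Qed.

(** A clique with a pair at distance [r] and none of the removed faces must lie in a line, and there
    [on_cycle] retains it because [r <= k]. *)
Lemma straightE r : 2 < r <= k -> straight k r =1 @scale n k r.-1.
Proof.
move=> rk S; have rk0 : 0 < r <= k by nlia.
apply/idP/idP.
  move=> /andP[tS /forallP eS]; have /andP[sS _] := tS.
  have /scaleP[S0 cS] := sS; apply/scaleP; split=> //.
  case: cS => [cS|]; last by right.
  have [L1|L1] := boolP (in_line true S).
    by right; exists true; apply: (clique_on_cycle (r := r)) => //; nlia.
  have [L2|L2] := boolP (in_line false S).
    by right; exists false; apply: (clique_on_cycle (r := r)) => //; nlia.
  left; apply/cliqueP => u v uS vS; move/cliqueP: cS => SS.
  have := SS _ _ uS vS; rewrite leq_eqVlt => /orP[/eqP uv|]; last by nlia.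
  exfalso; have [e [f [en fn vE]]] := at_sign_surj true u v.
  have noe s p x y : 0 < x -> 0 < y -> x + y = r -> p \in S -> at_sign s p x y \in S -> False.
    move=> x0 y0 xy pS qS; have xn : x < n by nlia.
    have yn : y < n by nlia.
    have := eS (s, p, (Ordinal xn, Ordinal yn)).
    by rewrite sub_edge pS qS /slanted /= x0 y0 xy eqxx.
  have := uv; rewrite vE torus_dist_at_sign0 // => ef.
  have nax d : across d u = across d v -> False.
    by move=> E; apply: (thin_axis_line rk0 tS _ uS vS E uv); case: (d); apply: negbTE.
  have [e0|e0] := posnP e.
    by apply: (nax false); rewrite vE e0 /= shift0.
  have [f0|f0] := posnP f.
    by apply: (nax true); rewrite vE f0 /= shift0.
  have [[eE _]|[eE _]] := cyc_dist0_spec en; have [[fE _]|[fE _]] := cyc_dist0_spec fn.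
  - by apply: (noe true u e f) => //; [nlia|rewrite -vE].
  - have E : at_sign false u e (n - f) = v.
      by rewrite vE /at_sign; congr pair; apply: shift_congr; nlia.
    apply: (noe false u e (n - f)); rewrite ?E //; nlia.
  - have E : at_sign false v (n - e) f = u.
      rewrite vE -[RHS](at_sign0 true) /at_sign; cbn [fst snd]; rewrite !shift_shift.
      by congr pair; apply: shift_congr; nlia.
    apply: (noe false v (n - e) f); rewrite ?E //; nlia.
  - have E : at_sign true v (n - e) (n - f) = u.
      rewrite vE -[RHS](at_sign0 true) /at_sign; cbn [fst snd]; rewrite !shift_shift.
      by congr pair; apply: shift_congr; nlia.
    apply: (noe true v (n - e) (n - f)); rewrite ?E //; nlia.
move=> sS; have /scaleP[S0 cS] := sS; apply/andP; split.
  apply/andP; split.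
    apply/scaleP; split=> //; case: cS => [cS|]; last by right.
    by left; apply: clique_le cS; nlia.
  apply/forallP => -[[d p] c]; apply/implyP => off; apply/negP => tS.
  have /cliqueP SS := triple_clique Hn Hk rk0 off sS tS.
  move: tS; rewrite sub_triple => /and3P[pS qS _]; have := SS _ _ pS qS.
  rewrite torus_dist_at_line0 ?cyc_dist0; try nlia.
  have rn : r < n by nlia.
  by cyc0_case n r; nlia.
apply/forallP => -[[s p] [x y]]; apply/implyP => /and3P[/= x0 y0 /eqP xy].
have xn := ltn_ord x; have yn := ltn_ord y.
rewrite sub_edge; apply/negP => /andP[pS qS].
have x0n : 0 < x < n by nlia.
have y0n : 0 < y < n by nlia.
have /cliqueP SS := slanted_clique x0n y0n sS pS qS.
have := SS _ _ pS qS; rewrite torus_dist_at_sign0 //.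
by cyc0_case n x; cyc0_case n y; nlia.
Qed.

Lemma collapses_scale2 : collapses (@scale n k k) (@scale n k 2).
Proof.
suff H m r : r <= k -> r = m + 2 -> collapses (@scale n k r) (@scale n k 2).
  by apply: (H (k - 2)); nlia.
elim: m r => [|m IH] r rk rE; first by rewrite rE; apply: collapses_eq.
apply: collapses_trans (collapses_thin Hn Hk _) _; first by nlia.
apply: collapses_trans (collapses_straight Hn Hk _) _; first by nlia.
apply: collapses_trans (collapses_eq (straightE _)) _; first by nlia.
by apply: IH; nlia.
Qed.

(** At scale 2 only the pairs of this slope are removed; those of the other slope become the
    diagonals of the triangulated squares. *)
Definition antidiag p : {set 'I_n * 'I_n} := [set p; at_sign false p 1 1].

(** The difference 0 and the six edge directions of the triangulated torus, with [n - 1] standing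
    for -1. *)
Definition unit_offset (e f : nat) : bool :=
  [|| (e == 0) && (f == 0), (e == 1) && (f == 0), (e == n - 1) && (f == 0),
      (e == 0) && (f == 1), (e == 0) && (f == n - 1), (e == 1) && (f == 1)
    | (e == n - 1) && (f == n - 1)].

(** A simplex in no line has two vertices that differ in both coordinates. These form a diagonal of
    a unit square, and every other vertex is a corner of that square. *)
Lemma straight2_grid S :
  @thin n k 2 S && [forall p, xpredT p ==> ~~ (antidiag p \subset S)] ->
  grid (@cyc_clique n k) xpredT S.
Proof.
have rk : 0 < 2 <= k by nlia.
have n1 : 1 < n by nlia.
move=> /andP[tS /forallP aS]; have /andP[/scaleP[S0 cS] _] := tS.
apply/gridP; split=> //.
case: cS => [cS|[d /andP[SL SC]]]; last by left; exists d.
have [/(clique_on_cycle S0 Hk cS)/andP[L1 L2]|L1] := boolP (in_line true S).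
  by left; exists true.
have [/(clique_on_cycle S0 Hk cS)/andP[L2 L3]|L2] := boolP (in_line false S).
  by left; exists false.
right; have L d : in_line d S = false by case: d; exact: negbTE.
have /cliqueP SS := cS.
have aS' u v : u \in S -> v \in S -> v = at_sign false u 1 1 -> False.
  by move=> uS vS vE; have := aS u; rewrite sub_set2 uS -vE vS.
have rel u v : u \in S -> v \in S ->
    exists e f, [/\ e < n, f < n, v = at_line true u e f & unit_offset e f].
  move=> uS vS; have [e [f [en fn vE]]] := at_line_surj true u v.
  exists e, f; split=> //; have := SS _ _ uS vS.
  have := thin_axis_line rk tS (L true) uS vS; have := thin_axis_line rk tS (L false) uS vS.
  rewrite vE torus_dist_at_line0 // => a2 a1 uv.
  have {}a1 : f = 0 -> cyc_dist n 0 e <> 2.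
    by move=> f0 e2; apply: a1; rewrite f0 ?e2 ?cyc_dist0 //= shift0.
  have {}a2 : e = 0 -> cyc_dist n 0 f <> 2.
    by move=> e0 f2; apply: a2; rewrite e0 ?f2 ?cyc_dist0 //= shift0.
  have b1 : ~ (e = 1 /\ f = n - 1).
    by move=> [eE fE]; apply: (aS' u v uS vS); rewrite vE eE fE.
  have b2 : ~ (e = n - 1 /\ f = 1).
    move=> [eE fE]; apply: (aS' v u vS uS); rewrite vE eE fE -[LHS](at_sign0 true).
    rewrite /at_sign /at_line /=; rewrite !shift_shift.
    by congr pair; symmetry; apply: shift_congr; nlia.
  have ee : e = 0 \/ e = 1 \/ e = n - 1.
    by clear b1 b2 a2; move: uv a1; cyc0_case n e; cyc0_case n f; nlia.
  have ff : f = 0 \/ f = 1 \/ f = n - 1.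
    by clear b1 b2 a1 ee; move: uv a2; cyc0_case n e; cyc0_case n f; nlia.
  clear uv a1 a2; rewrite /unit_offset.
  by case: ee => [?|[?|?]]; case: ff => [?|[?|?]]; subst e f; rewrite ?eqxx ?orbT //;
    exfalso; nlia.
have pairD u v : u \in S -> v \in S -> (forall d, across d u != across d v) ->
    exists2 p, p \in S & diag p \in S.
  move=> uS vS uv; have [e [f [en fn vE ef]]] := rel u v uS vS.
  have e0 : e != 0.
    by apply: contraNneq (uv false) => e0; rewrite vE e0 /= shift0.
  have f0 : f != 0.
    by apply: contraNneq (uv true) => f0; rewrite vE f0 /= shift0.
  have [[eE fE]|[eE fE]] : e = 1 /\ f = 1 \/ e = n - 1 /\ f = n - 1.
    by move: ef; rewrite /unit_offset; nlia.
    by exists u; rewrite // (_ : diag u = v) // vE eE fE.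
  exists v => //; rewrite (_ : diag v = u) // vE eE fE -[RHS](at_line0 true).
  rewrite -[diag _]/(at_line true _ 1 1) at_line_at_line /at_line.
  by congr pair; apply: shift_congr; nlia.
have [p pS dS] : exists2 p, p \in S & diag p \in S.
  have [u uS] := set0Pn _ S0.
  have [x xS xu] := not_in_line (L true) uS; have [y yS yu] := not_in_line (L false) uS.
  have [xE|xE] := eqVneq (across false x) (across false u); last first.
    by apply: (pairD x u) => // -[].
  have [yE|yE] := eqVneq (across true y) (across true u); last first.
    by apply: (pairD y u) => // -[].
  by apply: (pairD x y) => // -[]; [rewrite yE|rewrite xE eq_sym].
have near c : c \in S -> exists e f, [/\ e <= 1, f <= 1 & c = at_line true p e f].
  move=> cS'; have [e [f [en fn cE ef]]] := rel p c pS cS'.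
  have [g [h [gn hn cE' gh]]] := rel _ c dS cS'; exists e, f.
  move: cE'; rewrite cE -[diag p]/(at_line true p 1 1) at_line_at_line => E.
  have := shift_inj en (_ : 1 + g < n + n) (esym (congr1 fst E)).
  have := shift_inj fn (_ : 1 + h < n + n) (esym (congr1 snd E)).
  move=> /(_ (ltac:(nlia))) E2 /(_ (ltac:(nlia))) E1; split=> //;
    by move: ef gh; rewrite /unit_offset; nlia.
have step1 : step true p = at_line true p 1 0 by rewrite /at_line shift0.
have step2 : step false p = at_line true p 0 1 by rewrite /at_line shift0.
apply/in_triP; exists (at_line true p 1 0 \in S), p; split=> //.
apply/subsetP => c cS'; have [e [f [e1 f1 cE]]] := near c cS'.
rewrite !inE; have [pE dE] : p = at_line true p 0 0 /\ diag p = at_line true p 1 1.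
  by rewrite at_line0.
have Eq g h : g <= 1 -> h <= 1 -> (c == at_line true p g h) = (e == g) && (f == h).
  by move=> g1 h1; rewrite cE at_line_eq; nlia.
have [b|b] := boolP (at_line true p 1 0 \in S).
  rewrite step1 {1}pE dE !Eq //; have : ~ (e = 0 /\ f = 1); last by nlia.
  move=> [e0 f0]; have [g [h [gn hn cE' gh]]] := rel _ c b cS'.
  move: cE'; rewrite cE at_line_at_line => E; have en : e < n by nlia.
  have fn : f < n by nlia.
  have := shift_inj (d := 1 + g) en (ltac:(nlia)) (esym (congr1 fst E)).
  have := shift_inj (d := 0 + h) fn (ltac:(nlia)) (esym (congr1 snd E)).
  by move: gh; rewrite /unit_offset; nlia.
rewrite step2 {1}pE dE !Eq //; have : ~ (e = 1 /\ f = 0); last by nlia.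
by move=> [eE fE]; move: b; rewrite eE fE in cE; rewrite -cE cS'.
Qed.

Lemma grid_straight2 S : grid (@cyc_clique n k) xpredT S ->
  @thin n k 2 S && [forall p, xpredT p ==> ~~ (antidiag p \subset S)].
Proof.
have rk : 0 < 2 <= k by nlia.
have one : 0 < 1 < n by nlia.
move=> /gridP[S0 [[d [SL SC]]|/in_triP[d [p [_ Sp]]]]].
  apply/andP; split; first (apply/andP; split).
  - by apply/scaleP; split=> //; right; exists d; apply/andP.
  - apply/forallP => -[[d' u] c]; apply/implyP => off; apply/negP => tS.
    by rewrite (triple_not_line Hn Hk d rk off tS) in SL.
  - apply/forallP => u; rewrite sub_set2; apply/negP => /andP[uS vS].
    have := slanted_across false u d one one; move/in_lineP: SL => SL.
    by rewrite (SL _ _ vS uS) eqxx.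
have near c : c \in S -> exists e f, [/\ e <= 1, f <= 1, c = at_line true p e f &
    ~ (e = ~~ d :> nat /\ f = d :> nat)].
  move=> /(subsetP Sp); have [e [f [en fn ->]]] := at_line_surj true p c.
  have n2 : 2 < n by nlia.
  rewrite /at_line /= mem_tri_shift // => ef.
  by exists e, f; case: (d) ef => /= ef; split=> //; nlia.
have dist u v : u \in S -> v \in S -> torus_dist n u v <= 2 /\
    (forall d', across d' u = across d' v -> torus_dist n u v < 2).
  move=> /near[e [f [e1 f1 uE _]]] /near[g [h [g1 h1 vE _]]].
  have D : torus_dist n u v = (e - g) + (g - e) + ((f - h) + (h - f)).
    rewrite uE vE torus_dist_at_line; try nlia.
    by cyc_case n e g; cyc_case n f h; nlia.
  rewrite D; split; first by nlia.
  move=> d' /eqP; rewrite uE vE; case: d' => /=; rewrite shift_eq; nlia.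
apply/andP; split; first (apply/andP; split).
- by apply/scaleP; split=> //; left; apply/cliqueP => u v uS vS; case: (dist u v uS vS).
- apply/forallP => -[[d' u] c]; apply/implyP => off; apply/negP; rewrite sub_triple.
  move=> /and3P[uS vS _]; have [_ /(_ d')] := dist u _ uS vS.
  rewrite across_at_line shift0 => /(_ erefl).
  rewrite torus_dist_at_line0 ?cyc_dist0; try nlia.
  have n2 : 2 < n by nlia.
  by cyc0_case n 2; nlia.
- apply/forallP => u; rewrite sub_set2; apply/negP => /andP[uS vS].
  have [e [f [e1 f1 uE Nu]]] := near u uS; have [g [h [g1 h1 vE Nv]]] := near _ vS.
  move: vE; rewrite uE /at_sign /at_line /=; rewrite !shift_shift => E.
  have gn : g < n by nlia.
  have hn : h < n by nlia.
  have := shift_inj (d := e + 1) gn (ltac:(nlia)) (congr1 fst E).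
  have := shift_inj (d := f + (n - 1)) hn (ltac:(nlia)) (congr1 snd E).
  by case: (d) Nu Nv => /=; nlia.
Qed.

(** In a thin complex a simplex through an antidiagonal stays inside its unit square, so a third
    corner serves as apex. That corner is an end of the other diagonal only, which is not an
    antidiagonal. *)
Lemma collapses_grid : collapses (@thin n k 2) (grid (@cyc_clique n k) xpredT).
Proof.
have rk : 0 < 2 <= k by nlia.
have one : 0 < 1 < n by nlia.
have n1 : 1 < n by nlia.
have n0 : 0 < n by nlia.
apply: collapses_trans (collapses_batch (P := xpredT) (rk := fun=> 0) (s := antidiag)
  (w := fun p => at_sign false p 1 0) _ _) _.
- move=> p _; split; first by apply/set0Pn; exists p; rewrite !inE eqxx.
  rewrite !inE -{2}(at_sign0 false p); apply/negP => /orP[] /eqP/at_sign_inj.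
    by move/(_ n1 n0 n0 n0) => [].
  by move/(_ n1 n0 n1 n1) => [].
- move=> p S _ tS; rewrite sub_set2 => /andP[pS qS] _.
  have /andP[sS _] := tS; have cS := slanted_clique one one sS pS qS.
  have /cliqueP SS := cS.
  have nax := slanted_axis Hn Hk rk one one tS pS qS.
  set q := at_sign false p 1 1 in qS; set w := at_sign false p 1 0.
  have near c : c \in S -> exists e f, [/\ e <= 1, f <= 1 & c = at_sign false p e f].
    move=> cS'; have [e [f [en fn cE]]] := at_sign_surj false p c.
    exists e, f; have := SS _ _ pS cS'; have := SS _ _ qS cS'.
    have := nax true _ _ pS cS'; have := nax true _ _ qS cS'.
    have := nax false _ _ pS cS'; have := nax false _ _ qS cS'.
    rewrite /q cE !torus_dist_at_sign0 // !torus_dist_at_sign // => q2 p2 q1 p1 hq hp.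
    have {}p1 : ~ (f = 0 /\ cyc_dist n 0 e = 2).
      move=> [f0 e2]; apply: p1; last by rewrite f0 e2 cyc_dist0.
      by rewrite -{1}(at_sign0 false p) f0.
    have {}p2 : ~ (e = 0 /\ cyc_dist n 0 f = 2).
      move=> [e0 f2]; apply: p2; last by rewrite e0 f2 cyc_dist0.
      by rewrite -{1}(at_sign0 false p) e0.
    have {}q1 : ~ (f = 1 /\ cyc_dist n 1 e = 2).
      by move=> [f0 e2]; apply: q1; rewrite ?f0 ?e2 ?cyc_dist0.
    have {}q2 : ~ (e = 1 /\ cyc_dist n 1 f = 2).
      by move=> [e0 f2]; apply: q2; rewrite ?e0 ?f2 ?cyc_dist0.
    suff [-> ->] : e <= 1 /\ f <= 1 by [].
    move: hp hq p1 p2 q1 q2.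
    by cyc0_case n e; cyc0_case n f; cyc_case n 1 e; cyc_case n 1 f; split; nlia.
  have wS c : c \in S -> torus_dist n w c <= 2 /\
      (forall d, across d w = across d c -> torus_dist n w c <> 2).
    move=> /near[e [f [e1 f1 ->]]]; rewrite torus_dist_at_sign; try nlia.
    have en : e < n by nlia.
    have fn : f < n by nlia.
    have [eD fD] : cyc_dist n 1 e = 1 - e /\ cyc_dist n 0 f = f.
      by cyc_case n 1 e; cyc0_case n f; nlia.
    rewrite eD fD; split; first by nlia.
    case=> /= E.
      have := at_sign_inj2 (s := false) (p := p) (e := 1) (e' := e) n0 fn E; nlia.
    have := at_sign_inj1 (s := false) (p := p) (f := 0) (f' := f) n1 en E; nlia.
  split; last first.
    move=> p' _ _; rewrite sub_set2 !in_setU1 => /andP[pw qw].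
    have D : torus_dist n p' (at_sign false p' 1 1) = 2.
      by rewrite torus_dist_at_sign0 //; cyc0_case n 1; nlia.
    rewrite !inE negb_or; apply/andP; split; apply/eqP => wE.
      have {qw} : at_sign false p' 1 1 \in S.
        by case/predU1P: qw D => // ->; rewrite -wE torus_dist0.
      move=> /near[e [f [e1 f1 /(congr1 fst)]]]; rewrite -wE; cbn [fst snd at_sign w].
      rewrite /w /at_sign; cbn [fst snd]; rewrite shift_shift => /shift_inj; nlia.
    have {pw} : p' \in S.
      by case/predU1P: pw D => // pw; rewrite -wE pw torus_dist0.
    move=> /near[e [f [e1 f1 pE]]]; have := congr1 snd wE; rewrite pE /w /at_sign.
    cbn [fst snd]; rewrite shift_shift subn0 (shift_congr _ (d := n) (e := 0)); last by nlia.
    by move/esym/shift_inj; nlia.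
  apply/andP; split.
    apply/scaleP; split; first exact: setU1_neq0.
    by left; apply: cliqueU => // c /wS[].
  apply/forallP => -[[d u] c]; apply/implyP => off; rewrite sub_triple.
  apply/negP => /and3P[uS vS _].
  have D : torus_dist n u (at_line d u 2 0) = 2.
    rewrite torus_dist_at_line0 ?cyc_dist0; try nlia.
    have n2 : 2 < n by nlia.
    by cyc0_case n 2; nlia.
  have A : across d u = across d (at_line d u 2 0) by rewrite across_at_line shift0.
  move: uS vS A D; move: (at_line d u 2 0) => v; rewrite !in_setU1.
  case/predU1P=> [->|uS] /predU1P[->|vS] A D.
  + by rewrite torus_dist0 in D.
  + by have [_ /(_ d A)] := wS _ vS.
  + by have [_ /(_ d (esym A))] := wS _ uS; rewrite torus_dist_sym.
  + exact: nax A D.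
apply: collapses_eq => S; apply/idP/idP; first exact: straight2_grid.
exact: grid_straight2.
Qed.

Lemma collapses_VR : collapses (@VR_simplex n k) (grid (@cyc_clique n k) xpredT).
Proof.
apply: collapses_trans (collapses_eq (L := @scale n k k) _) _.
  move=> S; apply/andP/scaleP => -[S0 SS]; split=> //; first by left.
  case: SS => // -[d /andP[/in_lineP SL /cyc_cliqueP[_ SC]]].
  apply/cliqueP => p q pS qS; have := SC _ _ (imset_f _ pS) (imset_f _ qS).
  have := SL _ _ pS qS; rewrite /torus_dist; case: (d) => /= ->.
    by rewrite cyc_dist0 addn0.
  by rewrite cyc_dist0 add0n.
apply: collapses_trans collapses_scale2 _.
apply: collapses_trans (collapses_thin Hn Hk _) _; first by nlia.
exact: collapses_grid.
Qed.

End Reduction.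

(** * Critical simplices *)

Section ConeOff.
Variable V : finType.
Implicit Types (K L : {set V} -> bool) (S T : {set option V}) (v : V).

Definition old S : {set V} := [set v | Some v \in S].

Definition extend K S : bool := (None \notin S) && K (old S).

(* [K] with a cone over [L] attached, whose apex is the new vertex [None]. *)
Definition cone_off K L S : bool :=
  if None \in S then (old S == set0) || L (old S) else K (old S).

Lemma old_Some (T : {set V}) : old (Some @: T) = T.
Proof. by apply/setP => v; rewrite inE mem_imset // => ? ? []. Qed.

Lemma None_Some (T : {set V}) : None \notin Some @: T.
Proof. by apply/imsetP => -[]. Qed.

Lemma Some_old S : None \notin S -> Some @: old S = S.
Proof.
move=> NS; apply/setP => -[v|]; last by rewrite (negPf NS) (negPf (None_Some _)).
by rewrite mem_imset ?inE // => ? ? [].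
Qed.

Lemma old_U S T : old (S :|: T) = old S :|: old T.
Proof. by apply/setP => v; rewrite !inE. Qed.

Lemma old_set1 v : old [set Some v] = [set v].
Proof. by apply/setP => u; rewrite !inE. Qed.

Lemma old_None : old [set None] = set0.
Proof. by apply/setP => u; rewrite !inE. Qed.

Lemma old_subset S T : S \subset T -> old S \subset old T.
Proof. by move=> ST; apply/subsetP => v; rewrite !inE; exact: (subsetP ST). Qed.

Lemma old_eq0 S : None \notin S -> S != set0 -> old S != set0.
Proof.
move=> NS; apply: contra => /eqP S0.
by rewrite -(Some_old NS) S0 imset0.
Qed.

Lemma subset_old_set0 S T : S \subset T -> old S != set0 -> old T != set0.
Proof.
by move=> /old_subset ST; apply: contra => /eqP T0; rewrite -subset0 -T0.
Qed.

Lemma cone_off_down K L : down_closed K -> down_closed L -> (forall S : {set V}, L S -> K S) ->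
  down_closed (cone_off K L).
Proof.
move=> dK dL LK S S' + SS S'0; rewrite /cone_off.
have [NS'|NS'] := boolP (None \in S').
  rewrite (subsetP SS _ NS') => LS; have [//|S'N] := eqVneq (old S') set0.
  move: LS; rewrite (negPf (subset_old_set0 SS S'N)) /= => LS.
  exact: dL LS (old_subset SS) S'N.
have S'N := old_eq0 NS' S'0.
case: ifP => _; last by move=> KS; exact: dK KS (old_subset SS) S'N.
rewrite (negPf (subset_old_set0 SS S'N)) /= => /LK KS.
exact: dK KS (old_subset SS) S'N.
Qed.

(** A face [s] of [L] with apex [w] becomes the face [s] joined with the cone point, again with apex
    [w]; [K] itself is untouched. *)
Lemma collapses_cone_off K L L' : collapses L L' -> collapses (cone_off K L) (cone_off K L').
Proof.
elim=> {L L'} [L L' LL|L L' s w s0 ws Lw _ IH].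
  by apply: collapses_eq => S; rewrite /cone_off LL.
have subE S : (None |: Some @: s \subset S) = (None \in S) && (s \subset old S).
  rewrite subUset sub1set; congr andb; apply/subsetP/subsetP => sS v.
    by move=> vs; rewrite inE; apply: sS; exact: imset_f.
  by move=> /imsetP[u us ->]; have := sS u us; rewrite inE.
have old0 S : s \subset old S -> old S != set0.
  by apply: contraTN => /eqP->; rewrite subset0.
apply: (@collapses_step _ _ _ (None |: Some @: s) (Some w)).
- by apply/set0Pn; exists None; rewrite !inE.
- by rewrite !inE mem_imset // => ? ? [].
- move=> S; rewrite subE /cone_off => KS /andP[NS sS].
  rewrite in_setU1 NS /= old_U old_set1; apply/orP; right; apply: Lw => //.
  by move: KS; rewrite NS (negPf (old0 _ sS)).
- apply: collapses_trans IH; apply: collapses_eq => S; rewrite subE /cone_off.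
  case: (None \in S); rewrite /= ?andbT //.
  have [->|//] := eqVneq (old S) set0; rewrite subset0 s0 //.
Qed.

(** When [L] has shrunk to [v0], only the edge from [v0] to the cone point is left of the cone. So
    coning off a collapsible subcomplex keeps the homotopy type. *)
Lemma collapses_cone_off_point K L v0 : collapses L (fun S : {set V} => S == [set v0]) ->
  collapses (cone_off K L) (extend K).
Proof.
move=> /(collapses_cone_off K) col; apply: collapses_trans col _.
apply: (@collapses_step _ _ _ [set None] (Some v0)); try by rewrite ?inE // ?set1_neq0.
- by apply/set0Pn; exists None; rewrite inE.
- move=> S; rewrite sub1set /cone_off in_setU1 => + NS.
  rewrite NS orbT old_U old_set1 => /orP[/eqP->|/eqP->].
    by rewrite setU0 eqxx orbT.
  by rewrite setUid eqxx orbT.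
- apply: collapses_eq => S; rewrite sub1set /cone_off /extend.
  by case: (None \in S); rewrite /= ?andbF ?andbT.
Qed.

Section Facets.
Variables (K : {set V} -> bool) (I : finType) (crit : I -> {set V}).
Hypothesis Kcrit : forall i, K (crit i).
Hypothesis crit_max : forall i (S : {set V}), K S -> crit i \subset S -> S = crit i.
Hypothesis crit0 : forall i, crit i != set0.

Definition noncritical (S : {set V}) := K S && [forall i, S != crit i].

Lemma noncritical_down : down_closed K -> down_closed noncritical.
Proof.
move=> dK S S' /andP[KS /forallP NS] SS S0; rewrite /noncritical (dK S) //=.
apply/forallP => i; apply/eqP => S'i; have := NS i.
by rewrite (@crit_max i S) ?eqxx // -S'i.
Qed.

Lemma cone_off_facet i : cone_off K noncritical (Some @: crit i).
Proof. by rewrite /cone_off (negPf (None_Some _)) old_Some. Qed.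

Lemma cone_off_max i S : cone_off K noncritical S -> Some @: crit i \subset S ->
  S = Some @: crit i.
Proof.
rewrite /cone_off => + /[dup] iS /old_subset; rewrite old_Some => + iS'.
case: ifPn => [NS|NS KS]; last first.
  by rewrite -(crit_max KS iS') Some_old.
case/orP => [/eqP S0|/andP[KS /forallP/(_ i)]].
  by move: iS'; rewrite S0 subset0 (negPf (crit0 i)).
by rewrite (crit_max KS iS') eqxx.
Qed.

(** Outside its open facets the new complex is a cone with apex [None], which is what the
    contraction onto a wedge requires. *)
Lemma cone_off_cone S : cone_off K noncritical S -> (forall i, S != Some @: crit i) ->
  cone_off K noncritical (None |: S).
Proof.
rewrite /cone_off in_setU1 eqxx /= old_U old_None set0U.
case: ifPn => // NS KS Si; apply/orP; right; rewrite /noncritical KS.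
apply/forallP => i; apply: contra (Si i) => /eqP <-; by rewrite Some_old.
Qed.

End Facets.
End ConeOff.

Lemma cyc_clique_down n k : down_closed (@cyc_clique n k).
Proof.
move=> S S' /cyc_cliqueP[_ SS] sub S0; apply/cyc_cliqueP; split=> // x y xS yS.
by apply: SS; exact: (subsetP sub).
Qed.

Lemma grid_down n (RC : {set 'I_n} -> bool) T : down_closed RC -> down_closed (grid RC T).
Proof.
move=> dRC S S' /gridP[_ SRC] sub S0; apply/gridP; split=> //.
case: SRC => [[d [/in_lineP SL RS]]|/in_triP[d [p [Tp Sp]]]].
  left; exists d; split; first by apply/in_lineP => p q pS qS; apply: SL; exact: (subsetP sub).
  by apply: dRC RS _ _; [exact: imsetS|rewrite imset_eq0].
by right; apply/in_triP; exists d, p; split=> //; exact: subset_trans Sp.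
Qed.

Lemma VR_simplex_down n r : down_closed (@VR_simplex n r).
Proof.
move=> S S' /andP[_ /forall_inP SS] sub S0; rewrite /VR_simplex S0.
apply/forall_inP => p pS; apply/forall_inP => q qS.
by move/forall_inP: (SS p (subsetP sub p pS)); apply; exact: (subsetP sub).
Qed.

(** * The list of critical simplices and their dimensions *)

Section Assembly.
Variables (n : nat) (RC : {set 'I_n} -> bool) (caps : seq {set 'I_n}).
Hypothesis n_gt2 : 2 < n.
Hypothesis RC2 : forall X a, X != set0 -> X \subset [set a; shift a 1] -> RC X.
Hypothesis caps_uniq : uniq caps.
Hypothesis RCcap : forall X, X \in caps -> RC X.
Hypothesis card_cap : forall X, X \in caps -> #|X| = 4.
Hypothesis cap_max : forall X Y, X \in caps -> RC Y -> X \subset Y -> Y = X.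
Hypothesis collapses_caps :
  collapses (fun X => RC X && (X \notin caps)) (@lin_cliques n 1).
Implicit Types (d : bool) (p q : 'I_n * 'I_n) (S : {set 'I_n * 'I_n}) (X Y : {set 'I_n}).

(** [caps] will be empty for k = 2 and hold one tetrahedron for k at least 3. The triangles come
    first, in agreement with the order of the spheres in [wsph_dim]. *)
Definition critical : seq {set 'I_n * 'I_n} :=
  [seq tri true p | p <- enum [pred p | ~~ inner p]] ++
  [seq on_line e.1 e.2 @: X | X <- caps, e <- enum {: bool * 'I_n}].

Lemma criticalP S :
  reflect ((exists2 p, ~~ inner p & S = tri true p) \/
           exists d j, exists2 X, X \in caps & S = on_line d j @: X)
          (S \in critical).
Proof.
rewrite mem_cat; apply: (iffP orP) => -[].
- by case/mapP => p; rewrite mem_enum => pI ->; left; exists p.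
- by case/allpairsP => -[X [d j]] /= [XC _ ->]; right; exists d, j, X.
- by case=> p pI ->; left; apply: map_f; rewrite mem_enum.
- case=> d [j [X XC ->]]; right.
  by apply: (allpairs_f (fun X e => on_line e.1 e.2 @: X) XC (y := (d, j))); rewrite mem_enum.
Qed.

Lemma on_line_inj d j : injective (@on_line n d j).
Proof. by move=> x y /(congr1 (along d)); rewrite !along_on_line. Qed.

Lemma card_cap_line d j X : X \in caps -> #|on_line d j @: X| = 4.
Proof. by move=> XC; rewrite card_imset ?card_cap //; exact: on_line_inj. Qed.

Lemma cap_line_direction d d' j X S : X \in caps -> on_line d j @: X \subset S ->
  in_line d' S -> d' = d.
Proof.
move=> XC sub /in_lineP SL; apply/eqP; apply: contraT => dd.
have : #|X| <= 1.
  apply/card_le1_eqP => x y xX yX.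
  have d'E : d' = ~~ d by case: d d' dd {sub SL} => [] [].
  have := SL _ _ (subsetP sub _ (imset_f _ xX)) (subsetP sub _ (imset_f _ yX)).
  by rewrite d'E !across_negb_on_line.
by rewrite card_cap.
Qed.

Lemma line_of d S : S != set0 -> in_line d S -> exists j, S = on_line d j @: (along d @: S).
Proof.
move=> /set0Pn[p pS] /in_lineP SL; exists (across d p); apply/setP => q.
apply/idP/imsetP => [qS|[x /imsetP[q' q'S ->] ->]].
  exists (along d q); first exact: imset_f.
  by rewrite -(SL _ _ qS pS) on_lineK.
by rewrite -(SL _ _ q'S pS) on_lineK.
Qed.

Lemma in_tri_card T S : in_tri T S -> #|S| <= 3.
Proof.
by move=> /in_triP[d [p [_ Sp]]]; rewrite -(card_tri n_gt2 d p); exact: subset_leq_card.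
Qed.

Lemma grid_critical S : S \in critical -> grid RC xpredT S.
Proof.
case/criticalP => [[p _ ->]|[d [j [X XC ->]]]].
  apply/gridP; split; first by rewrite -card_gt0 card_tri.
  by right; apply/in_triP; exists true, p.
by apply: grid_on_line (RCcap XC); rewrite -card_gt0 card_cap.
Qed.

Lemma critical_max S S' : S \in critical -> grid RC xpredT S' -> S \subset S' -> S' = S.
Proof.
case/criticalP => [[p _ ->]|[d [j [X XC ->]]]] GS sub.
  have [|| _ [d Sd]] := grid_diag n_gt2 GS (p := p); try by apply: (subsetP sub); rewrite !inE eqxx ?orbT.
  have td : tri true p = tri d p.
    apply/eqP; rewrite eqEcard !card_tri // leqnn andbT; exact: subset_trans Sd.
  by apply/eqP; rewrite eqEsubset sub andbT td.
have [S0 [[d' [SL RS]]|/in_tri_card]] := gridP _ _ _ GS; last first.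
  by move/(leq_trans (subset_leq_card sub)); rewrite card_cap_line.
have d'd := cap_line_direction XC sub SL; subst d'; have [j' S'E] := line_of S0 SL.
suff E : along d @: S' = X.
  move: sub; rewrite S'E E => sub; apply/esym/eqP; rewrite eqEcard sub.
  by rewrite !card_cap_line.
by apply: cap_max RS _ => //; rewrite -(along_on_line_imset d j X) imsetS.
Qed.

Lemma critical_uniq : uniq critical.
Proof.
rewrite cat_uniq; apply/and3P; split.
- rewrite map_inj_uniq ?enum_uniq // => p q E; apply: (diag_sub_tri n_gt2 (d := true)).
    by rewrite -E !inE eqxx.
  by rewrite -E !inE eqxx !orbT.
- apply/hasPn => S /allpairsP[[X [d j]] /= [XC _ ->]]; apply/mapP => -[p _ E].
  by have := card_cap_line d j XC; rewrite E card_tri.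
- apply: allpairs_uniq => //; first exact: enum_uniq.
  move=> [X [d j]] [Y [e i]] /allpairsP[[X' [d' j']] [/= XC _ [-> -> ->]]].
  move=> /allpairsP[[Y' [e' i']] [/= YC _ [-> -> ->]]] /= E.
  have de : e' = d'.
    by apply: (cap_line_direction (j := j') XC _ (in_line_on_line e' i' Y')); rewrite E.
  subst e'; have XY : X' = Y' by rewrite -(along_on_line_imset d' j' X') E along_on_line_imset.
  subst Y'; congr (_, (_, _)); have /set0Pn[x xX] : X' != set0 by rewrite -card_gt0 card_cap.
  have : on_line d' j' x \in on_line d' i' @: X' by rewrite -E imset_f.
  by case/imsetP => y _ /(congr1 (across d')); rewrite !across_on_line.
Qed.

Lemma card_not_inner : #|[pred p : 'I_n * 'I_n | ~~ inner p]| = 2 * n - 1.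
Proof.
case: n n_gt2 => // m m2; pose P := [pred x : 'I_m.+1 | x != ord_max].
have cP : #|P| = m by rewrite cardC1 card_ord.
have -> : #|[pred p : 'I_m.+1 * 'I_m.+1 | ~~ inner p]| = #|[predC [predX P & P]]|.
  apply: eq_card => -[x y]; rewrite !inE /inner /=; congr (~~ _).
  by rewrite !ord_eqE /=; have := ltn_ord x; have := ltn_ord y; lia.
have := cardC [predX P & P]; rewrite cardX cP card_prod !card_ord.
by rewrite (_ : m.+1 * m.+1 = m * m + (2 * m.+1 - 1)); [move/addnI|nia].
Qed.

Lemma nth_critical_lt i : i < 2 * n - 1 -> #|nth set0 critical i| = 3.
Proof.
move=> i_lt; rewrite nth_cat size_map -cardE card_not_inner i_lt.
have : nth set0 [seq tri true p | p <- enum [pred p | ~~ inner p]] i \in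
    [seq tri true p | p <- enum [pred p | ~~ inner p]].
  by apply: mem_nth; rewrite size_map -cardE card_not_inner.
by case/mapP => p _ ->; exact: card_tri.
Qed.

Lemma size_critical : size critical = 2 * n - 1 + size caps * (2 * n).
Proof.
rewrite size_cat size_map -cardE card_not_inner size_allpairs -cardE.
by rewrite card_prod card_bool card_ord.
Qed.

Lemma nth_critical_ge i : 2 * n - 1 <= i < size critical -> #|nth set0 critical i| = 4.
Proof.
rewrite size_critical => /andP[i_ge i_lt].
rewrite nth_cat size_map -cardE card_not_inner ltnNge i_ge /=.
set r := [seq _ | X <- caps, e <- _]; set j := i - _.
have : nth set0 r j \in r.
  apply: mem_nth; rewrite size_allpairs -cardE card_prod card_bool card_ord /j.
  by rewrite ltn_subLR.
by case/allpairsP => -[X [d i']] /= [XC _ ->]; exact: card_cap_line.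
Qed.

Lemma collapses_not_critical (t : 'I_n) : t + 1 = n ->
  collapses (fun S => grid RC xpredT S && (S \notin critical)) (fun S => S == [set (t, t)]).
Proof.
move=> tn; apply: collapses_trans (collapses_noncritical n_gt2 tn _ collapses_caps).
  apply: collapses_eq => S; apply/andP/andP => -[GS NS]; last split.
  - split; last first.
      apply/forallP => p; apply/implyP => pI; apply: contra NS => /eqP ->.
      by apply/criticalP; left; exists p.
    have [S0 [[d [SL RS]]|ST]] := gridP _ _ _ GS; apply/gridP; split=> //; [left|by right].
    exists d; split=> //; rewrite RS; apply: contra NS => XC.
    by have [j ->] := line_of S0 SL; apply/criticalP; right; exists d, j, (along d @: S).
  - have [S0 [[d [SL /andP[RS _]]]|ST]] := gridP _ _ _ GS; apply/gridP; split=> //; [left|by right].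
    by exists d.
  - apply/criticalP => -[[p pI SE]|[d [j [X XC SE]]]].
      by move/forallP/(_ p): NS; rewrite pI SE eqxx.
    have [S0 [[d' [SL /andP[_ /negP]]]|/in_tri_card]] := gridP _ _ _ GS; last first.
      by rewrite SE card_cap_line.
    have -> : d' = d by apply: cap_line_direction XC _ SL; rewrite SE.
    by rewrite SE along_on_line_imset.
move=> X a X0 sub; rewrite (RC2 X0 sub); apply/negP => /card_cap X4.
have := subset_leq_card sub; rewrite X4 cards2; by case: (_ == _).
Qed.

End Assembly.

(** Any two vertices of the 5-cycle are within distance 2, so the complex is a full simplex, written
    as [lin_cliques] with bound 4. *)
Lemma collapses_cyc_clique5 :
  collapses (fun X => @cyc_clique 5 2 X && (X \notin [::])) (@lin_cliques 5 1).
Proof.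
apply: collapses_trans (@collapses_lin 5 4 isT); apply: collapses_eq => X; rewrite andbT.
rewrite /cyc_clique /lin_cliques; congr andb.
by apply: eq_forallb => x; congr implb; apply: eq_forallb => y; congr implb;
  case: x => -[|[|[|[|[|]]]]] // ?; case: y => -[|[|[|[|[|]]]]].
Qed.

Lemma cyc_clique_edge n k (X : {set 'I_n}) a : 2 < n -> 0 < k -> X != set0 ->
  X \subset [set a; shift a 1] -> cyc_clique k X.
Proof.
move=> n2 k0 X0 sub; apply/cyc_cliqueP; split=> // x y xX yX.
have sh z : z \in X -> exists2 e, e <= 1 & z = shift a e.
  move=> /(subsetP sub); rewrite !inE => /orP[/eqP->|/eqP->]; [exists 0|exists 1] => //.
  by rewrite shift0.
have [e e1 ->] := sh x xX; have [f f1 ->] := sh y yX.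
by rewrite cyc_dist_shift ?cyc_dist_le; nlia.
Qed.

Section Tetrahedron.
Variables (n k : nat) (z : 'I_n).
Hypotheses (Hn : n = 3 * k - 1) (Hk : 3 <= k) (Hz : z = 0 :> nat).

Lemma card_wtetra : #|wtetra k z| = 4.
Proof.
rewrite /wtetra cardsU1 (shift1_notin_wtri Hn Hk Hz); congr (1 + _).
by rewrite /wtri -setUA cardsU1 cards2 !inE !(eq_sym z) !shift_eq0 ?shift_eq; nlia.
Qed.

Lemma wtetra_clique : cyc_clique k (wtetra k z).
Proof.
apply/cyc_cliqueP; split; first by rewrite -card_gt0 card_wtetra.
move=> x y; have [d dn ->] := shift_surj z x; have [e en ->] := shift_surj z y.
rewrite !(mem_wtetra Hn Hk Hz) // cyc_dist_shift ?cyc_dist_le; nlia.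
Qed.

Lemma wtetra_max (X : {set 'I_n}) : cyc_clique k X -> wtetra k z \subset X -> X = wtetra k z.
Proof.
move=> KX sub; apply/eqP; rewrite eqEsubset sub andbT; apply/subsetP => x.
exact: (wtetra_link Hn Hk Hz).
Qed.

Lemma collapses_cyc_clique :
  collapses (fun X => cyc_clique k X && (X \notin [:: wtetra k z])) (@lin_cliques n 1).
Proof.
apply: collapses_trans (collapses_cycle Hn Hk Hz).
by apply: collapses_eq => X; rewrite inE.
Qed.

End Tetrahedron.

From mathcomp Require Import all_boot all_order all_algebra.
From mathcomp Require Import all_classical all_reals all_analysis.
From mathcomp Require Import wedge_sigT ring lra.
Import Order.TTheory GRing.Theory Num.Theory.
Import numFieldTopology.Exports numFieldNormedType.Exports.
Local Open Scope classical_set_scope.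
Local Open Scope ring_scope.

(** * Continuity and homotopy *)

Section RealContinuity.
Variables (R : realType) (T : topologicalType).
Implicit Types f g : T -> R^o.

Lemma continuous_add f g : continuous f -> continuous g -> continuous (fun x => f x + g x : R^o).
Proof. by move=> cf cg x; apply: (@continuousD _ _ _ f g) => //; [exact: cf|exact: cg]. Qed.

Lemma continuous_opp f : continuous f -> continuous (fun x => - f x : R^o).
Proof. by move=> cf x; apply: (@continuousN _ _ _ f); exact: cf. Qed.

Lemma continuous_sub f g : continuous f -> continuous g -> continuous (fun x => f x - g x : R^o).
Proof. by move=> cf cg; apply: continuous_add => //; exact: continuous_opp. Qed.

Lemma continuous_mul f g : continuous f -> continuous g -> continuous (fun x => f x * g x : R^o).
Proof. by move=> cf cg x; apply: (@continuousM R _ f g); [exact: cf|exact: cg]. Qed.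

Lemma continuous_inv f : (forall x, f x != 0) -> continuous f ->
  continuous (fun x => (f x)^-1 : R^o).
Proof. by move=> f0 cf x; apply: (@continuousV R _ f); [exact: f0|exact: cf]. Qed.

Lemma continuous_minr f g : continuous f -> continuous g ->
  continuous (fun x => Num.min (f x) (g x) : R^o).
Proof. by move=> cf cg x; apply: (@continuous_min R _ f g); [exact: cf|exact: cg]. Qed.

Lemma continuous_maxr f g : continuous f -> continuous g ->
  continuous (fun x => Num.max (f x) (g x) : R^o).
Proof. by move=> cf cg x; apply: (@continuous_max R _ f g); [exact: cf|exact: cg]. Qed.

Lemma continuous_cst (a : R) : continuous ((fun=> a) : T -> R^o).
Proof. exact: cst_continuous. Qed.

Lemma continuous_sum (I : Type) (r : seq I) (P : pred I) (F : I -> T -> R^o) :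
  (forall i, continuous (F i)) -> continuous (fun x => \sum_(i <- r | P i) F i x : R^o).
Proof.
move=> cF; elim: r => [|i r IH].
  rewrite (_ : (fun x => _) = fun=> 0 : R^o); first exact: continuous_cst.
  by apply/funext => x; rewrite big_nil.
rewrite (_ : (fun x => _) = fun x => (if P i then F i x else 0) + \sum_(j <- r | P j) F j x : R^o).
  by apply: continuous_add => //; case: (P i) => //; exact: continuous_cst.
by apply/funext => x; rewrite big_cons; case: ifP => // _; rewrite add0r.
Qed.

Lemma continuous_bigmin (I : Type) (r : seq I) (P : pred I) (a : R) (F : I -> T -> R^o) :
  (forall i, continuous (F i)) ->
  continuous (fun x => \big[Num.min/a]_(i <- r | P i) F i x : R^o).
Proof.
move=> cF; elim: r => [|i r IH].
  rewrite (_ : (fun x => _) = fun=> a : R^o); first exact: continuous_cst.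
  by apply/funext => x; rewrite big_nil.
case Pi : (P i); last first.
  rewrite (_ : (fun x => _) = fun x => \big[Num.min/a]_(j <- r | P j) F j x : R^o) //.
  by apply/funext => x; rewrite big_cons Pi.
rewrite (_ : (fun x => _) =
    fun x => Num.min (F i x) (\big[Num.min/a]_(j <- r | P j) F j x) : R^o).
  exact: continuous_minr.
by apply/funext => x; rewrite big_cons Pi.
Qed.

End RealContinuity.

Section Homotopy.
Variable R : realType.
Local Notation I := (unit_interval R).

Lemma set_val_continuous (T : topologicalType) (A : set T) :
  continuous (set_val : set_type A -> T).
Proof. exact: initial_continuous. Qed.

Lemma continuous_set_type (X T : topologicalType) (A : set T) (f : X -> set_type A) :
  continuous (fun x => set_val (f x)) -> continuous f.
Proof. by move=> cf; apply: continuous_comp_initial. Qed.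

Lemma interval_ge0 (s : I) : 0 <= set_val s :> R.
Proof. by have := set_valP s; rewrite /= in_itv /= => /andP[]. Qed.

Lemma interval_le1 (s : I) : set_val s <= 1 :> R.
Proof. by have := set_valP s; rewrite /= in_itv /= => /andP[]. Qed.

(** Clamping makes a reparametrization total, so that both halves of a concatenated homotopy are
    continuous on the whole cylinder before they are glued. *)
Definition to_interval (a : R) : I :=
  exist _ (Num.min 1 (Num.max 0 a) : R^o) (mem_set (ltac:(
    rewrite /= in_itv /= ge_min lexx le_min ler01 le_max lexx //) :
    `[0, 1]%classic (Num.min 1 (Num.max 0 a)))).

Lemma set_val_to_interval a : 0 <= a <= 1 -> set_val (to_interval a) = a.
Proof.
by move=> /andP[a0 a1]; rewrite /to_interval set_valE /= max_r // min_r.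
Qed.

Lemma continuous_to_interval (T : topologicalType) (f : T -> R^o) :
  continuous f -> continuous (fun x => to_interval (f x)).
Proof.
move=> cf; apply: continuous_set_type.
rewrite (_ : (fun x => _) = fun x => Num.min 1 (Num.max 0 (f x)) : R^o) //.
by apply: continuous_minr; [exact: continuous_cst|apply: continuous_maxr => //; exact: continuous_cst].
Qed.

Lemma continuous_pair (X Y Z : topologicalType) (f : X -> Y) (g : X -> Z) :
  continuous f -> continuous g -> continuous (fun x => (f x, g x)).
Proof. by move=> cf cg x; apply: cvg_pair; [exact: cf|exact: cg]. Qed.

Lemma fst_continuous (X Y : topologicalType) : continuous (@fst X Y).
Proof. by move=> x; exact: cvg_fst. Qed.

Lemma snd_continuous (X Y : topologicalType) : continuous (@snd X Y).
Proof. by move=> x; exact: cvg_snd. Qed.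

Lemma continuous_compose (X Y Z : topologicalType) (f : X -> Y) (g : Y -> Z) :
  continuous f -> continuous g -> continuous (fun x => g (f x)).
Proof. by move=> cf cg x; apply: continuous_comp; [exact: cf|exact: cg]. Qed.

Lemma continuous_glue (X Y : topologicalType) (A B : set X) (f g h : X -> Y) :
  closed A -> closed B -> A `|` B = setT -> continuous f -> continuous g ->
  (forall x, A x -> h x = f x) -> (forall x, B x -> h x = g x) -> continuous h.
Proof.
move=> cA cB AB cf cg hf hg; apply/continuous_subspace_setT; rewrite -AB.
apply: withinU_continuous => //.
  apply: (subspace_eq_continuous (f := f)); first by move=> x /set_mem /hf /esym.
  exact: continuous_subspaceT.
apply: (subspace_eq_continuous (f := g)); first by move=> x /set_mem /hg /esym.
exact: continuous_subspaceT.
Qed.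

Lemma homotopic_trans (X Y : topologicalType) (f g h : X -> Y) :
  homotopic R X Y f g -> homotopic R X Y g h -> homotopic R X Y f h.
Proof.
move=> [H [cH [H0 H1]]] [K [cK [K0 K1]]].
pose u (p : I * X) : R^o := set_val p.1.
have cu : continuous u.
  apply: continuous_compose; first exact: fst_continuous.
  exact: set_val_continuous.
pose F (p : I * X) := H (to_interval (2 * u p), p.2).
pose G (p : I * X) := K (to_interval (2 * u p - 1), p.2).
exists (fun p => if u p <= 2^-1 then F p else G p); split; last split.
- apply: (continuous_glue (A := [set p | u p <= 2^-1]) (B := [set p | 2^-1 <= u p])
    (f := F) (g := G)).
  + exact: (preimage_closed (f := u) (D := [set x : R^o | x <= 2^-1])
      (fun x _ => cu x) (@closed_le R _)).
  + exact: (preimage_closed (f := u) (D := [set x : R^o | x >= 2^-1])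
      (fun x _ => cu x) (@closed_ge R _)).
  + by apply/seteqP; split=> // p _ /=; case: (leP (u p)) => ?; [left|right; exact: ltW].
  + apply: continuous_compose cH; apply: continuous_pair; last exact: snd_continuous.
    by apply: continuous_to_interval; apply: continuous_mul => //; exact: continuous_cst.
  + apply: continuous_compose cK; apply: continuous_pair; last exact: snd_continuous.
    apply: continuous_to_interval; apply: continuous_sub; last exact: continuous_cst.
    by apply: continuous_mul => //; exact: continuous_cst.
  + by move=> p /= ->.
  + move=> p /= pge; case: ifP => // ple; have pE : u p = 2^-1 by apply/le_anti; rewrite ple.
    rewrite /F /G pE mulfV ?pnatr_eq0 // subrr H1; last by rewrite set_val_to_interval ?ler01 ?lexx.
    by rewrite K0 // set_val_to_interval // lexx ler01.
- move=> s x s0; rewrite /u /= s0 invr_ge0 ler0n /F /u /= s0 mulr0.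
  by rewrite H0 // set_val_to_interval // lexx ler01.
- move=> s x s1; rewrite /u /= s1 lt_geF ?invf_lt1 ?ltr1n ?ltr0n // /G /u /= s1.
  rewrite mulr1 (_ : 2 - 1 = 1 :> R) ?K1 //; last by rewrite -(natrB _ (leqnSn 1)).
  by rewrite set_val_to_interval // lexx ler01.
Qed.

Lemma homotopic_eq (X Y : topologicalType) (f g : X -> Y) :
  continuous f -> f =1 g -> homotopic R X Y f g.
Proof.
move=> cf fg; exists (fun p => f p.2); split=> //.
  by apply: continuous_compose cf; exact: snd_continuous.
Qed.

Lemma homotopic_comp (X Y Y' Z : topologicalType) (f : X -> Y) (g g' : Y -> Y') (h : Y' -> Z) :
  continuous f -> continuous h -> homotopic R Y Y' g g' ->
  homotopic R X Z (fun x => h (g (f x))) (fun x => h (g' (f x))).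
Proof.
move=> cf ch [H [cH [H0 H1]]]; exists (fun p => h (H (p.1, f p.2))); split; last split.
- apply: continuous_compose ch; apply: continuous_compose cH.
  apply: continuous_pair; first exact: fst_continuous.
  by apply: continuous_compose cf; exact: snd_continuous.
- by move=> s x s0 /=; rewrite H0.
- by move=> s x s1 /=; rewrite H1.
Qed.

Lemma homotopy_equivalent_trans (X Y Z : topologicalType) :
  homotopy_equivalent R X Y -> homotopy_equivalent R Y Z -> homotopy_equivalent R X Z.
Proof.
move=> [f [g [cf cg gf fg]]] [f' [g' [cf' cg' gf' fg']]].
exists (f' \o f), (g \o g'); split.
- exact: continuous_compose cf'.
- exact: continuous_compose cg.
- apply: homotopic_trans gf; exact: (homotopic_comp cf cg gf').
- apply: homotopic_trans fg'; exact: (homotopic_comp cg' cf' fg).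
Qed.

Lemma homotopy_equivalent_sym (X Y : topologicalType) :
  homotopy_equivalent R X Y -> homotopy_equivalent R Y X.
Proof. by move=> [f [g [cf cg gf fg]]]; exists g, f; split. Qed.

Lemma homotopy_equivalent_homeo (X Y : topologicalType) (f : X -> Y) (g : Y -> X) :
  continuous f -> continuous g -> cancel f g -> cancel g f -> homotopy_equivalent R X Y.
Proof.
move=> cf cg fK gK; exists f, g; split=> //; apply: homotopic_eq => //.
- exact: continuous_compose cg.
- exact: continuous_compose cf.
Qed.

End Homotopy.

(** * Geometric realizations *)

Section Compactness.

Lemma set_type_compact (T : topologicalType) (A : set T) :
  compact A -> compact [set: set_type A].
Proof.
move=> cA F PF _.
have FA : (set_val @ F) A.
  by apply: (@filterS _ F _ setT) => [x _|]; [exact: set_valP|exact: filterT].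
have [p [Ap cp]] := cA _ (fmap_proper_filter _ PF) FA.
exists (exist _ p (mem_set Ap)); split=> // B U FB [V [[W oW <-] Wp] WU].
have FB' : (set_val @ F) (set_val @` B).
  by apply: (@filterS _ F _ B) FB => x Bx; exists x.
have Wn : nbhs p W by apply: open_nbhs_nbhs.
have [_ [[b Bb <-] Wb]] := cp _ _ FB' Wn.
by exists b; split=> //; apply: WU.
Qed.

Lemma hausdorff_inj (X Y : topologicalType) (f : X -> Y) :
  continuous f -> injective f -> hausdorff_space Y -> hausdorff_space X.
Proof.
move=> cf fI hY x y clxy; apply/fI/hY => U V /cf nU /cf nV.
by have [z [Uz Vz]] := clxy _ _ nU nV; exists (f z).
Qed.

Lemma hausdorff_pair (X Y : topologicalType) :
  hausdorff_space X -> hausdorff_space Y -> hausdorff_space (X * Y)%type.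
Proof.
move=> hX hY [x y] [x' y'] cl; congr pair.
  apply: hX => U V nU nV; have [||z [Uz Vz]] := cl (fst @^-1` U) (fst @^-1` V).
  - exact: (@fst_continuous _ _ (x, y)).
  - exact: (@fst_continuous _ _ (x', y')).
  - by exists z.1.
apply: hY => U V nU nV; have [||z [Uz Vz]] := cl (snd @^-1` U) (snd @^-1` V).
- exact: (@snd_continuous _ _ (x, y)).
- exact: (@snd_continuous _ _ (x', y')).
- by exists z.2.
Qed.

(** A continuous surjection from a compact space onto a Hausdorff space is closed, hence a quotient
    map. *)
Lemma quotient_lift (X W Z : topologicalType) (f : X -> W) (k : X -> Z) :
  compact [set: X] -> hausdorff_space W -> continuous f -> (forall w, exists x, f x = w) ->
  continuous k -> (forall x y, f x = f y -> k x = k y) ->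
  exists2 h : W -> Z, continuous h & forall x, h (f x) = k x.
Proof.
move=> cX hW cf fS ck fk; pose g w := sval (cid (fS w)).
have fg w : f (g w) = w by rewrite /g; case: cid.
exists (k \o g) => [|x]; last by apply: fk; rewrite fg.
apply/continuous_closedP => C cC.
have -> : (k \o g) @^-1` C = f @` (k @^-1` C).
  apply/seteqP; split=> [w Cw|_ [x Cx <-]] /=; first by exists (g w).
  by rewrite (fk _ x) ?fg.
apply: compact_closed => //; apply: continuous_compact; first exact: continuous_subspaceT.
apply: (subclosed_compact _ cX) => //.
by move/continuous_closedP: ck; exact.
Qed.

Lemma interval_compact (R : realType) : compact [set: unit_interval R].
Proof. by apply: set_type_compact; exact: (@segment_compact R). Qed.

Lemma interval_hausdorff (R : realType) : hausdorff_space (unit_interval R).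
Proof.
apply: hausdorff_inj (@set_val_continuous _ _) _ (@norm_hausdorff _ R^o).
exact: val_inj.
Qed.

(** The end of the homotopy is constant on the fibres of [f] and descends to an inverse. All its
    stages respect the fibres, so it also descends to [W]; for this [quotient_lift] is applied to
    the product of [f] with the interval, again a map from a compact onto a Hausdorff space. *)
Lemma homotopy_equivalent_quotient (R : realType) (X W : topologicalType) (f : X -> W)
    (H : (unit_interval R * X)%type -> X) :
  compact [set: X] -> hausdorff_space W -> continuous f -> (forall w, exists x, f x = w) ->
  continuous H -> (forall s x, set_val s = 0 -> H (s, x) = x) ->
  (forall s x y, f x = f y -> f (H (s, x)) = f (H (s, y))) ->
  (forall s x y, set_val s = 1 -> f x = f y -> H (s, x) = H (s, y)) ->
  homotopy_equivalent R X W.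
Proof.
move=> cX hW cf fS cH H0 fH fH1.
have one : 0 <= (1 : R) <= 1 by rewrite ler01 lexx.
have zero : 0 <= (0 : R) <= 1 by rewrite ler01 lexx.
pose i1 := to_interval (1 : R); have i1E : set_val i1 = 1 := set_val_to_interval one.
have cc (Y : topologicalType) (y : Y) : continuous ((fun=> y) : X -> Y) := @cst_continuous _ _ y.
have [g cg gf] : exists2 g : W -> X, continuous g & forall x, g (f x) = H (i1, x).
  apply: (quotient_lift cX hW cf fS); last by move=> x y; exact: fH1.
  by apply: continuous_compose cH; apply: continuous_pair => // x; exact: cvg_id.
pose F (p : unit_interval R * X) := (p.1, f p.2).
have cF : continuous F.
  apply: continuous_pair; first exact: fst_continuous.
  by apply: continuous_compose cf; exact: snd_continuous.
have [h ch hF] : exists2 h : (unit_interval R * W)%type -> W, continuous h &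
    forall p, h (F p) = f (H p).
  apply: (quotient_lift _ _ cF).
  - by rewrite -setXTT; apply: compact_setX => //; exact: interval_compact.
  - by apply: hausdorff_pair => //; exact: interval_hausdorff.
  - by move=> [s w]; have [x xw] := fS w; exists (s, x); rewrite /F /= xw.
  - exact: continuous_compose cf.
  - by move=> [s x] [s' y] [/= <-]; exact: fH.
have hid : forall s w, set_val s = 0 -> h (s, w) = w.
  by move=> s w s0; have [x <-] := fS w; have := hF (s, x); rewrite /F /= => ->; rewrite H0.
have h1 : forall s w, set_val s = 1 -> h (s, w) = f (g w).
  move=> s w s1; have [x <-] := fS w; have := hF (s, x); rewrite /F /= => ->.
  by rewrite gf (_ : s = i1) //; apply: val_inj; rewrite -!set_valE i1E.
(* The homotopies built so far start at the identity, while [homotopy_equivalent] asks for ones that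
   end there. *)
pose rev (s : unit_interval R) := to_interval (1 - set_val s).
have crev : continuous rev.
  apply: continuous_to_interval; apply: continuous_sub; first exact: continuous_cst.
  exact: set_val_continuous.
have revE s : set_val (rev s) = 1 - set_val s.
  apply: set_val_to_interval; have := interval_ge0 s; have := interval_le1 s.
  by rewrite subr_ge0 lerBlDr lerDl => -> ->.
have crevp (Y : topologicalType) : continuous (fun p : unit_interval R * Y => (rev p.1, p.2)).
  apply: continuous_pair; last exact: snd_continuous.
  by apply: continuous_compose crev; exact: fst_continuous.
exists f, g; split=> //.
- exists (fun p => H (rev p.1, p.2)); split; first exact: (continuous_compose (crevp X) cH).
  split=> s x sE /=; last by rewrite H0 // revE sE subrr.
  rewrite gf (_ : rev s = i1) //; apply: val_inj.
  by rewrite -!set_valE i1E revE sE subr0.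
- exists (fun p => h (rev p.1, p.2)); split; first exact: (continuous_compose (crevp W) ch).
  split=> s w sE /=; last by rewrite hid // revE sE subrr.
  by rewrite h1 // revE sE subr0.
Qed.

End Compactness.

(** * Realizations of finite complexes, and collapses as deformations *)

Section Realization.
Variables (R : realType) (V : finType).
Implicit Types (K : {set V} -> bool) (s S : {set V}) (w v : V).
Local Notation point := {ptws V -> R^o}.

Definition support (t : V -> R) : {set V} := [set v | t v != 0]%SET.

Definition geom_set K : set point :=
  [set t | (forall v, 0 <= t v) /\ (\sum_v t v = 1) /\ K (support t)].

Definition geom K : topologicalType := set_type (geom_set K).

Definition coord K (x : geom K) v : R^o := (set_val x : V -> R^o) v.

Lemma coord_ge0 K (x : geom K) v : 0 <= coord x v.
Proof. by have [h _] := set_valP x; exact: h. Qed.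

Lemma coord_sum K (x : geom K) : \sum_v coord x v = 1.
Proof. by have [_ [h _]] := set_valP x. Qed.


Lemma ptws_continuous (X : topologicalType) (f : X -> point) :
  (forall v, continuous (fun x => f x v : R^o)) -> continuous f.
Proof.
move=> cf x; apply/cvg_sup => v.
exact: (@continuous_comp_initial _ X R^o (fun t : V -> R^o => t v) f (cf v)).
Qed.

Lemma geom_continuous (X : topologicalType) K (f : X -> geom K) :
  (forall v, continuous (fun x => coord (f x) v)) -> continuous f.
Proof. by move=> cf; apply: continuous_set_type; apply: ptws_continuous. Qed.

Lemma continuous_coord K v : continuous (fun x : geom K => coord x v).
Proof.
exact: (continuous_compose (@set_val_continuous _ (geom_set K))
  (@proj_continuous V (fun=> R^o) v)).
Qed.

Lemma coord_inj K (x y : geom K) : (forall v, coord x v = coord y v) -> x = y.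
Proof. by move=> xy; apply: val_inj; apply/funext => v; exact: xy. Qed.

Definition geom_point K (t : V -> R) (Kt : geom_set K t) : geom K :=
  exist _ (t : point) (mem_set Kt).

Lemma coord_geom_point K t (Kt : geom_set K t) v : coord (geom_point Kt) v = t v.
Proof. by []. Qed.

Lemma support_neq0 (t : V -> R) : \sum_v t v = 1 -> support t != finset.set0.
Proof.
move=> t1; apply/negP => /eqP s0; move: t1; rewrite big1.
  by move/eqP; rewrite eq_sym oner_eq0.
move=> v _; apply/eqP; have : v \notin support t by rewrite s0 inE.
by rewrite inE negbK.
Qed.

Lemma geom_compact K : down_closed K -> compact [set: geom K].
Proof.
move=> dK; apply: set_type_compact.
(* [D t] is the least weight that [t] has outside a simplex, so [D t <= 0] is a closed way to say
   that the support lies in some simplex. The default 1 makes the condition fail if there are no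
   simplices. *)
pose D (t : point) : R^o := \big[Num.min/1]_(S : {set V} | K S) \sum_(v | v \notin S) t v.
have cproj v : continuous (fun t : point => t v : R^o) := @proj_continuous V (fun=> R^o) v.
have cD : continuous D.
  by apply: continuous_bigmin => S; apply: continuous_sum.
have cS : continuous (fun t : point => \sum_v t v : R^o) by apply: continuous_sum.
have -> : geom_set K = [set t : point | forall v, `[0, 1]%classic (t v)] `&`
    ([set t | \sum_v t v = 1] `&` [set t | D t <= 0]).
  apply/seteqP; split=> t /=.
    move=> [t0 [t1 Kt]]; split; last split=> //.
      move=> v; rewrite in_itv /= t0 /= -t1 (bigD1 v) //= lerDl.
      by apply: sumr_ge0.
    apply: (le_trans (bigmin_le_cond _ _ Kt)); rewrite big1 // => v.
    by rewrite inE negbK => /eqP.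
  move=> [t01 [t1]]; have t0 v : 0 <= t v by have := t01 v; rewrite in_itv /= => /andP[].
  move/bigmin_leP => [|[S KS St]]; first by rewrite ler10.
  split=> //; split=> //; apply: (dK S) => //; last exact: support_neq0.
  apply/fintype.subsetP => v; rewrite inE; apply: contraNT => vS.
  rewrite eq_le t0 andbT; apply: le_trans St; rewrite (bigD1 v) //= lerDl.
  by apply: sumr_ge0.
apply: compact_closedI.
  exact: (@tychonoff V (fun=> R^o) (fun=> `[0, 1]%classic) (fun v => @segment_compact R 0 1)).
apply: closedI.
  exact: (preimage_closed (D := [set x : R^o | x = 1]) (fun x _ => cS x) (@closed_eq R 1)).
exact: (preimage_closed (D := [set x : R^o | x <= 0]) (fun x _ => cD x) (@closed_le R 0)).
Qed.

Section Collapse.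
Variables (K : {set V} -> bool) (s : {set V}) (w : V).
Hypotheses (dK : down_closed K) (s0 : s != finset.set0) (ws : w \notin s).
Hypothesis Kw : forall S, K S -> s \subset S -> K (w |: S)%SET.

Definition low (t : V -> R) : R := \big[Num.min/1]_(v in s) t v.

(** At [a = 1] a lightest vertex of [s] loses all its weight, and nothing ever moves where [s] is
    not in the support. This yields a deformation retraction onto the complex without the star of
    [s]. *)
Definition push (a : R) (t : V -> R) : V -> R :=
  fun v => t v - a * low t * ((v \in s)%:R - #|s|%:R * (v == w)%:R).

Local Notation K' := (fun S => K S && ~~ (s \subset S)).

Lemma low_le t v : v \in s -> low t <= t v.
Proof. by move=> vs; exact: bigmin_le_cond. Qed.

Lemma low_ge0 t : (forall v, 0 <= t v) -> 0 <= low t.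
Proof. by move=> t0; apply: le_bigmin => //; exact: ler01. Qed.

Lemma low_eq0 (t : V -> R) : (forall v, 0 <= t v) -> ~~ (s \subset support t) -> low t = 0.
Proof.
move=> t0 /subsetPn[v vs]; rewrite inE negbK => /eqP tv.
by apply/le_anti; rewrite low_ge0 // andbT -tv low_le.
Qed.

Lemma low_attained (t : V -> R) : (forall v, 0 <= t v) -> \sum_v t v = 1 ->
  exists2 v, v \in s & t v = low t.
Proof.
move=> t0 t1; have /bigmin_leP := lexx (low t) => -[|[v vs tv]]; last first.
  by exists v => //; apply/le_anti; rewrite tv low_le.
have [v vs] := set0Pn _ s0 => l1; exists v => //.
apply/le_anti; rewrite low_le // andbT; apply: le_trans l1.
by rewrite -t1 (bigD1 v) //= lerDl; apply: sumr_ge0.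
Qed.

Lemma pushP a t : 0 <= a <= 1 -> geom_set K t -> geom_set K (push a t).
Proof.
move=> /andP[a0 a1] [t0 [t1 Kt]].
have l0 := low_ge0 t0.
have p1 : \sum_v push a t v = 1.
  rewrite /push sumrB t1 -mulr_sumr sumrB -mulr_sumr.
  have -> : \sum_v (v \in s)%:R = #|s|%:R :> R.
    by rewrite -natr_sum -sum1_card [in RHS]big_mkcond /=; congr (_%:R).
  have -> : \sum_v (v == w)%:R = 1 :> R.
    by rewrite (bigD1 w) //= eqxx big1 ?addr0 // => v /negPf ->.
  by rewrite mulr1 subrr mulr0 subr0.
split; last split=> //.
  move=> v; rewrite /push; have [vs|vs] := boolP (v \in s).
    have -> : (v == w) = false by apply: contraNF ws => /eqP <-.
    rewrite mulr0 subr0 mulr1 subr_ge0; apply: le_trans (low_le t vs).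
    by rewrite ler_piMl.
  rewrite sub0r mulrN opprK addr_ge0 // mulr_ge0 ?mulr_ge0 //.
have [l00|lN0] := eqVneq (low t) 0.
  by rewrite (_ : push a t = t) //; apply/funext => v; rewrite /push l00 mulr0 mul0r subr0.
have sS : s \subset support t by apply: contraNT lN0 => h; rewrite low_eq0.
apply: dK (Kw Kt sS) _ (support_neq0 p1).
apply/fintype.subsetP => v; rewrite in_setU1 !inE; apply: contraR.
rewrite negb_or negbK => /andP[vw /eqP tv].
rewrite /push tv (negPf vw) mulr0 subr0 sub0r oppr_eq0.
suff -> : (v \in s) = false by rewrite mulr0.
by apply: contraTF sS => vs; apply/subsetPn; exists v => //; rewrite inE tv eqxx.
Qed.

Lemma push1P t : geom_set K t -> geom_set K' (push 1 t).
Proof.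
move=> Kt; have [p0 [p1 Kp]] := pushP (ltac:(rewrite ler01 lexx //) : 0 <= 1 <= 1) Kt.
split=> //; split=> //; rewrite Kp /=; have [t0 [t1 _]] := Kt.
have [v vs tv] := low_attained t0 t1; apply/subsetPn; exists v => //.
rewrite inE negbK /push vs tv (_ : (v == w) = false); last first.
  by apply: contraNF ws => /eqP <-.
by rewrite mulr0 subr0 mulr1 mul1r subrr.
Qed.

Lemma push_id a t : geom_set K' t -> push a t = t.
Proof.
move=> [t0 [t1 /andP[_ sS]]]; apply/funext => v.
by rewrite /push low_eq0 // mulr0 mul0r subr0.
Qed.

Lemma push_continuous (X : topologicalType) (a : X -> R^o) (t : X -> V -> R) :
  continuous a -> (forall v, continuous (fun x => t x v : R^o)) ->
  forall v, continuous (fun x => push (a x) (t x) v : R^o).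
Proof.
move=> ca ct v; apply: continuous_sub => //; apply: continuous_mul; last exact: continuous_cst.
by apply: continuous_mul => //; exact: continuous_bigmin.
Qed.

Lemma homotopy_equivalent_collapse_step : homotopy_equivalent R (geom K) (geom K').
Proof.
have sub t : geom_set K' t -> geom_set K t by move=> [t0 [t1 /andP[Kt _]]].
pose f (x : geom K) : geom K' := geom_point (push1P (set_valP x)).
pose g (x : geom K') : geom K := geom_point (sub _ (set_valP x)).
have a01 (u : unit_interval R) : 0 <= 1 - (set_val u : R) <= 1.
  by have := interval_ge0 u; have := interval_le1 u; rewrite subr_ge0 lerBlDr lerDl => -> ->.
have cf : continuous f.
  apply: geom_continuous => v; apply: (push_continuous (a := fun=> 1)).
    exact: continuous_cst.
  by move=> ?; exact: continuous_coord.
have cg : continuous g by apply: geom_continuous => v; exact: continuous_coord.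
exists f, g; split=> //.
- exists (fun p => geom_point (pushP (a01 p.1) (set_valP p.2))); split; last split.
  + apply: geom_continuous => v.
    apply: (push_continuous (a := fun p : unit_interval R * geom K => 1 - set_val p.1 : R^o)
      (t := fun p => coord p.2)).
      apply: continuous_sub; first exact: continuous_cst.
      exact: (continuous_compose (@fst_continuous _ _) (@set_val_continuous _ _)).
    by move=> u; exact: (continuous_compose (@snd_continuous _ _) (@continuous_coord K u)).
  + move=> u x u0; apply: coord_inj => v; rewrite /coord /= !set_valE /=.
    by move: u0; rewrite set_valE => ->; rewrite subr0.
  + move=> u x u1; apply: coord_inj => v; rewrite /coord /= !set_valE /=.
    by move: u1; rewrite set_valE => ->; rewrite subrr /push !mul0r subr0.
- apply: homotopic_eq; first exact: (continuous_compose cg cf).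
  move=> x; apply: coord_inj => v /=.
  exact: (congr1 (@^~ v) (push_id 1 (set_valP x))).
Qed.

End Collapse.

Lemma down_closed_avoid K s : down_closed K -> down_closed (fun S => K S && ~~ (s \subset S)).
Proof.
move=> dK S S' /andP[KS sS] SS S0; rewrite (dK S) //=.
by apply: contra sS => sS'; exact: fintype.subset_trans SS.
Qed.

Lemma homotopy_equivalent_collapses K L : down_closed K -> collapses K L ->
  homotopy_equivalent R (geom K) (geom L).
Proof.
move=> dK col; elim: col dK => {K L} [K L KL dK|K L s w s0 ws Kw _ IH dK].
  rewrite (_ : L = K); last by apply/funext => S; rewrite KL.
  by apply: (@homotopy_equivalent_homeo R _ _ id id) => // x; exact: cvg_id.
apply: (homotopy_equivalent_trans _ (IH (down_closed_avoid dK))).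
exact: (homotopy_equivalent_collapse_step dK s0 ws Kw).
Qed.

End Realization.

(** * Simplices and spheres *)

(* The quotient map of a simplex onto a sphere collapsing the boundary, in
   barycentric coordinates: the interior is identified with [R^d] by
   [j |-> (x j - x 0) / m], where [m] is the least coordinate, and then with the
   sphere minus a point by inverse stereographic projection.  The summand
   [(1 - \sum_j x j) ^+ 2] vanishes on the simplex; it extends the map to all
   points with vanishing [m]. *)
Section SimplexSphere.
Variables (R : realType) (d : nat).
Implicit Types x y : 'I_d.+1 -> R.

Definition least x : R := \big[Num.min/1]_j x j.
Definition offset x j : R := x j - x ord0.
Definition size2 x : R := \sum_j offset x j ^+ 2 + (1 - \sum_j x j) ^+ 2.
(** For [u = offset x / least x] and a point of the simplex this is
    [(2 u + (|u|^2 - 1) e_0) / (|u|^2 + 1)], multiplied through by [least x ^+ 2] so that it also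
    makes sense on the boundary, where it is the pole [e_0]. *)
Definition stereo x : 'rV[R^o]_d.+1 :=
  \row_j ((2 * least x * offset x j + (j == ord0)%:R * (size2 x - least x ^+ 2))
          / (size2 x + least x ^+ 2)).

Lemma least_le x j : least x <= x j. Proof. exact: bigmin_le. Qed.

Lemma least_ge0 x : (forall j, 0 <= x j) -> 0 <= least x.
Proof. by move=> x0; apply: le_bigmin => //; exact: ler01. Qed.

Lemma least_attained x : (forall j, 0 <= x j) -> \sum_j x j = 1 -> exists j, x j = least x.
Proof.
move=> x0 x1; have /bigmin_leP := lexx (least x) => -[l1|[j _ xj]]; last first.
  by exists j; apply/le_anti; rewrite xj least_le.
exists ord0; apply/le_anti; rewrite least_le andbT; apply: le_trans l1.
by rewrite -x1 (bigD1 ord0) //= lerDl; apply: sumr_ge0.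
Qed.

Lemma size2_ge0 x : 0 <= size2 x.
Proof. by apply: addr_ge0; [apply: sumr_ge0 => j _|]; exact: sqr_ge0. Qed.

(** If both terms vanished, all coordinates would be equal, with minimum 0 and sum 1. *)
Lemma stereo_den x : (forall j, 0 <= x j) -> 0 < size2 x + least x ^+ 2.
Proof.
move=> x0; rewrite lt_neqAle addr_ge0 ?sqr_ge0 ?size2_ge0 // andbT eq_sym.
rewrite paddr_eq0 ?sqr_ge0 ?size2_ge0 // sqrf_eq0; apply/negP => /andP[].
rewrite paddr_eq0 ?sqr_ge0 //; last by apply: sumr_ge0 => j _; exact: sqr_ge0.
rewrite psumr_eq0; last by move=> j _; exact: sqr_ge0.
move=> /andP[/allP o0]; rewrite sqrf_eq0 subr_eq0 => /eqP x1 /eqP l0.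
have [j xj] := least_attained x0 (esym x1).
have E i : x i = x ord0.
  by have := o0 i (mem_index_enum _); rewrite sqrf_eq0 subr_eq0 => /eqP.
move/eqP: x1; rewrite big1 ?oner_eq0 // => i _.
by rewrite E -(E j) xj l0.
Qed.

Lemma offset0 x : offset x ord0 = 0. Proof. exact: subrr. Qed.

(** The squares of the coordinates bring in the sum of the [offset x j ^+ 2] instead of [size2 x].
    The two agree when the coordinates sum to 1, and otherwise their difference is multiplied by
    [least x = 0]. *)
Lemma stereo_sphere x : (forall j, 0 <= x j) -> (least x = 0 \/ \sum_j x j = 1) ->
  sphere_set R d (stereo x).
Proof.
move=> x0 lx; have D0 := lt0r_neq0 (stereo_den x0).
rewrite /sphere_set /=; under eq_bigr do rewrite mxE expr_div_n.
rewrite -mulr_suml.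
have -> : \sum_j (2 * least x * offset x j + (j == ord0)%:R * (size2 x - least x ^+ 2)) ^+ 2
   = (2 * least x) ^+ 2 * \sum_j offset x j ^+ 2 + (size2 x - least x ^+ 2) ^+ 2.
  rewrite mulr_sumr (bigD1 ord0) //= [in RHS](bigD1 ord0) //= offset0 !mul1r.
  rewrite mulr0 add0r expr0n /= mulr0 add0r addrC; congr (_ + _).
  by apply: eq_bigr => j /negPf ->; rewrite mul0r addr0 exprMn.
have -> : (2 * least x) ^+ 2 * \sum_j offset x j ^+ 2 = (2 * least x) ^+ 2 * size2 x.
  by case: lx => [->|x1]; rewrite ?mulr0 ?expr0n ?mul0r // /size2 x1 subrr expr0n addr0.
apply: (@mulIf _ ((size2 x + least x ^+ 2) ^+ 2)); first by rewrite expf_neq0.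
by rewrite mulfVK ?expf_neq0 // mul1r; ring.
Qed.

Lemma stereo_base x : (forall j, 0 <= x j) -> least x = 0 -> stereo x = sphere_pt_vec R d.
Proof.
move=> x0 l0; have D0 := lt0r_neq0 (stereo_den x0).
apply/rowP => j; rewrite !mxE l0 mulr0 mul0r add0r expr0n /= subr0 addr0.
by rewrite -mulrA divff ?mulr1 //; move: D0; rewrite l0 expr0n addr0.
Qed.

Lemma stereo0 x : (forall j, 0 <= x j) ->
  1 - stereo x ord0 ord0 = 2 * least x ^+ 2 / (size2 x + least x ^+ 2).
Proof.
move=> x0; have D0 := lt0r_neq0 (stereo_den x0).
by rewrite mxE eqxx offset0 mulr0 add0r mul1r; field.
Qed.

Lemma stereo_nbase x : (forall j, 0 <= x j) -> stereo x = sphere_pt_vec R d -> least x = 0.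
Proof.
move=> x0 E; have D0 := lt0r_neq0 (stereo_den x0).
have := stereo0 x0; rewrite E mxE eqxx subrr => /esym/eqP.
by rewrite mulf_eq0 invr_eq0 (negPf D0) orbF mulf_eq0 pnatr_eq0 /= sqrf_eq0 => /eqP.
Qed.

Lemma stereo_ratio x j : (forall j, 0 <= x j) -> 0 < least x ->
  offset x j / least x = (j != ord0)%:R * stereo x ord0 j / (1 - stereo x ord0 ord0).
Proof.
move=> x0 l0; have D0 := lt0r_neq0 (stereo_den x0); have l0' := lt0r_neq0 l0.
rewrite stereo0 // mxE; have [->|j0] := eqVneq j ord0; first by rewrite offset0 !mul0r.
by rewrite /= mul0r addr0 mul1r; field; rewrite l0' D0.
Qed.

(** The image determines the ratios of offsets to minimum. Comparison at the indices where the two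
    minima are attained shows that [x] is a multiple of [y], and equal sums force the factor to be
    1. *)
Lemma stereo_inj x y : (forall j, 0 <= x j) -> (forall j, 0 <= y j) ->
  \sum_j x j = 1 -> \sum_j y j = 1 -> 0 < least x -> 0 < least y ->
  stereo x = stereo y -> x =1 y.
Proof.
move=> x0 y0 x1 y1 lx ly E.
have lx' := lt0r_neq0 lx; have ly' := lt0r_neq0 ly.
have rat j : offset x j / least x = offset y j / least y.
  by rewrite !stereo_ratio // E.
pose c := least x / least y.
have c0 : 0 < c by rewrite divr_gt0.
have off j : x j - x ord0 = c * (y j - y ord0).
  rewrite -[LHS](divfK lx') -/(offset x j) rat /c /offset; by field.
have [jx ljx] := least_attained x0 x1; have [jy ljy] := least_attained y0 y1.
have e1 : x ord0 = c * y ord0.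
  have cl : c * least y = least x by rewrite /c divfK.
  have h1 : c * y ord0 <= x ord0.
    have := least_le x jy; have := off jy.
    have -> : c * (y jy - y ord0) = least x - c * y ord0 by rewrite mulrBr ljy cl.
    lra.
  have h2 : x ord0 <= c * y ord0.
    have : c * least y <= c * y jx by rewrite ler_pM2l // least_le.
    have := off jx; rewrite mulrBr ljx cl; lra.
  by apply/le_anti; rewrite h1 h2.
have xc j : x j = c * y j by have := off j; rewrite e1 mulrBr; lra.
have c1 : c = 1.
  by rewrite -x1 (eq_bigr (fun j => c * y j)) -?mulr_sumr ?y1 ?mulr1.
by move=> j; rewrite xc c1 mul1r.
Qed.

Lemma stereo_surj (y : 'rV[R^o]_d.+1) : sphere_set R d y -> y != sphere_pt_vec R d ->
  exists x, [/\ forall j, 0 <= x j, \sum_j x j = 1, 0 < least x & stereo x = y].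
Proof.
move=> y1 yN; pose y0 : R := y ord0 ord0.
have yS : \sum_(j | j != ord0) y ord0 j ^+ 2 = 1 - y0 ^+ 2.
  by move: y1; rewrite /sphere_set /= (bigD1 ord0) //= => <-; rewrite /y0 addrAC subrr add0r.
have y01 : 0 < 1 - y0.
  have sq : y0 ^+ 2 <= 1.
    by rewrite -subr_ge0 -yS; apply: sumr_ge0 => j _; exact: sqr_ge0.
  have le1 : y0 <= 1 by rewrite leNgt; apply/negP => h; nra.
  rewrite subr_gt0 lt_neqAle le1 andbT; apply: contra yN => /eqP e1.
  have all0 j : j != ord0 -> y ord0 j = 0.
    move=> j0; have /eqP := yS; rewrite e1 expr1n subrr psumr_eq0; last by move=> ? _; exact: sqr_ge0.
    by move=> /allP /(_ j (mem_index_enum _)); rewrite j0 /= sqrf_eq0 => /eqP.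
  apply/eqP/rowP => j; rewrite mxE; have [->|/all0->//] := eqVneq j ord0.
  exact: e1.
have y01' := lt0r_neq0 y01.
(* [z] is the stereographic projection of [y]. Adding [1 - mu] raises its minimum to 1, and dividing
   by the sum [T] gives barycentric coordinates with minimum [T^-1]. The default 0 in [mu] is itself
   a value, [z ord0]. *)
pose z j : R := (j != ord0)%:R * y ord0 j / (1 - y0).
pose mu : R := \big[Num.min/0]_j z j.
pose xt j : R := 1 - mu + z j.
have z0 : z ord0 = 0 by rewrite /z eqxx !mul0r.
have mule j : mu <= z j by exact: bigmin_le.
have xt1 j : 1 <= xt j by rewrite /xt; have := mule j; lra.
pose T : R := \sum_j xt j.
have T0 : 0 < T.
  rewrite /T (bigD1 ord0) //= ltr_wpDr //; last exact: lt_le_trans (xt1 _).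
  by apply: sumr_ge0 => j _; exact: le_trans (xt1 _).
have T0' := lt0r_neq0 T0.
pose x j : R := xt j / T.
have x0 j : 0 <= x j by rewrite divr_ge0 // ?ltW //; exact: lt_le_trans (xt1 j).
have x1 : \sum_j x j = 1 by rewrite /x -mulr_suml divff.
have [j0 zj0] : exists j, z j = mu.
  have /bigmin_leP := lexx mu => -[m0|[j _ zj]]; last first.
    by exists j; apply/le_anti; rewrite zj mule.
  by exists ord0; apply/le_anti; rewrite mule z0 m0.
have lx : least x = T^-1.
  apply/le_anti/andP; split.
    apply: le_trans (least_le x j0) _; rewrite /x /xt zj0 subrK mul1r //.
  apply: le_bigmin => [|j _].
    rewrite invf_le1 // (le_trans (xt1 ord0)) // /T (bigD1 ord0) //= lerDl.
    by apply: sumr_ge0 => j _; exact: le_trans (xt1 _).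
  by rewrite /x ler_pdivlMr // mulVf.
exists x; split=> //; first by rewrite lx invr_gt0.
have ofx j : offset x j = z j / T by rewrite /offset /x /xt z0 -mulrBl addr0 addrAC subrr add0r.
have Z : \sum_j z j ^+ 2 = (1 + y0) / (1 - y0).
  rewrite (bigD1 ord0) //= z0 expr0n add0r.
  rewrite (eq_bigr (fun j => y ord0 j ^+ 2 / (1 - y0) ^+ 2)); last first.
    by move=> j j0'; rewrite /z j0' mul1r expr_div_n.
  by rewrite -mulr_suml yS; field.
have sz : size2 x = (1 + y0) / (1 - y0) / T ^+ 2.
  rewrite /size2 x1 subrr expr0n addr0 -Z mulr_suml; apply: eq_bigr => j _.
  by rewrite ofx expr_div_n.
have y2 : 1 + y0 + (1 - y0) != 0 by rewrite addrACA subrr addr0 (_ : 1 + 1 = 2%:R) ?pnatr_eq0 // -natrD.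
apply/rowP => j; rewrite mxE sz lx ofx /z.
have [->|jN] := eqVneq j ord0.
  by rewrite /= !mul0r mulr0 add0r mul1r -/y0; field; rewrite T0' y01' /= ?andbT; lra.
by rewrite /= mul0r addr0 mul1r; field; rewrite T0' y01' /= ?andbT; lra.
Qed.

End SimplexSphere.

Section MatrixSpace.
Variable R : realType.

Lemma continuous_matrix (T : topologicalType) m n (f : T -> 'M[R^o]_(m, n)) :
  (forall i j, continuous (fun x => f x i j : R^o)) -> continuous f.
Proof.
move=> cf x A [P PM PA].
have : \forall y \near x, forall i j, P i j (f y i j).
  by apply: filter_forall => i; apply: filter_forall => j; apply: cf; exact: PM.
by apply: filterS => y Py; apply: PA.
Qed.

Lemma entry_continuous m n i j : continuous (fun M : 'M[R^o]_(m, n) => M i j : R^o).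
Proof. exact: matrix_normedtype.coord_continuous. Qed.

Lemma matrix_hausdorff m n : hausdorff_space 'M[R^o]_(m, n).
Proof.
move=> M N cl; apply/matrixP => i j; apply: (@norm_hausdorff _ R^o) => U V nU nV.
have [z [Uz Vz]] := cl _ _ (@entry_continuous m n i j M U nU) (@entry_continuous m n i j N V nV).
by exists (z i j).
Qed.

Variable d : nat.

Lemma sphere_hausdorff : hausdorff_space (sphere R d).
Proof.
apply: hausdorff_inj (@set_val_continuous _ _) _ (@matrix_hausdorff _ _).
exact: val_inj.
Qed.

Lemma sphere_compact : compact [set: sphere R d].
Proof.
apply: set_type_compact.
have csq : continuous (fun x : 'rV[R^o]_d.+1 => \sum_i x ord0 i ^+ 2 : R^o).
  apply: continuous_sum => i; under eq_fun do rewrite expr2.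
  by apply: continuous_mul; exact: entry_continuous.
have cS : closed (sphere_set R d).
  exact: (preimage_closed (D := [set x : R^o | x = 1]) (fun x _ => csq x) (@closed_eq R 1)).
apply: (subclosed_compact cS (@rV_compact R^o _ (fun=> `[-1, 1]%classic)
  (fun=> @segment_compact R _ _))) => x /= Sx i.
have : x ord0 i ^+ 2 <= 1.
  by rewrite -Sx (bigD1 i) //= lerDl; apply: sumr_ge0 => j _; exact: sqr_ge0.
rewrite in_itv /= => h; rewrite -ler_norml.
by rewrite -(ler_pXn2r (n := 2)) ?nnegrE ?normr_ge0 // real_normK ?num_real ?expr1n.
Qed.

End MatrixSpace.

(** * Wedges of spheres *)

Lemma continuous_bigmax (R : realType) (T : topologicalType) (I : Type) (r : seq I) (P : pred I)
    (a : R) (F : I -> T -> R^o) :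
  (forall i, continuous (F i)) ->
  continuous (fun x => \big[Num.max/a]_(i <- r | P i) F i x : R^o).
Proof.
move=> cF; rewrite (_ : (fun x => _) = fun x => - \big[Num.min/- a]_(i <- r | P i) (- F i x) : R^o).
  by apply: continuous_opp; apply: continuous_bigmin => i; exact: continuous_opp.
apply/funext => x; rewrite (big_morph (fun y : R => - y) (@oppr_min R) (opprK a)).
by apply: eq_bigr => i _; rewrite opprK.
Qed.

Lemma continuous_prod_topology (I : eqType) (X : I -> topologicalType) (Y : topologicalType)
    (g : Y -> prod_topology X) :
  (forall i, continuous (fun y => g y i)) -> continuous g.
Proof.
move=> cg y; apply/cvg_sup => i.
exact: (@continuous_comp_initial _ _ _ (fun p : prod_topology X => p i) g (cg i)).
Qed.

Lemma least_gt0 (R : realType) d (x : 'I_d.+1 -> R) : (forall j, 0 < x j) -> 0 < least x.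
Proof. by move=> x0; apply: lt_bigmin => //; exact: ltr01. Qed.

Lemma continuous_stereo (R : realType) d (T : topologicalType) (x : T -> 'I_d.+1 -> R) :
  (forall y j, 0 <= x y j) -> (forall j, continuous (fun y => x y j : R^o)) ->
  continuous (fun y => stereo (x y)).
Proof.
move=> x0 cx; apply: continuous_matrix => i j.
have cl : continuous (fun y => least (x y) : R^o) by exact: continuous_bigmin.
have co k : continuous (fun y => offset (x y) k : R^o) by exact: continuous_sub.
have sq (f : T -> R^o) : continuous f -> continuous (fun y => f y ^+ 2 : R^o).
  by move=> cf; under eq_fun do rewrite expr2; exact: continuous_mul.
have cs : continuous (fun y => size2 (x y) : R^o).
  apply: continuous_add; first by apply: continuous_sum => k; exact: sq.
  apply: sq; apply: continuous_sub; first exact: continuous_cst.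
  exact: continuous_sum.
under eq_fun do rewrite mxE.
apply: continuous_mul; last first.
  apply: continuous_inv; last by apply: continuous_add => //; exact: sq.
  by move=> y; exact/lt0r_neq0/stereo_den.
apply: continuous_add.
  by apply: continuous_mul => //; apply: continuous_mul => //; exact: continuous_cst.
apply: continuous_mul; first exact: continuous_cst.
by apply: continuous_sub => //; exact: sq.
Qed.

(** * A complex that is a cone outside its open facets is a wedge of spheres *)

Section Bouquet.
Variables (R : realType) (U : finType) (C : {set U} -> bool).
Variables (I : finType) (dim : I -> nat) (facet : I -> {set U}) (i0 : I) (o : U).
Hypothesis dC : down_closed C.
Hypothesis Cfacet : forall i, C (facet i).
Hypothesis facet_max : forall i S, C S -> facet i \subset S -> S = facet i.
Hypothesis facet_inj : injective facet.
Hypothesis card_facet : forall i, #|facet i| = (dim i).+1.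
Hypothesis o_facet : forall i, o \notin facet i.
Hypothesis Co : C [set o]%SET.
Hypothesis cone : forall S, C S -> (forall i, S != facet i) -> C (o |: S)%SET.
Implicit Types (t : U -> R) (i : I) (x : geom R C).

Let vtx i (j : 'I_(dim i).+1) : U := enum_val (cast_ord (esym (card_facet i)) j).

Let vtx_facet i j : @vtx i j \in facet i. Proof. exact: enum_valP. Qed.

Let vtx_inj i : injective (@vtx i).
Proof. by move=> j j' /enum_val_inj /cast_ord_inj. Qed.

Let vtx_surj i v : v \in facet i -> exists j, v = @vtx i j.
Proof.
move=> vi; exists (cast_ord (card_facet i) (enum_rank_in vi v)).
by rewrite /vtx cast_ordK enum_rankK_in.
Qed.

(** Positive exactly in the open facet [i], so at most one height is positive at a point of the
    complex. *)
Let height i t : R := least (fun j => t (@vtx i j)).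

Let height_ge0 i t : (forall v, 0 <= t v) -> 0 <= height i t.
Proof. by move=> t0; exact: least_ge0. Qed.

Let height_le i t v : v \in facet i -> height i t <= t v.
Proof. by move=> /vtx_surj[j ->]; exact: (least_le (fun j => t (@vtx i j)) j). Qed.

Let height_support i t : geom_set C t -> 0 < height i t -> support t = facet i.
Proof.
move=> [t0 [_ Ct]] h0; apply: facet_max => //; apply/fintype.subsetP => v vi.
by rewrite inE; apply/lt0r_neq0/(lt_le_trans h0)/height_le.
Qed.

Let height_gt0 i t : geom_set C t -> facet i \subset support t -> 0 < height i t.
Proof.
move=> [t0 _] sub; apply: least_gt0 => j; rewrite lt0r t0 andbT.
by have /fintype.subsetP/(_ _ (vtx_facet j)) := sub; rewrite inE.
Qed.

Let height_unique i j t : geom_set C t -> 0 < height i t -> 0 < height j t -> i = j.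
Proof. by move=> Ct hi hj; apply: facet_inj; rewrite -(height_support Ct hi) (height_support Ct hj). Qed.

Let sum_vtx i (t : U -> R) : support t = facet i -> \sum_j t (@vtx i j) = \sum_v t v.
Proof.
move=> st; rewrite [RHS](bigID (fun v => v \in facet i)) /= [X in _ + X]big1 ?addr0; last first.
  by move=> v; rewrite -st inE negbK => /eqP.
rewrite (eq_bigl (fun v => v \in [set @vtx i j | j in 'I_(dim i).+1]%SET)).
  by rewrite big_imset //= => j j' _ _; exact: vtx_inj.
move=> v; apply/idP/imsetP => [/vtx_surj[j ->]|[j _ ->]]; first by exists j.
exact: vtx_facet.
Qed.

Let bary i x j : R := coord x (@vtx i j).

Let bary_sphere i x : sphere_set R (dim i) (stereo (bary (i:=i) x)).
Proof.
apply: stereo_sphere => [j|]; first exact: coord_ge0.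
have [h0|h0] := eqVneq (height i (coord x)) 0; [by left|right].
have hp : 0 < height i (coord x) by rewrite lt0r h0 height_ge0 // => v; exact: coord_ge0.
by rewrite (sum_vtx (height_support (set_valP x) hp)); exact: coord_sum.
Qed.

Let cell i x : sphere R (dim i) := exist _ (stereo (bary (i:=i) x)) (mem_set (bary_sphere i x)).

Let cell_base i x : height i (coord x) = 0 -> cell i x = sphere_pt R (dim i).
Proof.
by move=> h0; apply: val_inj; apply: stereo_base => // j; exact: coord_ge0.
Qed.

Let base_cell i x : cell i x = sphere_pt R (dim i) -> height i (coord x) = 0.
Proof. by move=> /(congr1 val); apply: stereo_nbase => j; exact: coord_ge0. Qed.

Let W : topologicalType :=
  @wedge I (fun i => sphere R (dim i)) (fun i => sphere_pt R (dim i)).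

Let into i (z : sphere R (dim i)) : W :=
  @wedge_lift I (fun i => sphere R (dim i)) (fun i => sphere_pt R (dim i)) i z.

Let top x : option I := [pick i | 0 < height i (coord x)].

Let f x : W :=
  if top x is Some i then into (cell i x) else into (sphere_pt R (dim i0)).

Let height_eq0 i x : ~~ (0 < height i (coord x)) -> height i (coord x) = 0.
Proof.
rewrite lt0r height_ge0 ?andbT ?negbK => [/eqP//|v]; exact: coord_ge0.
Qed.

Let f_prod x : wedge_prod (f x) = fun i => cell i x.
Proof.
apply: functional_extensionality_dep => i.
rewrite /f /top; case: pickP => [j hj|h0].
  rewrite /wedge_prod /into wedge_lift_funE; last by move=> *; exact: wedge_prod_pointE.
  have [ij|ij] := eqVneq j i; first by rewrite -{i}ij dfwithin.
  rewrite dfwithout // cell_base //; apply: height_eq0; apply: contra_neqN ij => hi.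
  exact: height_unique (set_valP x) hj hi.
rewrite /wedge_prod /into wedge_lift_funE; last by move=> *; exact: wedge_prod_pointE.
rewrite cell_base; last by apply: height_eq0; rewrite h0.
have [ij|ij] := eqVneq i0 i; first by rewrite -{i}ij dfwithin.
by rewrite dfwithout.
Qed.

Let W_hausdorff : hausdorff_space W.
Proof. by apply: wedge_hausdorff => i; exact: sphere_hausdorff. Qed.

Let W_compact : compact [set: W].
Proof. by apply: wedge_compact => [|i]; [exact: finite_finset|exact: sphere_compact]. Qed.

Let cell_continuous i : continuous (cell i).
Proof.
apply: continuous_set_type; apply: continuous_stereo => [x j|j]; first exact: coord_ge0.
exact: continuous_coord.
Qed.

(* As the wedge is compact, its map to the product of the spheres is a closed
   embedding, hence it suffices that every coordinate is continuous. *)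
Let f_continuous : continuous f.
Proof.
apply/continuous_closedP => A cA.
pose g x : prod_topology (fun i => sphere R (dim i)) := fun i => cell i x.
have cg : continuous g.
  exact: continuous_prod_topology cell_continuous.
have -> : f @^-1` A =
    g @^-1` (@wedge_prod I (fun i => sphere R (dim i)) (fun i => sphere_pt R (dim i)) @` A).
  apply/seteqP; split=> x /=; first by move=> Afx; exists (f x) => //; exact: f_prod.
  by move=> [w Aw]; rewrite -[g x]f_prod => /wedge_prod_inj <-.
move/continuous_closedP: cg; apply; apply: compact_closed.
  by apply: hausdorff_product => i; exact: sphere_hausdorff.
apply: continuous_compact; last exact: (subclosed_compact cA W_compact).
by apply: continuous_subspaceT; exact: wedge_prod_continuous.
Qed.

Let f_base x : (forall i, height i (coord x) = 0) -> f x = into (sphere_pt R (dim i0)).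
Proof. by move=> h0; rewrite /f /top; case: pickP => // i; rewrite h0 ltxx. Qed.

(** So [f] has just one fibre that can have several points, the part of the complex outside all open
    facets. *)
Let f_eq x y : f x = f y -> x = y \/ (forall i, height i (coord x) = 0 /\ height i (coord y) = 0).
Proof.
move=> fxy.
have cxy i : cell i x = cell i y.
  by have := congr1 (fun w : W => wedge_prod w i) fxy; rewrite !f_prod.
have [/existsP[i hx]|/existsPn h0] := boolP [exists i, 0 < height i (coord x)].
  left; have hy : 0 < height i (coord y).
    rewrite lt0r height_ge0 ?andbT; last by move=> v; exact: coord_ge0.
    apply: contraL hx => /eqP /cell_base; rewrite -cxy => /base_cell ->.
    by rewrite ltxx.
  have sx := height_support (set_valP x) hx; have sy := height_support (set_valP y) hy.
  have E : bary (i:=i) x =1 bary (i:=i) y.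
    apply: stereo_inj => //; try (by move=> j; exact: coord_ge0).
    - by rewrite (sum_vtx sx); exact: coord_sum.
    - by rewrite (sum_vtx sy); exact: coord_sum.
    - exact: (congr1 val (cxy i)).
  apply: coord_inj => v; have [/vtx_surj[j ->]|vi] := boolP (v \in facet i); first exact: E.
  have : v \notin support (coord x) by rewrite sx.
  have : v \notin support (coord y) by rewrite sy.
  by rewrite !inE !negbK => /eqP -> /eqP ->.
right=> i; have hx := height_eq0 (h0 i); split=> //.
by apply: base_cell; rewrite -cxy cell_base.
Qed.

Let f_surj w : exists x, f x = w.
Proof.
have := @wedgeTE I (fun i => sphere R (dim i)) (fun i => sphere_pt R (dim i)).
move=> /seteqP[_ /(_ w Logic.I)] [i _ [z _ <-]].
have [->|zN] := eqVneq z (sphere_pt R (dim i)).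
  (* The base point is hit by the apex [o], which lies in no facet. *)
  have Ko : geom_set C (fun v => (v == o)%:R : R).
    split=> [v|]; first by rewrite ler0n.
    split; first by rewrite (bigD1 o) //= eqxx big1 ?addr0 // => v /negPf ->.
    rewrite (_ : support _ = [set o]%SET) //; apply/setP => v.
    by rewrite !inE pnatr_eq0 eqb0 negbK.
  exists (geom_point Ko); rewrite f_base.
    exact: (@wedge_liftE I (fun i => sphere R (dim i)) (fun i => sphere_pt R (dim i)) i
      (sphere_pt R (dim i)) i0 (sphere_pt R (dim i0))).
  move=> k; apply: height_eq0; apply/negP => hk.
  have /setP/(_ o) := height_support Ko hk; rewrite (negPf (o_facet k)) inE eqxx.
  by rewrite pnatr_eq0.
have [|y [y0 y1 ly yz]] := @stereo_surj R (dim i) (val z) (set_valP z).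
  by apply: contra zN => /eqP zE; apply/eqP/val_inj.
pose t v : R := \sum_j (v == @vtx i j)%:R * y j.
have tv j : t (@vtx i j) = y j.
  rewrite /t (bigD1 j) //= eqxx mul1r big1 ?addr0 // => k kj.
  by rewrite (inj_eq (@vtx_inj i)) eq_sym (negPf kj) mul0r.
have Kt : geom_set C t.
  split=> [v|]; first by apply: sumr_ge0 => j _; rewrite mulr_ge0 ?ler0n.
  split.
    rewrite exchange_big -[RHS]y1 /=; apply: eq_bigr => j _.
    by rewrite -mulr_suml (bigD1 (vtx j)) //= eqxx big1 ?addr0 ?mul1r // => v /negPf ->.
  rewrite (_ : support t = facet i) //; apply/setP => v; rewrite inE.
  apply/idP/idP => [|/vtx_surj[j ->]]; last first.
    by rewrite tv; apply/lt0r_neq0/(lt_le_trans ly)/least_le.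
  apply: contraNT => vi; rewrite /t big1 // => j _.
  by rewrite (_ : (v == _) = false) ?mul0r //; apply: contraNF vi => /eqP ->.
have tE : (fun j => t (@vtx i j)) = y by apply/funext.
have hi : 0 < height i t by rewrite /height tE.
exists (geom_point Kt); rewrite /f /top; case: pickP => [k hk|/(_ i)]; last first.
  by rewrite /= hi.
have ki : k = i by exact: height_unique Kt hk hi.
rewrite {k hk}ki; congr into; apply: val_inj; rewrite /= -yz; congr stereo.
exact: tE.
Qed.

(* [trim s] lowers a point of a facet towards the boundary by at most [s / N] on
   each vertex, and [lift s] is the weight moved to the apex [o]; it is positive only
   where [trim s] reaches the boundary.  The homotopy is [raw s] normalized by its
   mass. *)
Let N : R := #|U|.+1%:R.

Let N_gt0 : 0 < N. Proof. by rewrite ltr0n. Qed.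

Let hump t v : R := \big[Num.max/0]_(i | v \in facet i) height i t.

Let peak t : R := \big[Num.max/0]_i height i t.

Let trim (s : R) t v : R := t v - Num.min (s / N) (hump t v).

Let lift (s : R) t : R := Num.max 0 (s - N * peak t).

Let raw (s : R) t v : R := (1 - lift s t) * trim s t v + lift s t * (v == o)%:R.

Let mass (s : R) t : R := \sum_v raw s t v.

Let hump_ge0 t v : 0 <= hump t v. Proof. exact: bigmax_ge_id. Qed.

Let hump_le t v : (forall v, 0 <= t v) -> hump t v <= t v.
Proof. by move=> t0; apply: bigmax_le => // i vi; exact: height_le. Qed.

Let peak_ge0 t : 0 <= peak t. Proof. exact: bigmax_ge_id. Qed.

Let height_peak i t : height i t <= peak t. Proof. exact: le_bigmax. Qed.

Let trim_ge0 s t v : (forall v, 0 <= t v) -> 0 <= trim s t v.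
Proof. by move=> t0; rewrite subr_ge0 ge_min hump_le ?orbT. Qed.

Let trim_eq0 s t v : 0 <= s -> (forall v, 0 <= t v) -> t v = 0 -> trim s t v = 0.
Proof.
move=> s0 t0 tv; have h0 : hump t v = 0 by apply/le_anti; rewrite hump_ge0 -{1}tv hump_le.
by rewrite /trim tv h0 min_r ?subrr // divr_ge0 // ltW.
Qed.

Let lift_ge0 s t : 0 <= lift s t. Proof. by rewrite le_max lexx. Qed.

Let lift_le s t : 0 <= s -> lift s t <= s.
Proof. by move=> s0; rewrite ge_max s0 lerBlDr lerDl mulr_ge0 // ltW. Qed.

Let raw_ge0 s t v : 0 <= s <= 1 -> (forall v, 0 <= t v) -> 0 <= raw s t v.
Proof.
move=> /andP[s0 s1] t0; apply: addr_ge0; last by rewrite mulr_ge0 ?ler0n.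
by rewrite mulr_ge0 ?trim_ge0 // subr_ge0 (le_trans (lift_le _ _)).
Qed.

Let mass_gt0 s t : 0 <= s <= 1 -> geom_set C t -> 0 < mass s t.
Proof.
move=> s01 [t0 [t1 _]]; have /andP[s0 s1] := s01.
(* Each of the [#|U|] vertices loses at most [s / N], and [N] exceeds [#|U|], so the total loss
   stays below 1. *)
have T0 : 0 < \sum_v trim s t v.
  rewrite /trim sumrB t1 subr_gt0; apply: (@le_lt_trans _ _ (\sum_(v : U) s / N)).
    by apply: ler_sum => v _; rewrite ge_min lexx.
  rewrite sumr_const -mulr_natl mulrA ltr_pdivrMr // mul1r.
  by rewrite (@le_lt_trans _ _ #|U|%:R) ?ltr_nat // ler_piMr.
have -> : mass s t = (1 - lift s t) * (\sum_v trim s t v) + lift s t.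
  rewrite /mass /raw big_split /= -!mulr_sumr; congr (_ + _).
  by rewrite (bigD1 o) //= eqxx big1 ?addr0 ?mulr1 // => v /negPf ->.
have [->|l0] := eqVneq (lift s t) 0; first by rewrite subr0 mul1r addr0.
rewrite ltr_wpDl ?lt0r ?l0 ?lift_ge0 //; apply: mulr_ge0; last exact: ltW.
by rewrite subr_ge0 (le_trans (lift_le _ _)).
Qed.

Let support_trim s t : 0 <= s -> (forall v, 0 <= t v) -> support (trim s t) \subset support t.
Proof.
move=> s0 t0; apply/fintype.subsetP => v; rewrite !inE; apply: contra => /eqP tv.
by rewrite trim_eq0.
Qed.

(** A positive lift means [peak t < s / N], so inside an open facet the full height is trimmed and a
    lowest vertex vanishes. The trimmed support can then be joined with [o]. *)
Let trim_facet s t i : 0 <= s -> geom_set C t -> 0 < lift s t -> support (trim s t) != facet i.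
Proof.
move=> s0 Ct; have [t0 [t1 _]] := Ct; rewrite /lift lt_max ltxx /= subr_gt0 => pk.
apply/eqP => si; have sub : facet i \subset support t by rewrite -si support_trim.
have hi := height_gt0 Ct sub; have st := height_support Ct hi.
have [|j tj] := least_attained (fun j => t0 (@vtx i j)); first by rewrite (sum_vtx st).
have : @vtx i j \notin support (trim s t).
  rewrite inE negbK; apply/eqP/le_anti; rewrite trim_ge0 // andbT subr_le0 tj le_min.
  rewrite ler_pdivlMr // mulrC (le_trans _ (ltW pk)) ?ler_pM2l //; last exact: height_peak.
  by rewrite /=; apply: (le_bigmax_cond 0 (fun i => height i t)); exact: vtx_facet.
by rewrite si vtx_facet.
Qed.

Let squash_set s t : 0 <= s <= 1 -> geom_set C t -> geom_set C (fun v => raw s t v / mass s t).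
Proof.
move=> s01 Ct; have m0 := mass_gt0 s01 Ct; have [t0 [t1 CSt]] := Ct.
have /andP[s0 s1] := s01.
have p1 : \sum_v raw s t v / mass s t = 1 by rewrite -mulr_suml divff // lt0r_neq0.
split=> [v|]; first by rewrite divr_ge0 ?raw_ge0 // ltW.
split=> //; have sN0 := support_neq0 p1.
have sraw (S : {set U}) : (forall v, v \notin S -> raw s t v = 0) ->
    support (fun v => raw s t v / mass s t) \subset S.
  move=> h; apply/fintype.subsetP => v; rewrite inE; apply: contraR => /h ->.
  by rewrite mul0r.
have [l0|l0] := eqVneq (lift s t) 0.
  apply: dC CSt _ sN0; apply: sraw => v; rewrite inE negbK => /eqP tv.
  by rewrite /raw l0 trim_eq0 // mulr0 mul0r addr0.
have lp : 0 < lift s t by rewrite lt0r l0 lift_ge0.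
have sub : support (fun v => raw s t v / mass s t) \subset (o |: support (trim s t))%SET.
  apply: sraw => v; rewrite in_setU1 inE negb_or negbK => /andP[vo /eqP tv].
  by rewrite /raw tv (negPf vo) !mulr0 addr0.
have [e|e] := eqVneq (support (trim s t)) finset.set0.
  by apply: dC Co _ sN0; move: sub; rewrite e finset.setU0.
apply: dC (cone _ _) sub sN0; last by move=> i; exact: trim_facet.
by apply: dC CSt _ e; exact: support_trim.
Qed.

Let unit01 (s : unit_interval R) : 0 <= (set_val s : R) <= 1.
Proof. by rewrite interval_ge0 interval_le1. Qed.

Let squash (p : unit_interval R * geom R C) : geom R C :=
  geom_point (squash_set (unit01 p.1) (set_valP p.2)).

Let squash_continuous : continuous squash.
Proof.
have cs : continuous (fun p : unit_interval R * geom R C => set_val p.1 : R^o).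
  exact: (continuous_compose (@fst_continuous _ _) (@set_val_continuous _ _)).
have cc v : continuous (fun p : unit_interval R * geom R C => coord p.2 v).
  exact: (continuous_compose (@snd_continuous _ _) (@continuous_coord _ _ C v)).
have ch i : continuous (fun p : unit_interval R * geom R C => height i (coord p.2) : R^o).
  by apply: continuous_bigmin => j; exact: cc.
have cl : continuous (fun p : unit_interval R * geom R C => lift (set_val p.1) (coord p.2) : R^o).
  apply: continuous_maxr; first exact: continuous_cst.
  apply: continuous_sub => //; apply: continuous_mul; first exact: continuous_cst.
  exact: continuous_bigmax.
have cr v : continuous (fun p : unit_interval R * geom R C => raw (set_val p.1) (coord p.2) v : R^o).
  apply: continuous_add; apply: continuous_mul => //.
  - by apply: continuous_sub => //; exact: continuous_cst.
  - apply: continuous_sub => //; apply: continuous_minr.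
      by apply: continuous_mul => //; exact: continuous_cst.
    exact: continuous_bigmax.
  - exact: continuous_cst.
apply: geom_continuous => v; apply: continuous_mul => //; apply: continuous_inv.
  by move=> p; apply/lt0r_neq0/mass_gt0; [exact: unit01|exact: set_valP].
exact: continuous_sum.
Qed.

(** Outside the open facets the homotopy is the straight line to [o]; at time 1 the large fibre of
    [f] has become a point. *)
Let raw_low s t : 0 <= s -> (forall i, height i t = 0) ->
  raw s t = fun v => (1 - s) * t v + s * (v == o)%:R.
Proof.
move=> s0 h0; apply/funext => v.
have hz : hump t v = 0.
  by apply/le_anti; rewrite hump_ge0 andbT; apply: bigmax_le => // i _; rewrite h0.
have pz : peak t = 0.
  by apply/le_anti; rewrite peak_ge0 andbT; apply: bigmax_le => // i _; rewrite h0.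
rewrite /raw /trim hz min_r ?subr0; last by rewrite divr_ge0 // ltW.
by rewrite /lift pz mulr0 subr0 max_r.
Qed.

Let mass_low s t : 0 <= s -> \sum_v t v = 1 -> (forall i, height i t = 0) -> mass s t = 1.
Proof.
move=> s0 t1 h0; rewrite /mass raw_low // big_split /= -!mulr_sumr t1 mulr1.
rewrite (bigD1 o) //= eqxx big1 => [|v /negPf -> //].
by rewrite addr0 mulr1 subrK.
Qed.

Let coord_squash_low s x : (forall i, height i (coord x) = 0) ->
  coord (squash (s, x)) = fun v => (1 - set_val s) * coord x v + set_val s * (v == o)%:R.
Proof.
move=> h0; apply/funext => v; rewrite /squash coord_geom_point /=.
rewrite (mass_low _ _ h0) ?divr1; last 2 first.
- exact: interval_ge0.
- exact: coord_sum.
by rewrite (raw_low _ h0) //; exact: interval_ge0.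
Qed.

Let squash_low s x i : (forall i, height i (coord x) = 0) -> height i (coord (squash (s, x))) = 0.
Proof.
move=> h0; apply: height_eq0; apply/negP => hi.
suff : 0 < height i (coord x) by rewrite h0 ltxx.
apply: height_gt0 (set_valP x) _; rewrite -(height_support (set_valP (squash (s, x))) hi).
apply/fintype.subsetP => v; have [->|vo] := eqVneq v o.
  by rewrite (height_support (set_valP (squash (s, x))) hi) (negPf (o_facet i)).
rewrite !inE; apply: contra => /eqP xv.
have : coord (squash (s, x)) v = 0.
  by rewrite coord_squash_low // (negPf vo) (xv : coord x v = 0) !mulr0 addr0.
by move=> /eqP.
Qed.

Theorem homotopy_equivalent_bouquet : homotopy_equivalent R (geom R C) W.
Proof.
apply: (homotopy_equivalent_quotient (H := squash) _ W_hausdorff f_continuous f_surj).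
- exact: geom_compact.
- exact: squash_continuous.
- move=> s x s0; apply: coord_inj => v; rewrite /squash coord_geom_point /= s0.
  have l0 : lift 0 (coord x) = 0 by rewrite /lift sub0r max_l // oppr_le0 mulr_ge0 // ltW.
  have r0 w : raw 0 (coord x) w = coord x w.
    by rewrite /raw l0 /trim mul0r min_l // !subr0 mul1r mul0r addr0.
  rewrite r0 /mass (eq_bigr (coord x)) ?coord_sum ?divr1 // => w _; exact: r0.
- move=> s x y /f_eq[->//|h0]; rewrite !f_base // => i; apply: squash_low => j.
    by have [] := h0 j.
  by have [] := h0 j.
- move=> s x y s1 /f_eq[->//|h0]; apply: coord_inj => v.
  rewrite !coord_squash_low; first by rewrite s1 subrr !mul0r.
    by move=> i; have [] := h0 i.
  by move=> i; have [] := h0 i.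
Qed.

End Bouquet.

Section Wedge.
Variables (R : realType) (V : finType) (K : {set V} -> bool).

Lemma homotopy_equivalent_extend : homotopy_equivalent R (geom R K) (geom R (extend K)).
Proof.
pose ext (t : V -> R) (u : option V) : R := if u is Some v then t v else 0.
have old_support (t : option V -> R) : old (support t) = support (fun v => t (Some v) : R).
  by apply/setP => v; rewrite !inE.
have sum_option (t : option V -> R) : \sum_u t u = t None + \sum_v t (Some v).
  rewrite (bigD1 None) //=; congr (_ + _).
  rewrite (eq_bigl (fun u => u \in [set Some v | v in V]%SET)).
    by rewrite big_imset //= => ? ? _ _ [].
  by case=> [v|]; rewrite ?imset_f //; apply/esym/imsetP => -[].
have extP (t : V -> R) : geom_set K t -> geom_set (extend K) (ext t).
  move=> [t0 [t1 Kt]]; split=> [[v|]|] /=; [exact: t0|exact: lexx|].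
  by split; [rewrite sum_option add0r|rewrite /extend inE eqxx old_support].
have resN (t : option V -> R) : geom_set (extend K) t -> t None = 0.
  by move=> [_ [_ /andP[]]]; rewrite inE negbK => /eqP.
have resP (t : option V -> R) : geom_set (extend K) t -> geom_set K (fun v => t (Some v)).
  move=> Kt; have tN := resN t Kt; move: Kt => [t0 [t1 /andP[_ Kt]]].
  by split=> //; rewrite -old_support; split=> //; rewrite -t1 sum_option tN add0r.
pose f (x : geom R K) := geom_point (extP _ (set_valP x)).
pose g (x : geom R (extend K)) := geom_point (resP _ (set_valP x)).
apply: (@homotopy_equivalent_homeo R _ _ f g).
- apply: geom_continuous => -[v|]; first exact: continuous_coord.
  exact: continuous_cst.
- by apply: geom_continuous => v; exact: continuous_coord.
- by move=> x; apply: coord_inj.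
- move=> x; apply: coord_inj => -[v|] //; exact: (esym (resN (coord x) (set_valP x))).
Qed.

Variables (I : finType) (dim : I -> nat) (crit : I -> {set V}) (i0 : I) (v0 : V).

(** The cone over the noncritical part provides the apex [None] for the bouquet; since that part is
    collapsible, the coned complex collapses back onto the copy [extend K] of [K]. *)
Theorem homotopy_equivalent_wedge :
  down_closed K -> (forall i, K (crit i)) ->
  (forall i S, K S -> crit i \subset S -> S = crit i) ->
  injective crit -> (forall i, #|crit i| = (dim i).+1) ->
  collapses (noncritical K crit) (fun S => S == [set v0]%SET) ->
  homotopy_equivalent R (geom R K)
    (@wedge I (fun i => sphere R (dim i)) (fun i => sphere_pt R (dim i))).
Proof.
move=> dK Kcrit crit_max crit_inj card_crit col.
have crit0 i : crit i != finset.set0 by rewrite -card_gt0 card_crit.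
have dC : down_closed (cone_off K (noncritical K crit)).
  by apply: cone_off_down => //; [exact: noncritical_down|move=> S /andP[]].
apply: homotopy_equivalent_trans homotopy_equivalent_extend _.
apply: homotopy_equivalent_trans.
  apply/homotopy_equivalent_sym/(homotopy_equivalent_collapses R dC).
  exact: collapses_cone_off_point col.
apply: (@homotopy_equivalent_bouquet R _ _ I dim (fun i => [set Some v | v in crit i]%SET) i0 None) => //.
- by move=> i; exact: cone_off_facet.
- by move=> i S; exact: cone_off_max.
- by move=> i j ij; apply: crit_inj; rewrite -(old_Some (crit i)) ij old_Some.
- by move=> i; rewrite card_imset // => ? ? [].
- by move=> i; exact: None_Some.
- by rewrite /cone_off finset.in_set1 eqxx old_None eqxx.
- exact: cone_off_cone.
Qed.

End Wedge.

(** Matrices and functions on pairs carry the same coordinates, and both topologies make continuity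
    a matter of entries, so the two realizations are homeomorphic. *)
Lemma homotopy_equivalent_VR_torus (R : realType) n r :
  homotopy_equivalent R (VR_torus R n r) (geom R (@VR_simplex n r)).
Proof.
pose vec (M : 'M[R]_n) (p : 'I_n * 'I_n) : R := M p.1 p.2.
pose mat (t : 'I_n * 'I_n -> R) : 'M[R^o]_n := \matrix_(i, j) t (i, j).
have matK t : vec (mat t) = t by apply/funext => -[i j]; rewrite /vec mxE.
have vecK M : mat (vec M) = M by apply/matrixP => i j; rewrite mxE.
have sum_vec (M : 'M[R]_n) : \sum_p vec M p = \sum_i \sum_j M i j.
  by rewrite pair_bigA.
have vecP M : VR_real_set R n r M -> geom_set (@VR_simplex n r) (vec M).
  move=> [M0 [M1 KM]]; split=> [p|]; first exact: M0.
  by rewrite sum_vec; split.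
have matP t : geom_set (@VR_simplex n r) t -> VR_real_set R n r (mat t).
  rewrite -{1}(matK t) => -[t0 [t1 Kt]]; split=> [i j|]; first exact: (t0 (i, j)).
  by rewrite -sum_vec; split.
pose f (x : VR_torus R n r) := geom_point (vecP _ (set_valP x)).
pose g (x : geom R (@VR_simplex n r)) : VR_torus R n r :=
  exist _ (mat (coord x)) (mem_set (matP _ (set_valP x))).
apply: (@homotopy_equivalent_homeo R _ _ f g).
- apply: geom_continuous => p.
  exact: (continuous_compose (@set_val_continuous _ (VR_real_set R n r)) (@entry_continuous R n n p.1 p.2)).
- apply: continuous_set_type; apply: continuous_matrix => i j.
  rewrite (_ : (fun x => _) = fun x => coord x (i, j)); first exact: continuous_coord.
  by apply/funext => x; rewrite /= mxE.
- by move=> x; apply: val_inj; exact: vecK.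
- by move=> x; apply: coord_inj => p; exact: (congr1 (@^~ p) (matK (coord x))).
Qed.

Lemma homotopy_equivalent_wedge_spheres (R : realType) n k (caps : seq {set 'I_n}) a b :
  n = (3 * k - 1)%N -> (1 < k)%N -> (2 * n - 1)%N = a -> (size caps * (2 * n))%N = b ->
  uniq caps -> (forall X, X \in caps -> cyc_clique k X) -> (forall X, X \in caps -> #|X| = 4%N) ->
  (forall X Y, X \in caps -> cyc_clique k Y -> X \subset Y -> Y = X) ->
  collapses (fun X => cyc_clique k X && (X \notin caps)) (@lin_cliques n 1) ->
  homotopy_equivalent R (VR_torus R n k) (wedge_spheres R a b).
Proof.
move=> nk k1 na nb caps_uniq RCcap card_cap cap_max col.
have n2 : (2 < n)%N by rewrite nk; lia.
have RC2 := fun X x => @cyc_clique_edge n k X x n2 (ltnW k1).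
have [t tn] : exists t : 'I_n, (t + 1)%N = n.
  clear -n2; case: n n2 => // m _.
  by exists ord_max; rewrite addn1.
apply: homotopy_equivalent_trans (homotopy_equivalent_VR_torus R n k) _.
apply: homotopy_equivalent_trans
  (homotopy_equivalent_collapses R (@VR_simplex_down n k) (collapses_VR nk k1)) _.
have sz : size (critical caps) = (a + b)%N by rewrite size_critical // na nb.
pose crit (i : 'I_(a + b)) := nth finset.set0 (critical caps) i.
have crit_mem i : crit i \in critical caps by apply: mem_nth; rewrite sz.
have i0 : 'I_(a + b) by apply: (@Ordinal _ 0); lia.
apply: (@homotopy_equivalent_wedge R _ _ 'I_(a + b) (wsph_dim a b) crit i0 (t, t)).
- exact/grid_down/cyc_clique_down.
- by move=> i; exact: (grid_critical n2 RCcap card_cap).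
- by move=> i S; exact: (critical_max n2 card_cap cap_max).
- move=> i j /eqP; rewrite nth_uniq ?sz //; last exact: critical_uniq.
  by move=> /eqP; exact: val_inj.
- move=> i; rewrite /wsph_dim; case: ifP => [ia|/negbT ia].
    by apply: nth_critical_lt; rewrite // na.
  by apply: nth_critical_ge; rewrite // na sz ltn_ord andbT leqNgt.
- apply: collapses_trans (collapses_not_critical n2 RC2 card_cap col tn).
  apply: collapses_eq => S; rewrite /noncritical; congr andb.
  apply/forallP/idP => [h|h i]; last by apply: contraNneq h => ->.
  apply/negP => /(nthP finset.set0)[i]; rewrite sz => il E.
  by have := h (Ordinal il); rewrite /crit E eqxx.
Qed.

Theorem theorem5p12 (R : realType) :
  (forall k : nat, (3 <= k)%N ->
     homotopy_equivalent R (VR_torus R (3 * k - 1) k)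
                           (wedge_spheres R (6 * k - 3) (6 * k - 2)))
  /\ homotopy_equivalent R (VR_torus R 5 2) (wedge_spheres R 9 0).
Proof.
split=> [k k3|]; last first.
  by apply: (@homotopy_equivalent_wedge_spheres R 5 2 [::]) => //; exact: collapses_cyc_clique5.
have n0 : (0 < 3 * k - 1)%N by lia.
pose z : 'I_(3 * k - 1) := Ordinal n0.
apply: (@homotopy_equivalent_wedge_spheres R _ k [:: wtetra k z]) => //; try by rewrite /=; lia.
- by move=> X; rewrite inE => /eqP ->; exact: wtetra_clique.
- by move=> X; rewrite inE => /eqP ->; exact: card_wtetra.
- by move=> X Y; rewrite inE => /eqP ->; exact: wtetra_max.
- exact: collapses_cyc_clique.
Qed.
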